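(* Let $A$ be a unital AF-algebra, $A=\overline{\bigcup_{n\in\mathbb N}A_n}^{\|\cdot\|_A}$, where $(A_n)_{n\in\mathbb N}$ is an increasing sequence of finite-dimensional C*-subalgebras of $A$ containing $1_A$ with $A_0=\mathbb C1_A$, and let $\tau$ be a faithful tracial state on $A$. For $n\in\mathbb N$ let $E_n:A\to A_n$ be the unique $\tau$-preserving conditional expectation onto $A_n$. Let $(\beta(n))_{n\in\mathbb N}$ be a sequence in $(0,\infty)$ converging to $0$ and such that $\left(\frac{\beta(n)}{\beta(n-1)}\right)_{n\ge 1}$ converges to $0$. For $a\in A$ let $$L_\beta(a)=\sup\left\{\frac{\|a-E_n(a)\|_A}{\beta(n)}:n\in\mathbb N\right\}.$$ Let $F(x_1,x_2,x_3,x_4)=2(x_1x_4+x_2x_3)$, $G(x,y,z)=F(x,y,z,z)$ and $H(x,y)=F(x,x,y,y)$ on $[0,\infty)^4$, $[0,\infty)^3$, $[0,\infty)^2$ respectively. Let $I$ be a norm-closed two-sided ideal of $A$. For $n\in\mathbb N$ put $I_n=I\cap A_n$ and let $1_n$ be the unit of the finite-dimensional C*-algebra $I_n$. For $\omega\in I$ define $$D_I(\omega)=\max\left\{L_\beta(\omega),\ \|\omega\|_A,\ \sup_{n\in\mathbb N}\frac{\|\omega-\omega1_n\|_A}{\beta(n)}\right\},$$ and let $D_{I_n}$ be the restriction of $D_I$ to $I_n$. Let $\langle\omega,\nu\rangle_I=\omega\nu^*$ for $\omega,\nu\in I$, and let $\langle\cdot,\cdot\rangle_{I_n}$ be the restriction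 of $\langle\cdot,\cdot\rangle_I$ to $I_n$. Then $(F,G,H)$ is an admissible triple; $\Omega^\beta_I=(I,\langle\cdot,\cdot\rangle_I,D_I,A,L_\beta)$ and, for every $n\in\mathbb N$, $\Omega^\beta_{I_n}=(I_n,\langle\cdot,\cdot\rangle_{I_n},D_{I_n},A_n,L_\beta)$ are $(F,G,H)$-metrized quantum vector bundles; and $$\lim_{n\to\infty}\Lambda^{mod}(\Omega^\beta_{I_n},\Omega^\beta_I)=0.$$ In particular, for every $n\ge1$, $$\Lambda^{mod}(\Omega^\beta_{I_n},\Omega^\beta_I)\le\max\{\beta(n),x_n-1\},$$ where $x_n=\max\{1+\beta(n),x_n'\}$ and $x_n'=\max_{m<n}\left\{\frac{2\beta(n)+\beta(m)}{\beta(m)}\right\}$, and $\max\{\beta(n),x_n-1\}\to0$ as $n\to\infty$.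
   Context: Conventions. $\mathbb N$ includes $0$. For a C*-algebra $A$, $sa(A)$ is the set of self-adjoint elements, $S(A)$ the state space, $\mathfrak R a=\frac{a+a^*}2$, $\mathfrak I a=\frac{a-a^*}{2i}$, $a\circ b=\frac{ab+ba}2$, $\{a,b\}=\frac{ab-ba}{2i}$. Seminorms and norms ''defined on a dense subspace'' are extended by the value $+\infty$ outside it; the domain is the set where the value is finite. In $(A,L_\beta)$ and $(A_n,L_\beta)$ the seminorm $L_\beta$ is understood as restricted to $sa(A)$, $sa(A_n)$. If $I_n=\{0\}$ then $1_n=0$. $\mathrm{Haus}_\rho$ denotes the Hausdorff distance between sets for a (pseudo)metric $\rho$. Admissible functions. $F:[0,\infty)^4\to[0,\infty)$ is admissible if it is nondecreasing in each variable (for the coordinatewise order) and $x_1x_4+x_2x_3\le F(x_1,x_2,x_3,x_4)$. A triple $(F,G,H)$ is admissible if $F$ is admissible, $G:[0,\infty)^3\to[0,\infty)$ is coordinatewise nondecreasing with $(x+y)z\le G(x,y,z)$, and $H:[0,\infty)^2\to[0,\infty)$ is coordinatewise nondecreasing with $2xy\le H(x,y)$. Quantum compact metric spaces. For $F$ admissible, an $F$-Leibniz quantum compact metric space $(A,L)$ is a unital C*-algebra $A$ with a seminorm $L$ defined on a dense Jordan-Lie subalgebra $dom(L)$ of $sa(A)$ such that: (1) $\{a\in dom(L):L(a)=0\}=\mathbb R1_A$; (2) $mk_L(\varphi,\psi)=\sup\{|\varphi(a)-\psi(a)|:a\in sa(A),L(a)\le1\}$ metrizes the weak* topology of $S(A)$;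 (3) $\{a\in sa(A):L(a)\le1\}$ is norm closed; (4) $\max\{L(a\circ b),L(\{a,b\})\}\le F(\|a\|_A,\|b\|_A,L(a),L(b))$ for all $a,b\in dom(L)$. Metrized quantum vector bundles. For an admissible triple $(F,G,H)$, an $(F,G,H)$-metrized quantum vector bundle $\Omega=(M,\langle\cdot,\cdot\rangle_M,D_M,A,L)$ consists of an $F$-Leibniz quantum compact metric space $(A,L)$, a left Hilbert C*-module $(M,\langle\cdot,\cdot\rangle_M)$ over $A$ (inner product $A$-linear in the first variable, $M$ complete for $\|\omega\|_M=\sqrt{\|\langle\omega,\omega\rangle_M\|_A}$), and a norm $D_M$ defined on a dense $\mathbb C$-subspace of $M$ such that: (1) $\|\cdot\|_M\le D_M$; (2) $\{\omega\in M:D_M(\omega)\le1\}$ is compact for $\|\cdot\|_M$; (3) $D_M(a\omega)\le G(\|a\|_A,L(a),D_M(\omega))$ for all $a\in sa(A)$, $\omega\in M$; (4) $\max\{L(\mathfrak R\langle\omega,\eta\rangle_M),L(\mathfrak I\langle\omega,\eta\rangle_M)\}\le H(D_M(\omega),D_M(\eta))$ for all $\omega,\eta\in M$. Modular Gromov-Hausdorff propinquity $\Lambda^{mod}$ (Latrémolière). Fix an admissible triple $(F,G,H)$. For $\Omega=(M,\langle\cdot,\cdot\rangle_M,D_M,A,L)$ let $\mathcal D_1(\Omega)=\{\omega\in M:D_M(\omega)\le1\}$ and $k_\Omega(\omega,\eta)=\sup\{\|\langle\omega,\xi\rangle_M-\langle\eta,\xi\rangle_M\|_A:\xi\in\mathcal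 D_1(\Omega)\}$. Let $\Omega_A=(M,\langle\cdot,\cdot\rangle_M,D_M,A,L_A)$ and $\Omega_B=(N,\langle\cdot,\cdot\rangle_N,D_N,B,L_B)$ be $(F,G,H)$-metrized quantum vector bundles. A modular bridge $\gamma$ from $\Omega_A$ to $\Omega_B$ consists of a unital C*-algebra $E$; an element $x\in E$ with $\|x\|_E\le1$ such that $S_1(E|x)=\{\varphi\in S(E):\varphi((1_E-x)^*(1_E-x))=\varphi((1_E-x)(1_E-x)^* )=0\}$ is nonempty; unital injective *-homomorphisms $\pi_A:A\to E$ and $\pi_B:B\to E$; a nonempty set $J$; and families $(\omega_j)_{j\in J}$ in $\mathcal D_1(\Omega_A)$ and $(\eta_j)_{j\in J}$ in $\mathcal D_1(\Omega_B)$. Put $bn_\gamma(a,b)=\|\pi_A(a)x-x\pi_B(b)\|_E$ and $dn_\gamma(\omega,\eta)=\sup_{j\in J}\max\{bn_\gamma(\langle\omega,\omega_j\rangle_M,\langle\eta,\eta_j\rangle_N),\,bn_\gamma(\langle\omega_j,\omega\rangle_M,\langle\eta_j,\eta\rangle_N)\}$. Define: - height $\varsigma(\gamma)=\max\{\mathrm{Haus}_{mk_{L_A}}(S(A),\{\varphi\circ\pi_A:\varphi\in S_1(E|x)\}),\ \mathrm{Haus}_{mk_{L_B}}(S(B),\{\varphi\circ\pi_B:\varphi\in S_1(E|x)\})\}$; - basic reach $\varrho_b(\gamma)=\mathrm{Haus}_{\|\cdot\|_E}(\{\pi_A(a)x:a\in sa(A),L_A(a)\le1\},\{x\pi_B(b):b\in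 sa(B),L_B(b)\le1\})$; - modular reach $\varrho^\#(\gamma)=\sup_{j\in J}dn_\gamma(\omega_j,\eta_j)$; - imprint $\varpi(\gamma)=\max\{\mathrm{Haus}_{k_{\Omega_A}}(\{\omega_j:j\in J\},\mathcal D_1(\Omega_A)),\ \mathrm{Haus}_{k_{\Omega_B}}(\{\eta_j:j\in J\},\mathcal D_1(\Omega_B))\}$; - length $\lambda(\gamma)=\max\{\varsigma(\gamma),\varrho_b(\gamma),\varrho^\#(\gamma)+\varpi(\gamma)\}$. A modular trek from $\Omega_A$ to $\Omega_B$ is a finite sequence of modular bridges $\gamma_1,\dots,\gamma_k$ between $(F,G,H)$-metrized quantum vector bundles, starting at $\Omega_A$ and ending at $\Omega_B$, the target of $\gamma_i$ being the source of $\gamma_{i+1}$; its length is $\sum_i\lambda(\gamma_i)$. $\Lambda^{mod}(\Omega_A,\Omega_B)$ is the infimum of the lengths of all modular treks from $\Omega_A$ to $\Omega_B$. *)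

(* Defs.v *)
From HB Require Import structures.
From mathcomp Require Import all_boot all_order all_algebra.
From mathcomp Require Import all_classical all_reals all_analysis.
From mathcomp Require Import complex.

Set Implicit Arguments.
Unset Strict Implicit.
Unset Printing Implicit Defensive.

Import Order.TTheory GRing.Theory Num.Theory.
Import numFieldTopology.Exports numFieldNormedType.Exports.
Import Normc.

Local Open Scope classical_set_scope.
Local Open Scope ring_scope.
Local Open Scope complex_scope.

(* The library has no join of [GRing.PzSemiRing] with [Num.NormedZmodule], and
   its normed modules over [K] cannot be modules over another ring; hence this
   minimal structure, which does not interfere with the algebraic hierarchy. *)
HB.mixin Record hasNorm (R : realType) V of GRing.Zmodule V := {
  nrm : V -> R;
  nrm0 : nrm 0 = 0;
  nrm_eq0 : forall x : V, nrm x = 0 -> x = 0;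
  nrmN : forall x : V, nrm (- x) = nrm x;
  nrmD : forall x y : V, nrm (x + y) <= nrm x + nrm y
}.

#[short(type="nrmZmodType")]
HB.structure Definition NrmZmod (R : realType) :=
  {V of hasNorm R V & GRing.Zmodule V}.

#[short(type="nrmLmodType")]
HB.structure Definition NrmLmodule (R : realType) (K : pzRingType) :=
  {V of hasNorm R V & GRing.Lmodule K V}.

Section NormBasics.
Context {R : realType} {V : nrmZmodType R}.
Implicit Types x y z : V.

Lemma nrm_ge0 x : 0 <= nrm x.
Proof.
rewrite -(@pmulrn_lge0 _ _ 2)// mulr2n -{2}(nrmN x).
by rewrite -(@nrm0 R V) -(subrr x) nrmD.
Qed.

Lemma nrmB x y : nrm (x - y) = nrm (y - x).
Proof. by rewrite -nrmN opprB. Qed.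

Lemma nrm_triangle y x z : nrm (x - z) <= nrm (x - y) + nrm (y - z).
Proof. by rewrite (le_trans _ (nrmD _ _))// addrA subrK. Qed.

End NormBasics.

(* [V] with the metric, hence the topology, of its norm *)
Definition mtop (R : realType) (V : nrmZmodType R) : Type := V.

Section MetricOfNorm.
Context {R : realType} {V : nrmZmodType R}.

Let d (x y : mtop V) : R := nrm ((x : V) - y).

Let dxx x : d x x = 0. Proof. by rewrite /d subrr nrm0. Qed.

Let d_eq0 x y : d x y = 0 -> x = y.
Proof. by move=> /nrm_eq0/eqP; rewrite subr_eq0 => /eqP. Qed.

Let d_sym x y : d x y = d y x. Proof. exact: nrmB. Qed.

Let d_triangle y x z : d x z <= d x y + d y z.
Proof. exact: nrm_triangle. Qed.

HB.instance Definition _ := Choice.copy (mtop V) V.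
HB.instance Definition _ :=
  isMetric.Build R (mtop V) dxx d_eq0 d_sym d_triangle.

End MetricOfNorm.

(* [GRing.Algebra] imposes [1 != 0]: the zero algebra, which has no state, is
   excluded. *)
HB.mixin Record isCStarAlgebra (R : realType) A
    of GRing.Algebra R[i] A & hasNorm R A := {
  star : A -> A;
  nrmZ : forall (c : R[i]) (a : A), nrm (c *: a) = normc c * nrm a;
  nrmM : forall a b : A, nrm (a * b) <= nrm a * nrm b;
  starK : involutive star;
  starD : {morph star : a b / a + b};
  starZ : forall (c : R[i]) (a : A), star (c *: a) = c^*%C *: star a;
  starM : forall a b : A, star (a * b) = star b * star a;
  cstar_identity : forall a : A, nrm (star a * a) = nrm a ^+ 2;
  cstar_complete : forall F : set_system (mtop A), ProperFilter F ->
    cauchy F -> exists a : mtop A, F --> a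
}.

#[short(type="cstarAlgType")]
HB.structure Definition CStarAlgebra (R : realType) :=
  {A of isCStarAlgebra R A & GRing.Algebra R[i] A & hasNorm R A}.

(* An element of a C*-algebra is positive iff it is of the form b^* b. *)
Definition cstar_pos (R : realType) (A : cstarAlgType R) (a : A) : Prop :=
  exists b : A, a = star b * b.

(* The complex scalars act on [M] through [c%:A]. *)
HB.mixin Record isHilbertModule (R : realType) (A : cstarAlgType R) M
    of GRing.Lmodule A M & hasNorm R M := {
  inner : M -> M -> A;
  inner_linear : forall (a : A) (u v w : M),
    inner (a *: u + v) w = a * inner u w + inner v w;
  inner_star : forall u v : M, star (inner u v) = inner v u;
  inner_pos : forall u : M, cstar_pos (inner u u);
  nrm_inner : forall u : M, nrm u = Num.sqrt (nrm (inner u u));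
  hilbert_complete : forall F : set_system (mtop M), ProperFilter F ->
    cauchy F -> exists u : mtop M, F --> u
}.

#[short(type="hilbertModType")]
HB.structure Definition HilbertModule (R : realType) (A : cstarAlgType R) :=
  {M of isHilbertModule R A M & GRing.Lmodule A M & hasNorm R M}.

Section CStarBasics.
Context {R : realType} {A : cstarAlgType R}.
Implicit Types a b : A.

Lemma star0 : star (0 : A) = 0.
Proof. by rewrite -(scale0r (0 : A)) starZ conjc0 !scale0r. Qed.

Lemma nrm_star a : nrm (star a) = nrm a.
Proof.
suff le b : nrm b <= nrm (star b).
  by apply/eqP; rewrite eq_le le -{2}(starK a) le.
have [->|b0] := eqVneq b 0; first by rewrite star0.
have b_gt0 : 0 < nrm b.
  by rewrite lt_neqAle nrm_ge0 andbT eq_sym; apply: contra_neq b0 => /nrm_eq0.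
by rewrite -(ler_pM2r b_gt0) -expr2 -cstar_identity nrmM.
Qed.

Lemma nrmMstar a : nrm (a * star a) = nrm a ^+ 2.
Proof. by rewrite -{1}(starK a) cstar_identity nrm_star. Qed.

End CStarBasics.

(* A space embedded isometrically onto a closed subset of a complete space is
   complete. *)
Lemma isometric_complete (R : realType) (V W : nrmZmodType R) (f : V -> W) :
    (forall F : set_system (mtop W), ProperFilter F -> cauchy F ->
      exists w : mtop W, F --> w) ->
    (forall u v, nrm (f u - f v) = nrm (u - v)) ->
    closed (range f : set (mtop W)) ->
  forall F : set_system (mtop V), ProperFilter F -> cauchy F ->
    exists v : mtop V, F --> v.
Proof.
move=> W_complete f_isom f_closed F FF /cauchy_ballP F_cauchy.
pose g : mtop V -> mtop W := f.
have gF_cauchy : cauchy (g @ F).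
  apply/cauchy_ballP => e e0; rewrite near_map2.
  apply: filterS (F_cauchy e e0) => -[u v] /=.
  by rewrite !ballEmdist /= /mdist /= f_isom.
have [w gFw] := W_complete _ _ gF_cauchy.
have [v _ gv] : range g w.
  apply: f_closed => B wB.
  have [x gBx] := @filter_ex _ F _ (g @^-1` B) (gFw _ wB).
  by exists (g x); split => //; exists x.
exists v => P /nbhs_ballP[e /= e0 eP].
have : F (g @^-1` ball w e) by exact/gFw/nbhsx_ballx.
apply: filterS => x /=.
rewrite -gv => wx; apply: eP; move: wx.
by rewrite !ballEmdist /= /mdist /= f_isom.
Qed.

Record cstarSubalg (R : realType) (A : cstarAlgType R) := CStarSubalg {
  subalg_set :> set A;
  subalg1 : subalg_set 1;
  subalgZD : forall (c : R[i]) a b,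
    subalg_set a -> subalg_set b -> subalg_set (c *: a + b);
  subalgM : forall a b, subalg_set a -> subalg_set b -> subalg_set (a * b);
  subalg_star : forall a, subalg_set a -> subalg_set (star a);
  subalg_closed : closed (subalg_set : set (mtop A))
}.

Section SubalgType.
Context {R : realType} {A : cstarAlgType R} (B : cstarSubalg A).

Definition subalg_type : Type := {a : A | a \in (B : set A)}.

HB.instance Definition _ := [isSub of subalg_type for @sval _ _].
HB.instance Definition _ := [Choice of subalg_type by <:].

Let subalg_subsemialg : GRing.subsemialg_closed [in (B : set A)].
Proof.
have B0 : (B : set A) 0.
  by have := subalgZD (-1) (subalg1 B) (subalg1 B); rewrite scaleN1r addNr.
split; first exact/mem_set/subalg1.
- by split=> [|a b /set_mem Ba /set_mem Bb]; apply/mem_set => //;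
    rewrite -[a]scale1r; exact: subalgZD.
- move=> c a /set_mem Ba; apply/mem_set.
  by rewrite -[_ *: _]addr0; exact: subalgZD.
- by move=> a b /set_mem Ba /set_mem Bb; exact/mem_set/subalgM.
Qed.

HB.instance Definition _ :=
  GRing.SubChoice_isSubAlgebra.Build R[i] A _ subalg_type subalg_subsemialg.

Let subalg_nrm (x : subalg_type) : R := nrm (val x).

Let subalg_nrm0 : subalg_nrm 0 = 0.
Proof. by rewrite /subalg_nrm raddf0 nrm0. Qed.
Let subalg_nrm_eq0 x : subalg_nrm x = 0 -> x = 0.
Proof. by move=> /nrm_eq0 x0; apply: val_inj; rewrite x0 raddf0. Qed.
Let subalg_nrmN x : subalg_nrm (- x) = subalg_nrm x.
Proof. by rewrite /subalg_nrm raddfN nrmN. Qed.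
Let subalg_nrmD x y : subalg_nrm (x + y) <= subalg_nrm x + subalg_nrm y.
Proof. by rewrite /subalg_nrm raddfD nrmD. Qed.

HB.instance Definition _ := hasNorm.Build R subalg_type
  subalg_nrm0 subalg_nrm_eq0 subalg_nrmN subalg_nrmD.

Definition sub_star (x : subalg_type) : subalg_type :=
  exist _ (star (val x)) (mem_set (subalg_star (set_mem (valP x)))).

Let sub_nrmZ (c : R[i]) (x : subalg_type) : nrm (c *: x) = normc c * nrm x.
Proof. exact: (nrmZ c (val x)). Qed.
Let sub_nrmM (x y : subalg_type) : nrm (x * y) <= nrm x * nrm y.
Proof. exact: nrmM. Qed.
Let sub_starK : involutive sub_star.
Proof. by move=> x; apply: val_inj; exact: starK. Qed.
Let sub_starD : {morph sub_star : x y / x + y}.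
Proof. by move=> x y; apply: val_inj; exact: starD. Qed.
Let sub_starZ (c : R[i]) (x : subalg_type) :
  sub_star (c *: x) = c^*%C *: sub_star x.
Proof. by apply: val_inj; exact: starZ. Qed.
Let sub_starM (x y : subalg_type) : sub_star (x * y) = sub_star y * sub_star x.
Proof. by apply: val_inj; exact: starM. Qed.
Let sub_cstar (x : subalg_type) : nrm (sub_star x * x) = nrm x ^+ 2.
Proof. exact: cstar_identity. Qed.
Let sub_complete (F : set_system (mtop subalg_type)) : ProperFilter F ->
  cauchy F -> exists x : mtop subalg_type, F --> x.
Proof.
apply: (isometric_complete (f := val : subalg_type -> A)).
- exact: cstar_complete.
- by [].
- rewrite (_ : range _ = B); first exact: subalg_closed.
  by apply/seteqP; split=> [_ [x _ <-]|a Ba]; [exact: set_mem (valP x)|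
    exists (exist _ a (mem_set Ba))].
Qed.

HB.instance Definition _ := isCStarAlgebra.Build R subalg_type
  sub_nrmZ sub_nrmM sub_starK sub_starD sub_starZ sub_starM sub_cstar
  sub_complete.

End SubalgType.

Record closedIdeal (R : realType) (A : cstarAlgType R) := ClosedIdeal {
  ideal_set :> set A;
  ideal0 : ideal_set 0;
  idealD : forall a b, ideal_set a -> ideal_set b -> ideal_set (a + b);
  idealMl : forall a b, ideal_set b -> ideal_set (a * b);
  idealMr : forall a b, ideal_set a -> ideal_set (a * b);
  ideal_closed : closed (ideal_set : set (mtop A))
}.

(* the intersection of [I] and [B], as an ideal of the C*-algebra [B] *)
Program Definition ideal_cap (R : realType) (A : cstarAlgType R)
    (I : closedIdeal A) (B : cstarSubalg A) : closedIdeal (subalg_type B) :=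
  @ClosedIdeal R (subalg_type B) [set x | ideal_set I (val x)] _ _ _ _ _.
Next Obligation. by move=> R A I B; exact: ideal0. Qed.
Next Obligation. by move=> R A I B x y; exact: idealD. Qed.
Next Obligation. by move=> R A I B x y; exact: idealMl. Qed.
Next Obligation. by move=> R A I B x y; exact: idealMr. Qed.
Next Obligation.
move=> R A I B x clx; apply: ideal_closed => U /nbhs_ballP[e /= e0 eU].
have [y [Iy xy]] := clx _ (nbhsx_ballx (x : mtop (subalg_type B)) e e0).
by exists (val y); split => //; apply: eU; move: xy; rewrite !ballEmdist.
Qed.

Section IdealModule.
Context {R : realType} {A : cstarAlgType R} (I : closedIdeal A).

Definition ideal_mod : Type := {a : A^o | a \in (I : set A)}.

HB.instance Definition _ := [isSub of ideal_mod for @sval _ _].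
HB.instance Definition _ := [Choice of ideal_mod by <:].

Let ideal_submod : GRing.subsemimod_closed ([in (I : set A)] : {pred A^o}).
Proof.
split=> [|a b /set_mem Ib]; last exact/mem_set/idealMl.
split=> [|a b /set_mem Ia /set_mem Ib]; apply/mem_set;
  [exact: ideal0|exact: idealD].
Qed.

HB.instance Definition _ :=
  GRing.SubChoice_isSubLmodule.Build A A^o _ ideal_mod ideal_submod.

Let ideal_nrm (w : ideal_mod) : R := nrm (val w : A).

Let ideal_nrm0 : ideal_nrm 0 = 0.
Proof. exact: nrm0. Qed.
Let ideal_nrm_eq0 w : ideal_nrm w = 0 -> w = 0.
Proof. by move=> /nrm_eq0 w0; apply: val_inj; rewrite w0. Qed.
Let ideal_nrmN w : ideal_nrm (- w) = ideal_nrm w.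
Proof. exact: nrmN. Qed.
Let ideal_nrmD v w : ideal_nrm (v + w) <= ideal_nrm v + ideal_nrm w.
Proof. exact: nrmD. Qed.

HB.instance Definition _ := hasNorm.Build R ideal_mod
  ideal_nrm0 ideal_nrm_eq0 ideal_nrmN ideal_nrmD.

Definition ideal_inner (v w : ideal_mod) : A := (val v : A) * star (val w : A).

Let ideal_inner_linear (a : A) (u v w : ideal_mod) :
  ideal_inner (a *: u + v) w = a * ideal_inner u w + ideal_inner v w.
Proof. by rewrite /ideal_inner mulrA -mulrDl. Qed.
Let ideal_inner_star (u v : ideal_mod) :
  star (ideal_inner u v) = ideal_inner v u.
Proof. by rewrite /ideal_inner starM starK. Qed.
Let ideal_inner_pos (u : ideal_mod) : cstar_pos (ideal_inner u u).
Proof. by exists (star (val u : A)); rewrite starK. Qed.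
Let ideal_nrm_inner (u : ideal_mod) :
  nrm u = Num.sqrt (nrm (ideal_inner u u)).
Proof. by rewrite nrmMstar sqrtr_sqr ger0_norm// nrm_ge0. Qed.
Let ideal_complete (F : set_system (mtop ideal_mod)) : ProperFilter F ->
  cauchy F -> exists w : mtop ideal_mod, F --> w.
Proof.
apply: (isometric_complete (f := val : ideal_mod -> A)).
- exact: cstar_complete.
- by [].
- rewrite (_ : range _ = I); first exact: ideal_closed.
  by apply/seteqP; split=> [_ [w _ <-]|a Ia]; [exact: set_mem (valP w)|
    exists (exist _ a (mem_set Ia))].
Qed.

HB.instance Definition _ := isHilbertModule.Build R A ideal_mod
  ideal_inner_linear ideal_inner_star ideal_inner_pos ideal_nrm_inner
  ideal_complete.

End IdealModule.

Section Admissible.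
Context {R : realType}.

Definition admissible4 (F : R -> R -> R -> R -> R) : Prop :=
  [/\ forall x1 x2 x3 x4, 0 <= x1 -> 0 <= x2 -> 0 <= x3 -> 0 <= x4 ->
        0 <= F x1 x2 x3 x4,
      forall x1 x2 x3 x4 y1 y2 y3 y4,
        0 <= x1 <= y1 -> 0 <= x2 <= y2 -> 0 <= x3 <= y3 -> 0 <= x4 <= y4 ->
        F x1 x2 x3 x4 <= F y1 y2 y3 y4
    & forall x1 x2 x3 x4, 0 <= x1 -> 0 <= x2 -> 0 <= x3 -> 0 <= x4 ->
        x1 * x4 + x2 * x3 <= F x1 x2 x3 x4].

Definition admissible3 (G : R -> R -> R -> R) : Prop :=
  [/\ forall x y z, 0 <= x -> 0 <= y -> 0 <= z -> 0 <= G x y z,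
      forall x y z x' y' z', 0 <= x <= x' -> 0 <= y <= y' -> 0 <= z <= z' ->
        G x y z <= G x' y' z'
    & forall x y z, 0 <= x -> 0 <= y -> 0 <= z -> (x + y) * z <= G x y z].

Definition admissible2 (H : R -> R -> R) : Prop :=
  [/\ forall x y, 0 <= x -> 0 <= y -> 0 <= H x y,
      forall x y x' y', 0 <= x <= x' -> 0 <= y <= y' -> H x y <= H x' y'
    & forall x y, 0 <= x -> 0 <= y -> 2 * x * y <= H x y].

Definition admissible_triple (F : R -> R -> R -> R -> R) (G : R -> R -> R -> R)
    (H : R -> R -> R) : Prop :=
  [/\ admissible4 F, admissible3 G & admissible2 H].

End Admissible.

Section CStarNotions.
Context {R : realType} {A : cstarAlgType R}.

Definition re_part (a : A) : A := (2 : R[i])^-1 *: (a + star a).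
Definition im_part (a : A) : A := (2 * 'i%C : R[i])^-1 *: (a - star a).
Definition jordan (a b : A) : A := (2 : R[i])^-1 *: (a * b + b * a).
Definition lie (a b : A) : A := (2 * 'i%C : R[i])^-1 *: (a * b - b * a).

Definition states : set (A -> R[i]) :=
  [set phi | [/\ scalar phi, forall a, 0 <= phi (star a * a) & phi 1 = 1]].

Definition lip_ball (L : A -> \bar R) : set A :=
  [set a | star a = a /\ (L a <= 1)%E].

Definition mk (L : A -> \bar R) (phi psi : A -> R[i]) : \bar R :=
  ereal_sup [set (normc (phi a - psi a))%:E | a in lip_ball L].

(* [rho] is a metric on the state space, and induces there the topology of
   pointwise convergence *)
Record metrizes_weak_star (rho : (A -> R[i]) -> (A -> R[i]) -> \bar R) : Prop := {
  mws_fin : forall phi psi, states phi -> states psi -> rho phi psi \is a fin_num;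
  mws_eq0 : forall phi psi, states phi -> states psi ->
    rho phi psi = 0%E <-> phi = psi;
  mws_sym : forall phi psi, states phi -> states psi -> rho phi psi = rho psi phi;
  mws_triangle : forall phi psi chi, states phi -> states psi -> states chi ->
    (rho phi chi <= rho phi psi + rho psi chi)%E;
  mws_nbhs : forall phi (U : set (A -> R[i])), states phi ->
    within states (nbhs (phi : {ptws A -> (R[i])^o})) U <->
    exists2 e : R, 0 < e &
      forall psi, states psi -> (rho phi psi < e%:E)%E -> U psi
}.

(* [L] is a seminorm on its domain [set a | L a < +oo], a subspace of the
   self-adjoint elements, and takes the value [+oo] everywhere else. *)
Record leibniz_qcms (F : R -> R -> R -> R -> R) (L : A -> \bar R) : Prop := {
  lip_selfadj : forall a, (L a < +oo)%E -> star a = a;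
  lip_ge0 : forall a, (0 <= L a)%E;
  lipZ : forall (t : R) a, (L a < +oo)%E -> L (t%:C *: a)%R = (`|t|%:E * L a)%E;
  lipD : forall a b, (L (a + b)%R <= L a + L b)%E;
  lip_jordan : forall a b, (L a < +oo)%E -> (L b < +oo)%E ->
    (L (jordan a b) < +oo)%E;
  lip_lie : forall a b, (L a < +oo)%E -> (L b < +oo)%E -> (L (lie a b) < +oo)%E;
  lip_dense : forall a : A, star a = a ->
    closure ([set b | (L b < +oo)%E] : set (mtop A)) a;
  lip_eq0 : forall a, L a = 0%E <-> exists t : R, a = t%:C%:A;
  lip_mk : metrizes_weak_star (mk L);
  lip_closed : closed (lip_ball L : set (mtop A));
  lip_leibniz : forall a b, (L a < +oo)%E -> (L b < +oo)%E ->
    (maxe (L (jordan a b)) (L (lie a b)) <=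
     (F (nrm a) (nrm b) (fine (L a)) (fine (L b)))%:E)%E
}.

End CStarNotions.

(* Data only: the conditions on [lip] and [dnorm] are in [metrized_bundle]. *)
Record bundle (R : realType) := Bundle {
  base : cstarAlgType R;
  lip : base -> \bar R;
  modl : hilbertModType base;
  dnorm : modl -> \bar R
}.

Definition unit_ball (R : realType) (W : bundle R) : set (modl W) :=
  [set w | (dnorm w <= 1)%E].

(* [mb_leibniz] and [mb_inner] are inequalities between extended reals whose
   right-hand side is [+oo] as soon as one of its arguments is, so they only
   constrain the domains of [lip] and [dnorm]. *)
Record metrized_bundle (R : realType) (F : R -> R -> R -> R -> R)
    (G : R -> R -> R -> R) (H : R -> R -> R) (W : bundle R) : Prop := {
  mb_qcms : leibniz_qcms F (@lip R W);
  mb_norm_ge0 : forall w : modl W, (0 <= dnorm w)%E;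
  mb_norm0 : dnorm (0 : modl W) = 0%E;
  mb_norm_eq0 : forall w : modl W, dnorm w = 0%E -> w = 0;
  mb_normZ : forall (c : R[i]) (w : modl W), (dnorm w < +oo)%E ->
    dnorm (c%:A *: w)%R = ((normc c)%:E * dnorm w)%E;
  mb_normD : forall v w : modl W, (dnorm (v + w)%R <= dnorm v + dnorm w)%E;
  mb_dense : closure ([set w | (dnorm w < +oo)%E] : set (mtop (modl W))) = setT;
  mb_nrm_le : forall w : modl W, ((nrm w)%:E <= dnorm w)%E;
  mb_compact : compact (@unit_ball R W : set (mtop (modl W)));
  mb_leibniz : forall (a : base W) (w : modl W), star a = a ->
    (lip a < +oo)%E -> (dnorm w < +oo)%E ->
    (dnorm (a *: w)%R <= (G (nrm a) (fine (lip a)) (fine (dnorm w)))%:E)%E;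
  mb_inner : forall v w : modl W, (dnorm v < +oo)%E -> (dnorm w < +oo)%E ->
    (maxe (lip (re_part (inner v w))) (lip (im_part (inner v w))) <=
     (H (fine (dnorm v)) (fine (dnorm w)))%:E)%E
}.

Definition hausdorff (R : realType) (T : Type) (rho : T -> T -> \bar R)
    (X Y : set T) : \bar R :=
  maxe (ereal_sup [set ereal_inf [set rho x y | y in Y] | x in X])
       (ereal_sup [set ereal_inf [set rho x y | x in X] | y in Y]).

Definition kmetric (R : realType) (W : bundle R) (v w : modl W) : \bar R :=
  ereal_sup [set (nrm (inner v u - inner w u))%:E | u in @unit_ball R W].

Definition states1 (R : realType) (E : cstarAlgType R) (x : E) :
    set (E -> R[i]) :=
  [set phi | [/\ states phi, phi (star (1 - x) * (1 - x)) = 0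
               & phi ((1 - x) * star (1 - x)) = 0]].

Record bridge (R : realType) (W W' : bundle R) := Bridge {
  br_alg : cstarAlgType R;
  br_pivot : br_alg;
  br_pivot_le1 : nrm br_pivot <= 1;
  br_states1 : states1 br_pivot !=set0;
  br_pi : {lrmorphism base W -> br_alg};
  br_pi' : {lrmorphism base W' -> br_alg};
  br_pi_star : forall a, br_pi (star a) = star (br_pi a);
  br_pi'_star : forall b, br_pi' (star b) = star (br_pi' b);
  br_pi_inj : injective br_pi;
  br_pi'_inj : injective br_pi';
  br_index : Type;
  br_index_inh : inhabited br_index;
  br_anchor : br_index -> modl W;
  br_coanchor : br_index -> modl W';
  br_anchor_ball : forall j, unit_ball (br_anchor j);
  br_coanchor_ball : forall j, unit_ball (br_coanchor j)
}.

Arguments br_anchor {R W W'} _ _.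
Arguments br_coanchor {R W W'} _ _.

Section BridgeLength.
Context {R : realType} {W W' : bundle R} (g : bridge W W').
Local Open Scope ereal_scope.

Local Notation x := (br_pivot g).

Definition bridge_norm (a : base W) (b : base W') : R :=
  nrm (br_pi g a * x - x * br_pi' g b)%R.

Definition deck_norm (w : modl W) (v : modl W') : \bar R :=
  ereal_sup [set maxe
    (bridge_norm (inner w (br_anchor g j)) (inner v (br_coanchor g j)))%:E
    (bridge_norm (inner (br_anchor g j) w) (inner (br_coanchor g j) v))%:E
    | j in [set: br_index g]].

Definition bridge_height : \bar R :=
  maxe (hausdorff (mk (@lip R W)) states
          [set phi \o br_pi g | phi in states1 x])
       (hausdorff (mk (@lip R W')) states
          [set phi \o br_pi' g | phi in states1 x]).

Definition basic_reach : \bar R :=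
  hausdorff (fun a b : br_alg g => (nrm (a - b)%R)%:E)
    [set (br_pi g a * x)%R | a in lip_ball (@lip R W)]
    [set (x * br_pi' g b)%R | b in lip_ball (@lip R W')].

Definition modular_reach : \bar R :=
  ereal_sup [set deck_norm (br_anchor g j) (br_coanchor g j)
            | j in [set: br_index g]].

Definition imprint : \bar R :=
  maxe (hausdorff (@kmetric R W) (range (br_anchor g)) (@unit_ball R W))
       (hausdorff (@kmetric R W') (range (br_coanchor g)) (@unit_ball R W')).

Definition bridge_length : \bar R :=
  maxe bridge_height (maxe basic_reach (modular_reach + imprint)).

End BridgeLength.

Section Propinquity.
Context {R : realType}.
Variables (F : R -> R -> R -> R -> R) (G : R -> R -> R -> R) (H : R -> R -> R).

Inductive trek : bundle R -> bundle R -> Type :=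
| trek_one W W' : metrized_bundle F G H W -> metrized_bundle F G H W' ->
    bridge W W' -> trek W W'
| trek_cons W W' W'' : metrized_bundle F G H W -> bridge W W' ->
    trek W' W'' -> trek W W''.

Fixpoint trek_length (W W' : bundle R) (t : trek W W') : \bar R :=
  match t with
  | trek_one _ _ _ _ g => bridge_length g
  | trek_cons _ _ _ _ g t' => (bridge_length g + trek_length t')%E
  end.

Definition propinquity (W W' : bundle R) : \bar R :=
  ereal_inf [set l | exists t : trek W W', l = trek_length t].

End Propinquity.

Section AF.
Context {R : realType} {A : cstarAlgType R}.

Definition faithful_tracial (tau : A -> R[i]) : Prop :=
  [/\ states tau, forall a b, tau (a * b) = tau (b * a)
    & forall a, tau (star a * a) = 0 -> a = 0].

Definition finite_dim (B : set A) : Prop :=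
  exists s : seq A, forall b, B b ->
    exists c : 'I_(size s) -> R[i], b = \sum_(i < size s) c i *: s`_i.

(* Linear, positive, contractive, [B]-bimodular projections onto [B]; for a
   faithful [tau] there is at most one that preserves [tau]. *)
Record cond_expectation (tau : A -> R[i]) (B : set A) (E : A -> A) : Prop := {
  cexp_linear : linear E;
  cexp_in : forall a, B (E a);
  cexp_id : forall b, B b -> E b = b;
  cexp_pos : forall a, cstar_pos a -> cstar_pos (E a);
  cexp_nrm : forall a, nrm (E a) <= nrm a;
  cexp_bimod : forall b a c, B b -> B c -> E (b * a * c) = b * E a * c;
  cexp_trace : forall a, tau (E a) = tau a
}.

Definition is_unit_of (B : set A) (e : A) : Prop :=
  B e /\ forall b, B b -> e * b = b /\ b * e = b.

Definition sa_restrict (L : A -> \bar R) (a : A) : \bar R :=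
  if star a == a then L a else +oo%E.

Variables (E : nat -> A -> A) (beta : nat -> R).

Definition Lbeta (a : A) : \bar R :=
  ereal_sup [set (nrm (a - E n a) / beta n)%:E | n in [set: nat]].

(* The formula of [D_I], read on the whole of [A]; [e n] is the unit [1_n]. *)
Definition Dideal (e : nat -> A) (w : A) : \bar R :=
  maxe (Lbeta w) (maxe (nrm w)%:E
    (ereal_sup [set (nrm (w - w * e n) / beta n)%:E | n in [set: nat]])).

Definition ideal_bundle (I : closedIdeal A) (e : nat -> A) : bundle R :=
  @Bundle R A (sa_restrict Lbeta) (ideal_mod I) (fun w => Dideal e (val w)).

End AF.

(* The same formulas, restricted to [B] and to the ideal [ideal_cap I B]. *)
Definition fin_ideal_bundle (R : realType) (A : cstarAlgType R)
    (E : nat -> A -> A) (beta : nat -> R) (I : closedIdeal A) (e : nat -> A)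
    (B : cstarSubalg A) : bundle R :=
  @Bundle R (subalg_type B)
    (sa_restrict (fun a : subalg_type B => Lbeta E beta (val a)))
    (ideal_mod (ideal_cap I B))
    (fun w => Dideal E beta e (val (val w : subalg_type B))).

Section Constants.
Context {R : realType}.

Definition FAF (x1 x2 x3 x4 : R) : R := 2 * (x1 * x4 + x2 * x3).
Definition GAF (x y z : R) : R := FAF x y z z.
Definition HAF (x y : R) : R := FAF x x y y.

(* The entries are positive, so the neutral element 0 is harmless for n > 0. *)
Definition xseq (beta : nat -> R) (n : nat) : R :=
  Num.max (1 + beta n)
    (\big[Num.max/0]_(m < n) ((2 * beta n + beta m) / beta m)).

End Constants.

(* Main.v *)
From HB Require Import structures.
Require Import Defs.
From mathcomp Require Import all_boot all_order all_algebra.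
From mathcomp Require Import all_classical all_reals all_analysis.
From mathcomp Require Import complex ring lra.

(* Let [eps = x_n - 1]; then [beta n <= eps] and [2 beta n <= eps beta m] for
   [m < n]. A trek of two bridges of length [eps / 2] passes through a bundle over
   [A_n (+) A] with module [I_n (+) I], whose seminorm and norm also control the
   difference [a_1 - a_2] at scale [eps / 2]. The pivots [(1, 0)] and [(0, 1)]
   forget one coordinate, so that the modular reaches vanish; it remains to
   approximate the unit ball of [I] by that of [I_n]. For [w] in the former,
   [E_n w 1_n] is within [min (b + b^2, sqrt 2 b)] of [w] for the modular metric,
   where [b = beta n], and dividing it by [1 + eps / 2] or by [eps / b] brings it
   into the unit ball of [I_n] at distance at most [3 eps / 2] from [w]. The middle
   norm absorbs two thirds of this distance, and the imprint of the second bridge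
   the remaining [eps / 2]. *)

Set Implicit Arguments.
Unset Strict Implicit.
Unset Printing Implicit Defensive.

Import Order.TTheory GRing.Theory Num.Theory.
Import numFieldTopology.Exports numFieldNormedType.Exports.
Import Normc.

Local Open Scope classical_set_scope.
Local Open Scope ring_scope.
Local Open Scope complex_scope.

Local Notation Re := complex.Re.
Local Notation Im := complex.Im.

(** * Complex numbers and C*-algebras *)

(** Reach and imprint are added in the length. In a single bridge with pivot 1 the reach would
    compare products both of whose factors have moved, and the imprint would come on top. Once the
    reaches vanish, height, basic reach and imprint are combined by a maximum only. The module gap
    is measured against the unit ball of [I], as the modular metric does, and not in norm: the norm
    estimate $\sqrt 2 b$ alone would leave the case of a small [eps] and a [b] slightly below it out
    of the range of both divisors. The weights of the two gaps differ: [dl] on the base, which the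
    heights charge in full, and [2 * dl] on the module, the most that the constant 4 of [HAF]
    permits. The approximation constant 3/2 is [(2 * dl + dl) / eps]. A further obstacle is that
    [states] tests elements [star b * b] with [b] in the same algebra. Carrying a state of $A_n
    \oplus A$ along $E_n$ requires positivity of $E_n$ inside $A_n$; it is obtained up to a small
    scalar, from the trace norm on a finite-dimensional algebra. *)

Section ComplexModulus.
Context {R : realType}.
Implicit Types (z w : R[i]) (t : R).

Lemma normc_ge0 z : 0 <= normc z.
Proof. by case: z => a b /=; exact: sqrtr_ge0. Qed.

Lemma normc_real t : normc t%:C = `|t|.
Proof. by rewrite /normc /= expr0n /= addr0 sqrtr_sqr. Qed.

Lemma normr_normc z : `|z| = (normc z)%:C.
Proof. by rewrite normc_def; case: z. Qed.

Lemma normc_conj z : normc z^*%C = normc z.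
Proof. by case: z => a b /=; rewrite sqrrN. Qed.

Lemma Re_le_normc z : `|Re z| <= normc z.
Proof.
by case: z => a b /=; rewrite -sqrtr_sqr ler_wsqrtr// lerDl sqr_ge0.
Qed.

Lemma Im_le_normc z : `|Im z| <= normc z.
Proof.
by case: z => a b /=; rewrite -sqrtr_sqr ler_wsqrtr// lerDr sqr_ge0.
Qed.

Lemma ReD z w : Re (z + w) = Re z + Re w.
Proof. by case: z w => [a b] [c d]. Qed.

Lemma complex_ge0 z : 0 <= z <-> Im z = 0 /\ 0 <= Re z.
Proof.
case: z => a b; rewrite lecE /=; split; first by case/andP => /eqP-> ->.
by case=> -> ->; rewrite eqxx.
Qed.

Lemma real_complex_eq z : Im z = 0 -> z = (Re z)%:C.
Proof. by case: z => a b /= ->. Qed.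

Lemma normc_rotate z : exists u : R[i], normc u = 1 /\ u * z = (normc z)%:C.
Proof.
have [->|z0] := eqVneq z 0.
  by exists 1; rewrite normc1 mulr0 normc0.
have nz0 : normc z != 0 by apply: contra z0 => /eqP/eq0_normc ->.
exists (z^*%C * (normc z)^-1%:C); split.
  rewrite normcM normc_conj normc_real ger0_norm ?invr_ge0 ?normc_ge0//.
  by rewrite mulfV.
have := sqr_normc z; rewrite normr_normc => /esym zz.
rewrite mulrAC [z^*%C * z]mulrC zz expr2 -mulrA -[X in _ * X]rmorphM /=.
by rewrite mulfV// mulr1.
Qed.

Lemma conjc_i : ('i%C : R[i])^*%C = - 'i%C.
Proof. by apply/eqP; rewrite eq_complex /= oppr0 !eqxx. Qed.

Lemma conjc_half_i : ((2 * 'i%C : R[i])^-1)^*%C = - (2 * 'i%C)^-1.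
Proof.
have := conjc_i; rewrite -invrN -mulrN => <-.
by rewrite fmorphV rmorphM rmorph_nat.
Qed.

Lemma neq0Ci : ('i%C : R[i]) != 0.
Proof. by rewrite eq_complex /= oner_eq0 andbF. Qed.

Lemma normc_half : normc ((2 : R[i])^-1) = 2^-1.
Proof.
have -> : (2 : R[i])^-1 = (2^-1 : R)%:C by rewrite fmorphV rmorph_nat.
by rewrite normc_real ger0_norm// invr_ge0.
Qed.

Lemma normc_half_i : normc ((2 * 'i%C : R[i])^-1) = 2^-1.
Proof.
rewrite invfM normcM normc_half normcV.
by rewrite /normc /= expr0n /= add0r expr1n sqrtr1 invr1 mulr1.
Qed.

End ComplexModulus.

Section NormedSpace.
Context {R : realType} {V : nrmZmodType R}.
Implicit Types (x y : V) (S : set V).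

Lemma nrm_sum (I : Type) (r : seq I) (P : pred I) (F : I -> V) :
  nrm (\sum_(i <- r | P i) F i) <= \sum_(i <- r | P i) nrm (F i).
Proof.
elim/big_ind2: _ => [|x1 x2 y1 y2 h1 h2|//]; first by rewrite nrm0.
by rewrite (le_trans (nrmD _ _))// lerD.
Qed.

Lemma mtop_ballE (x : mtop V) e : ball x e = [set y : V | nrm ((x : V) - y) < e].
Proof. by rewrite ballEmdist. Qed.

Lemma closure_mtopP S x :
  closure (S : set (mtop V)) x <->
  forall e : R, 0 < e -> exists2 y, S y & nrm (x - y) < e.
Proof.
split=> [clx e e0|h B /nbhs_ballP[e /= e0 eB]].
  have [y [Sy]] := clx _ (nbhsx_ballx (x : mtop V) e e0).
  by rewrite mtop_ballE; exists y.
have [y Sy xy] := h e e0; exists y; split => //; apply: eB.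
by rewrite mtop_ballE.
Qed.

Lemma closed_mtopP S :
  (forall x, (forall e : R, 0 < e -> exists2 y, S y & nrm (x - y) < e) -> S x) ->
  closed (S : set (mtop V)).
Proof. by move=> h x /closure_mtopP; exact: h. Qed.

Lemma closed_mtop_in S x : closed (S : set (mtop V)) ->
  (forall e : R, 0 < e -> exists2 y, S y & nrm (x - y) < e) -> S x.
Proof. by move=> cS h; apply: cS; apply/closure_mtopP. Qed.

Definition mtop_complete : Prop := forall F : set_system (mtop V),
  ProperFilter F -> cauchy F -> exists v : mtop V, F --> v.

Lemma filter_cauchy_cvg (F : set_system V) : mtop_complete -> ProperFilter F ->
    (forall e : R, 0 < e -> exists x, F [set y | nrm (x - y) <= e]) ->
  exists v : V, forall e : R, 0 < e -> F [set y | nrm (v - y) < e].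
Proof.
move=> cV FF h.
have [|v Fv] := cV (F : set_system (mtop V)) FF.
  apply/cauchy_ballP => e e0.
  have e3 : 0 < e / 3 by rewrite divr_gt0.
  have [x Fx] := h _ e3.
  exists ([set y | nrm (x - y) <= e / 3], [set y | nrm (x - y) <= e / 3]).
    by split.
  move=> [y z] /= [xy xz]; rewrite mtop_ballE /=.
  rewrite (le_lt_trans (nrm_triangle x _ _))// nrmB.
  by rewrite (le_lt_trans (lerD xy xz))//; lra.
exists v => e e0.
have := Fv _ (nbhsx_ballx (v : mtop V) e e0).
by rewrite mtop_ballE.
Qed.

Lemma seq_cauchy_cvg (y : nat -> V) : mtop_complete ->
    (forall e : R, 0 < e -> exists N, forall m, nrm (y N - y (N + m)%N) <= e) ->
  exists l : V, forall e : R, 0 < e ->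
    exists N, forall n, (N <= n)%N -> nrm (l - y n) < e.
Proof.
move=> cV h.
have [|l hl] := @filter_cauchy_cvg (y @ \oo) cV _.
  move=> e e0; have [N hN] := h e e0; exists (y N); exists N => // n /= Nn.
  by rewrite -(subnKC Nn); exact: hN.
by exists l => e /hl[N _ hN]; exists N => n Nn; exact: hN.
Qed.

End NormedSpace.
Arguments mtop_complete {R} V.

Section CStarElementary.
Context {R : realType} {A : cstarAlgType R}.
Implicit Types (a b h : A) (c : R[i]) (t : R).

Lemma nrmZR t a : nrm (t%:C *: a) = `|t| * nrm a.
Proof. by rewrite nrmZ normc_real. Qed.

Lemma starN a : star (- a) = - star a.
Proof.
have := starZ (-1) a; rewrite scaleN1r => ->.
by rewrite rmorphN rmorph1 scaleN1r.
Qed.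

Lemma starB a b : star (a - b) = star a - star b.
Proof. by rewrite starD starN. Qed.

Lemma star1 : star (1 : A) = 1.
Proof. by rewrite -[LHS]mulr1 -[1 in X in _ * X]starK -starM mulr1 starK. Qed.

Lemma nrm1 : nrm (1 : A) = 1.
Proof.
have n10 : nrm (1 : A) != 0.
  by apply/eqP => /nrm_eq0/eqP; rewrite oner_eq0.
by apply: (mulfI n10); rewrite mulr1 -expr2 -cstar_identity star1 mulr1.
Qed.

Lemma nrm_scalar c : nrm (c%:A : A) = normc c.
Proof. by rewrite nrmZ nrm1 mulr1. Qed.

Lemma starX a n : star (a ^+ n) = star a ^+ n.
Proof. by elim: n => [|n IH]; rewrite ?star1// exprS starM IH exprSr. Qed.

(** The C*-identity is iterated by squaring, hence the exponents $2^j$; with [expr2n_bounded] they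
    do the work of the spectral radius formula. *)
Lemma nrm_selfadj_pow h j : star h = h -> nrm (h ^+ (2 ^ j)) = nrm h ^+ (2 ^ j).
Proof.
move=> hs; elim: j => [|j IH]; first by rewrite expn0 !expr1.
rewrite expnSr !exprM expr2 -IH -cstar_identity starX hs //.
Qed.

Lemma selfadj_re a : star (re_part a) = re_part a.
Proof.
rewrite /re_part starZ starD starK [X in _ *: X]addrC.
by rewrite fmorphV rmorph_nat.
Qed.

Lemma selfadj_im a : star (im_part a) = im_part a.
Proof.
by rewrite /im_part starZ starB starK conjc_half_i scaleNr -scalerN opprB.
Qed.

Lemma re_imE a : a = re_part a + 'i%C *: im_part a.
Proof.
rewrite /re_part /im_part scalerA invfM mulrCA mulfV ?neq0Ci// mulr1.
rewrite -scalerDr addrACA subrr addr0.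
have -> : a + a = (2 : R[i]) *: a by rewrite scaler_nat mulr2n.
by rewrite scalerA mulVf ?scale1r// pnatr_eq0.
Qed.

Lemma star_re_imE a : star a = re_part a - 'i%C *: im_part a.
Proof.
rewrite [in LHS](re_imE a); move: (selfadj_re a) (selfadj_im a).
by move: (re_part a) (im_part a) => x y xs ys; rewrite starD starZ xs ys conjc_i scaleNr.
Qed.

Lemma nrm_re a : nrm (re_part a) <= nrm a.
Proof.
rewrite /re_part nrmZ normc_half ler_pdivrMl//.
by rewrite (le_trans (nrmD _ _))// nrm_star mulr_natl mulr2n.
Qed.

Lemma star_real_scale (t : R) a : star (t%:C *: a) = t%:C *: star a.
Proof.
by rewrite starZ; congr (_ *: _); apply/eqP; rewrite eq_complex /= oppr0 !eqxx.
Qed.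

Lemma star_jordan a b : star a = a -> star b = b -> star (jordan a b) = jordan a b.
Proof.
move=> sa sb; rewrite /jordan starZ starD !starM sa sb addrC.
by rewrite fmorphV rmorph_nat.
Qed.

Lemma star_lie a b : star a = a -> star b = b -> star (lie a b) = lie a b.
Proof.
move=> sa sb; rewrite /lie starZ starB !starM sa sb conjc_half_i.
by rewrite scaleNr -scalerN opprB.
Qed.

Lemma re_partB a b : re_part (a - b) = re_part a - re_part b.
Proof. by rewrite /re_part starB -scalerBr opprD addrACA. Qed.

Lemma re_part_id a : star a = a -> re_part a = a.
Proof.
move=> sa; rewrite /re_part sa.
have -> : a + a = (2 : R[i]) *: a by rewrite scaler_nat mulr2n.
by rewrite scalerA mulVf ?scale1r// pnatr_eq0.
Qed.

End CStarElementary.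

Section SquareRoot.
Context {R : realType} {A : cstarAlgType R}.
Implicit Types (a b h : A).

Lemma expr_lt_eps (r e : R) : 0 <= r < 1 -> 0 < e -> exists n, r ^+ n < e.
Proof.
move=> /andP[r0 r1] e0.
have rr : `|r| < 1 by rewrite ger0_norm.
have := cvg_expr rr => /cvgrPdist_lt/(_ e e0)[N _ /(_ N (leqnn N))] /=.
rewrite sub0r normrN ger0_norm ?exprn_ge0// => h; by exists N.
Qed.

Lemma sqr_diff (x y : A) : x * x - y * y = x * (x - y) + (x - y) * y.
Proof. by rewrite mulrBr mulrBl addrA subrK. Qed.

(* [1 - y] is the square root, where [y] is the fixed point of the contraction
   [y |-> (h + y^2) / 2] of the ball of radius [nrm h]. *)
Lemma sqrt_one_sub h : star h = h -> nrm h < 1 ->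
  exists2 s : A, star s = s & s * s = 1 - h.
Proof.
move=> hs h1; set r := nrm h.
have r0 : 0 <= r by exact: nrm_ge0.
pose T (y : A) : A := (2^-1)%:C *: (h + y * y).
pose y := fix y (k : nat) : A := if k is k'.+1 then T (y k') else 0.
have T_le (x : A) : nrm x <= r -> nrm (T x) <= r.
  move=> xr; rewrite /T nrmZR ger0_norm ?invr_ge0//.
  have : nrm (h + x * x) <= r + r * r.
    rewrite (le_trans (nrmD _ _))// lerD// (le_trans (nrmM _ _))//.
    by rewrite ler_pM ?nrm_ge0.
  have : r * r <= r by rewrite ler_piMl// ltW.
  lra.
have T_contr (x z : A) : nrm x <= r -> nrm z <= r ->
    nrm (T x - T z) <= r * nrm (x - z).
  move=> xr zr; rewrite /T -scalerBr nrmZR ger0_norm ?invr_ge0//.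
  rewrite opprD addrACA subrr add0r sqr_diff.
  have : nrm (x * (x - z) + (x - z) * z) <= r * nrm (x - z) + nrm (x - z) * r.
    rewrite (le_trans (nrmD _ _))// lerD// (le_trans (nrmM _ _))//.
      by rewrite ler_wpM2r// nrm_ge0.
    by rewrite ler_wpM2l// nrm_ge0.
  by rewrite [nrm (x - z) * r]mulrC; lra.
have y_le k : nrm (y k) <= r.
  by elim: k => [|k IH]; [rewrite /= nrm0|exact: T_le].
have y_star k : star (y k) = y k.
  elim: k => [|k IH]; first exact: star0.
  by rewrite /= /T star_real_scale starD starM IH hs.
have y_cauchy k m : nrm (y k - y (k + m)%N) <= r ^+ k * r.
  elim: k => [|k IH]; first by rewrite expr0 mul1r sub0r nrmN.
  rewrite addSn exprS -mulrA (le_trans (T_contr _ _ (y_le _) (y_le _)))//.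
  by rewrite ler_wpM2l.
have [|l hl] := seq_cauchy_cvg (@cstar_complete R A) (y := y).
  move=> e e0; have [n hn] := @expr_lt_eps r e (introT andP (conj r0 h1)) e0.
  exists n => m; rewrite (le_trans (y_cauchy _ _))//.
  rewrite (le_trans _ (ltW hn))// ler_piMr ?exprn_ge0//; exact: ltW.
have small (x : A) : (forall e : R, 0 < e -> nrm x <= e) -> x = 0.
  move=> hx; apply: nrm_eq0; apply/eqP; rewrite eq_le nrm_ge0 andbT.
  by apply/ler_addgt0Pr => e e0; rewrite add0r; exact: hx.
have l_le : nrm l <= r.
  apply/ler_addgt0Pr => e e0; have [N /(_ N (leqnn N)) hN] := hl e e0.
  rewrite -(subrK (y N) l) (le_trans (nrmD _ _))// addrC lerD ?y_le//.
  exact: ltW.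
have l_star : star l = l.
  apply/eqP; rewrite -subr_eq0; apply/eqP/small => e e0.
  have e2 : 0 < e / 2 by rewrite divr_gt0.
  have [N /(_ N (leqnn N)) hN] := hl _ e2.
  have -> : star l - l = star (l - y N) - (l - y N).
    by rewrite starB y_star opprB addrA subrK.
  rewrite (le_trans (nrmD _ _))// nrmN nrm_star.
  by rewrite (splitr e) lerD// ltW.
have l_fix : l = T l.
  apply/eqP; rewrite -subr_eq0; apply/eqP/small => e e0.
  have e2 : 0 < e / 2 by rewrite divr_gt0.
  have [N hN] := hl _ e2.
  rewrite (le_trans (nrm_triangle (y N.+1) _ _))// (splitr e) lerD//.
    exact/ltW/hN.
  rewrite (le_trans (T_contr _ _ (y_le _) l_le))// nrmB.
  have := hN N (leqnn N); have := nrm_ge0 (l - y N); move: h1; rewrite -/r.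
  move: (nrm _) => x r1 x0 xe.
  by rewrite (le_trans _ (ltW xe))// ler_piMl// ltW.
exists (1 - l); first by rewrite starB star1 l_star.
(* The fixed-point equation in the form $2 l = h + l^2$, which is $(1 - l)^2 = 1 - h$. *)
have two_l : l + l = h + l * l.
  have -> : l + l = (2 : R)%:C *: l by rewrite rmorph_nat scaler_nat mulr2n.
  rewrite [in LHS]l_fix /T scalerA -rmorphM mulfV ?scale1r//.
have -> : h = l + (l - l * l) by rewrite addrA two_l addrK.
by rewrite mulrBl mul1r mulrBr mulr1 [in RHS]opprD addrA.
Qed.

End SquareRoot.

Section ScalarFunction.
Context {R : realType} {V : lmodType R[i]} (phi : V -> R[i]).
Hypothesis phi_lin : scalar phi.

Lemma scalarfD u v : phi (u + v) = phi u + phi v.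
Proof. by have := phi_lin 1 u v; rewrite scale1r mul1r. Qed.

Lemma scalarf0 : phi 0 = 0.
Proof. by apply: (addrI (phi 0)); rewrite -scalarfD !addr0. Qed.

Lemma scalarfZ c u : phi (c *: u) = c * phi u.
Proof. by have := phi_lin c u 0; rewrite !addr0 scalarf0 addr0. Qed.

Lemma scalarfN u : phi (- u) = - phi u.
Proof. by rewrite -scaleN1r scalarfZ mulN1r. Qed.

Lemma scalarfB u v : phi (u - v) = phi u - phi v.
Proof. by rewrite scalarfD scalarfN. Qed.

Lemma scalarf_sum (I : Type) (r : seq I) (P : pred I) (F : I -> V) :
  phi (\sum_(i <- r | P i) F i) = \sum_(i <- r | P i) phi (F i).
Proof.
by elim/big_rec2: _ => [|i x y _ <-]; [exact: scalarf0|rewrite scalarfD].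
Qed.

End ScalarFunction.

Section States.
Context {R : realType} {A : cstarAlgType R} (phi : A -> R[i]).
Hypothesis phi_state : states phi.
Implicit Types (a b h : A).

Lemma state_scalar : scalar phi. Proof. by case: phi_state. Qed.

Lemma state_pos a : 0 <= phi (star a * a). Proof. by case: phi_state. Qed.

Lemma state1 : phi 1 = 1. Proof. by case: phi_state. Qed.

Let phi_lin := state_scalar.

(** By [sqrt_one_sub], [1 - h] has the form [star s * s], so its value is nonnegative. The order of
    [R[i]] makes this a statement on the imaginary part as well. *)
Lemma state_real_lt1 h : star h = h -> nrm h < 1 ->
  Im (phi h) = 0 /\ Re (phi h) <= 1.
Proof.
move=> hs h1; have [s ss sE] := sqrt_one_sub hs h1.
have := state_pos s; rewrite ss sE scalarfB// state1 => /complex_ge0.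
case: (phi h) => x y /= [/eqP]; rewrite sub0r oppr_eq0 => /eqP -> .
by rewrite subr_ge0.
Qed.

Lemma state_real_le h : star h = h -> Im (phi h) = 0 /\ Re (phi h) <= nrm h.
Proof.
move=> hs.
have key (t : R) : nrm h < t -> Im (phi h) = 0 /\ Re (phi h) <= t.
  move=> ht; have t0 : 0 < t by rewrite (le_lt_trans (nrm_ge0 h)).
  have [] := @state_real_lt1 (t^-1%:C *: h).
  - by rewrite starZ hs; congr (_ *: _); apply/eqP; rewrite eq_complex /= oppr0 !eqxx.
  - by rewrite nrmZR gtr0_norm ?invr_gt0// mulrC ltr_pdivrMr ?mul1r.
  rewrite scalarfZ//; case: (phi h) => x y /=.
  rewrite !mul0r subr0 addr0 => /eqP; rewrite mulf_eq0 invr_eq0 gt_eqF//= => /eqP ->.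
  by rewrite mulrC ler_pdivrMr// mul1r.
split; first by have [] := key (nrm h + 1); rewrite // ltrDl.
by apply/ler_addgt0Pr => e e0; have [] := key (nrm h + e); rewrite // ltrDl.
Qed.

Lemma state_star a : phi (star a) = (phi a)^*%C.
Proof.
rewrite star_re_imE [in RHS](re_imE a) scalarfB// scalarfD// !(scalarfZ phi_lin 'i%C).
have [Ir _] := state_real_le (selfadj_re a).
have [Ii _] := state_real_le (selfadj_im a).
move: (phi (re_part a)) (phi (im_part a)) Ir Ii => [x x'] [y y'] /= -> ->.
by apply/eqP; rewrite eq_complex /= !(mul0r, mulr0, mul1r, subr0, addr0, add0r, sub0r, oppr0) !eqxx.
Qed.

(** After multiplication by a phase [phi a] is real and nonnegative, so that only the self-adjoint
    part contributes and [state_real_le] applies; no Cauchy-Schwarz inequality is involved. *)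
Lemma state_le_nrm a : normc (phi a) <= nrm a.
Proof.
have [u [u1 uz]] := normc_rotate (phi a).
have : Re (phi (u *: a)) <= nrm (re_part (u *: a)).
  have [_ le_re] := state_real_le (selfadj_re (u *: a)); apply: le_trans le_re.
  have [Ii _] := state_real_le (selfadj_im (u *: a)).
  rewrite [in X in X <= _](re_imE (u *: a)) scalarfD// (scalarfZ phi_lin 'i%C) ReD.
  move: (phi (im_part _)) Ii => [y y'] /= ->.
  by rewrite !(mul0r, mulr0, subr0, mul1r) addr0.
rewrite scalarfZ// uz /= => h; rewrite (le_trans h)// (le_trans (nrm_re _))//.
by rewrite nrmZ u1 mul1r.
Qed.

End States.

Section CentralProjection.
Context {R : realType} {A : cstarAlgType R}.
Implicit Types (a b z e : A).

(** A constant factor disappears under $2^j$-th roots. Without roots: if $M < a$, some power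
    $(M/a)^{2^j}$ falls below $1/(C+1)$. *)
Lemma expr2n_bounded (a C M : R) : 0 <= M ->
  (forall j, a ^+ (2 ^ j) <= C * M ^+ (2 ^ j)) -> a <= M.
Proof.
move=> M0 h; rewrite leNgt; apply/negP => Ma.
have a0 : 0 < a by rewrite (le_lt_trans M0).
have r01 : 0 <= M / a < 1.
  by apply/andP; split; [rewrite divr_ge0// ltW|rewrite ltr_pdivrMr// mul1r].
have C0 : 0 <= C.
  rewrite leNgt; apply/negP => C0; have := h 0%N; rewrite expn0 !expr1 => h0.
  have : C * M <= 0 by rewrite nmulr_rle0.
  by move=> /(le_trans h0); rewrite leNgt a0.
have C1 : 0 < (C + 1)^-1 by rewrite invr_gt0 ltr_wpDl.
have [n hn] := expr_lt_eps r01 C1.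
have Mn : (M / a) ^+ (2 ^ n) < (C + 1)^-1.
  apply: le_lt_trans hn; apply: ler_wiXn2l; last exact/ltnW/ltn_expl.
    by case/andP: r01.
  by case/andP: r01 => _ /ltW.
have an0 : 0 < a ^+ (2 ^ n) by rewrite exprn_gt0.
move: Mn; rewrite expr_div_n ltr_pdivrMr// => Mn.
have := h n; apply/negP; rewrite -ltNge.
have C10 : 0 < C + 1 by rewrite -invr_gt0.
rewrite (le_lt_trans (y := (C + 1) * M ^+ (2 ^ n)))//.
  by rewrite ler_wpM2r ?exprn_ge0// lerDl.
by rewrite mulrC -ltr_pdivlMr// mulrC.
Qed.

(* The powers [z^N] of a self-adjoint block-diagonal [z] have norm at most
   [2 M^N], so the factor 2 disappears in the limit. *)
Lemma nrm_selfadj_block_le h e (M : R) : star h = h -> e * e = e ->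
  h * e = e * h -> nrm (h * e) <= M -> nrm (h * (1 - e)) <= M -> nrm h <= M.
Proof.
move=> hs ee he M1 M2.
have M0 : 0 <= M by rewrite (le_trans (nrm_ge0 _) M1).
have powE f n : f * f = f -> h * f = f * h -> (h * f) ^+ n.+1 = h ^+ n.+1 * f.
  move=> ff hf; rewrite exprMn_comm//; congr (_ * _).
  by elim: n => [|n IH]; rewrite ?expr1// exprS IH ff.
have ff : (1 - e) * (1 - e) = 1 - e.
  by rewrite mulrBr mulr1 mulrBl mul1r ee subrr subr0.
have hf : h * (1 - e) = (1 - e) * h by rewrite mulrBr mulrBl mulr1 mul1r he.
have powle f n : f * f = f -> h * f = f * h -> nrm (h * f) <= M ->
    nrm (h ^+ n.+1 * f) <= M ^+ n.+1.
  move=> ff' hf' hM; rewrite -powE//.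
  elim: n => [|n IH]; first by rewrite !expr1.
  by rewrite exprS [M ^+ _]exprS (le_trans (nrmM _ _))// ler_pM ?nrm_ge0.
apply: (@expr2n_bounded _ 2) => // j.
rewrite -nrm_selfadj_pow//.
have [n ->] : exists n, (2 ^ j = n.+1)%N.
  by exists (2 ^ j).-1; rewrite prednK// expn_gt0.
have -> : h ^+ n.+1 = h ^+ n.+1 * e + h ^+ n.+1 * (1 - e).
  by rewrite -mulrDr addrC subrK mulr1.
rewrite (le_trans (nrmD _ _))// mulr_natl mulr2n lerD//; exact: powle.
Qed.

(** [star z * z] is self-adjoint and commutes with [e], so the C*-identity reduces to the previous
    lemma. For [e] a unit $1_n$, central in $A_n$, two errors are thus combined by their maximum
    instead of their sum. *)
Lemma nrm_block_le z e (M : R) : star e = e -> e * e = e -> z * e = e * z ->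
  star z * e = e * star z ->
  nrm (z * e) <= M -> nrm (z * (1 - e)) <= M -> nrm z <= M.
Proof.
move=> es ee ze zse M1 M2.
have M0 : 0 <= M by rewrite (le_trans (nrm_ge0 _) M1).
rewrite -(ler_pXn2r (n := 2)) ?nnegrE ?nrm_ge0// -cstar_identity.
have fs : star (1 - e) = 1 - e by rewrite starB star1 es.
have ff : (1 - e) * (1 - e) = 1 - e.
  by rewrite mulrBr mulr1 mulrBl mul1r ee subrr subr0.
have blk f : star f = f -> f * f = f -> z * f = f * z -> star z * f = f * star z ->
    nrm (z * f) <= M -> nrm (star z * z * f) <= M ^+ 2.
  move=> fs' ff' zf zsf hM.
  have -> : star z * z * f = star (z * f) * (z * f).
    by rewrite starM fs' -zsf -[RHS]mulrA (mulrA f z) -zf -(mulrA z f) ff' mulrA.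
  by rewrite cstar_identity ler_pXn2r// nnegrE nrm_ge0.
apply: (@nrm_selfadj_block_le _ e) => //.
- by rewrite starM starK.
- by rewrite -mulrA ze mulrA zse mulrA.
- exact: blk.
- by apply: blk => //; rewrite ?mulrBr ?mulrBl ?mulr1 ?mul1r ?ze ?zse.
Qed.

End CentralProjection.

(** * Compactness and trace coordinates *)

Section Compactness.
Context {R : realType}.

Lemma ultra_real_limit (T : Type) (F : set_system T) (g : T -> R) (M : R) :
    UltraFilter F -> F [set x | `|g x| <= M] ->
  exists r : R, forall d : R, 0 < d -> F [set x | `|g x - r| < d].
Proof.
move=> FU FM; have FF : ProperFilter F := @ultra_proper _ _ FU.
have gF : F (g @^-1` `[- M, M]).
  by apply: filterS FM => x /= h; rewrite in_itv /= -ler_norml.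
have [] := @segment_compact R (- M) M (g @ F) (fmap_proper_filter g FF) gF.
move=> r [_ rcl]; exists r => d d0.
have [//|FC] := in_ultra_setVsetC [set x | `|g x - r| < d] FU.
have [|y [/= h1 h2]] := rcl [set y | ~ `|y - r| < d] (ball r d) FC.
  exact: nbhsx_ballx.
by exfalso; apply: h1; move: h2; rewrite /ball /= distrC.
Qed.

(* Total boundedness in the form in which finite dimensionality provides it. *)
Definition approx_fin (B : cstarAlgType R) (S : set B) : Prop :=
  forall e : R, 0 < e -> exists (J : finType) (x : J -> B) (M : R),
    forall a, S a -> exists2 c : J -> R[i],
      forall j, normc (c j) <= M & nrm (a - \sum_j c j *: x j) <= e.

(** Along an ultrafilter the finitely many bounded coefficients converge, so the ultrafilter is
    Cauchy. The isometry [f] allows approximants in an algebra for subsets of a module over it. *)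
Lemma approx_fin_compact (V : nrmZmodType R) (B : cstarAlgType R) (f : V -> B)
    (S : set V) :
    (forall u v, nrm (f u - f v) = nrm (u - v)) -> mtop_complete V ->
    approx_fin (f @` S) -> closed (S : set (mtop V)) ->
  compact (S : set (mtop V)).
Proof.
move=> f_isom cV fS clS; rewrite compact_ultra => F FU FS.
have FF : ProperFilter F := @ultra_proper _ _ FU.
have [|v hv] := @filter_cauchy_cvg R V F cV FF.
  move=> e e0; have e4 : 0 < e / 4 by rewrite divr_gt0.
  have [J [x [M hJ]]] := fS _ e4.
  have [c hc] : exists c : V -> J -> R[i], forall a, S a ->
      (forall j, normc (c a j) <= M) /\
      nrm (f a - \sum_j c a j *: x j) <= e / 4.
    suff : forall a, exists c : J -> R[i], S a ->
        (forall j, normc (c j) <= M) /\ nrm (f a - \sum_j c j *: x j) <= e / 4.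
      by case/choice => c hc; exists c.
    move=> a.
    have [Sa|nSa] := pselect (S a); last by exists (fun=> 0).
    by have [|c c1 c2] := hJ (f a); [exists a|exists c].
  have lim (g : R[i] -> R) : (forall z, `|g z| <= normc z) ->
      exists r : J -> R, forall j (d : R), 0 < d -> F [set a | `|g (c a j) - r j| < d].
    move=> gle; suff : forall j, exists r : R, forall d : R, 0 < d ->
        F [set a | `|g (c a j) - r| < d] by case/choice => r hr; exists r.
    move=> j.
    apply: (@ultra_real_limit _ F _ M FU); apply: filterS FS => a /hc[h _] /=.
    exact: le_trans (gle _) (h j).
  have [r hr] := lim _ (@Re_le_normc R).
  have [s hs] := lim _ (@Im_le_normc R).
  pose N := \sum_j nrm (x j).
  have N0 : 0 <= N by apply: sumr_ge0 => j _; exact: nrm_ge0.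
  (* Real and imaginary parts within [d] give coefficients within [2 * d], hence an error of at most
     [e / 4] in norm; [N + 1] avoids a division by 0. *)
  pose d := e / 4 / (2 * (N + 1)).
  have d0 : 0 < d by rewrite divr_gt0// mulr_gt0// ltr_wpDl.
  have Fr : F [set a | forall j, `|Re (c a j) - r j| < d].
    by apply: (@filter_forall _ J (fun j a => `|Re (c a j) - r j| < d)) => j; exact: hr.
  have Fs : F [set a | forall j, `|Im (c a j) - s j| < d].
    by apply: (@filter_forall _ J (fun j a => `|Im (c a j) - s j| < d)) => j; exact: hs.
  pose p := \sum_j (r j +i* s j) *: x j.
  have Fp : F [set a | nrm (f a - p) <= e / 2].
    apply: filterS3 FS Fr Fs => a Sa ra sa /=.
    have [_ h] := hc _ Sa.
    rewrite (le_trans (nrm_triangle (\sum_j c a j *: x j) _ _))//.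
    have -> : e / 2 = e / 4 + e / 4 by lra.
    rewrite lerD// /p -sumrB (le_trans (nrm_sum _ _ _))//.
    apply: (@le_trans _ _ (\sum_j (2 * d) * nrm (x j))).
      apply: ler_sum => j _; rewrite -scalerBl nrmZ ler_wpM2r ?nrm_ge0//.
      have := ra j; have := sa j; case: (c a j) => u w /= h1 h2.
      have d20 : 0 <= 2 * d by rewrite mulr_ge0// ltW.
      rewrite -[X in _ <= X]ger0_norm// -sqrtr_sqr ler_wsqrtr//.
      have h1' : (w - s j) ^+ 2 <= d ^+ 2.
        by rewrite -real_normK ?num_real// ler_sqr ?nnegrE ?(ltW d0)// ltW.
      have h2' : (u - r j) ^+ 2 <= d ^+ 2.
        by rewrite -real_normK ?num_real// ler_sqr ?nnegrE ?(ltW d0)// ltW.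
      by move: (d) h1' h2' => d'; clear; have := sqr_ge0 d'; nra.
    rewrite -mulr_sumr -/N /d.
    rewrite (_ : 2 * _ * N = e / 4 * (N / (N + 1))); last by field; lra.
    rewrite ler_piMr//; first exact: ltW.
    by rewrite ler_pdivrMr ?mul1r ?ltr_wpDl// lerDl.
  (* The limit combination [p] need not be a value of [f]. A member of the set replaces it as a
     centre, at the price of another [e / 2]. *)
  have [a ha] := filter_ex Fp.
  exists a; apply: filterS Fp => y /= hy.
  rewrite -f_isom (le_trans (nrm_triangle p _ _))//.
  by rewrite (nrmB p) (splitr e) lerD.
exists v; split.
  apply: (closed_mtop_in clS) => e e0.
  by have [y [Sy vy]] := filter_ex (filterI FS (hv e e0)); exists y.
move=> P /nbhs_ballP[e /= e0 eP]; apply: filterS (hv e e0) => y /= vy.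
by apply: eP; rewrite mtop_ballE.
Qed.

End Compactness.

Section TraceCoordinates.
Context {R : realType} {A : cstarAlgType R} (tau : A -> R[i]).
Hypothesis tau_tracial : faithful_tracial tau.
Implicit Types (a b x : A).

Let tau_state : states tau. Proof. by case: tau_tracial. Qed.
Let tau_lin : scalar tau := state_scalar tau_state.

(** The inner product of the GNS construction for [tau], linear in the second variable. *)
Definition tau_ip x a : R[i] := tau (star x * a).
Local Notation ip := tau_ip.

Lemma tau_ip_conj x a : (ip x a)^*%C = ip a x.
Proof. by rewrite /ip -state_star// starM starK. Qed.

Lemma tau_ipDr x a b : ip x (a + b) = ip x a + ip x b.
Proof. by rewrite /ip mulrDr scalarfD. Qed.

Lemma tau_ipBr x a b : ip x (a - b) = ip x a - ip x b.
Proof. by rewrite /ip mulrBr scalarfB. Qed.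

Lemma tau_ipZr x c a : ip x (c *: a) = c * ip x a.
Proof. by rewrite /ip -scalerAr scalarfZ. Qed.

Lemma tau_ip_sumr x (I : Type) (r : seq I) (F : I -> A) :
  ip x (\sum_(i <- r) F i) = \sum_(i <- r) ip x (F i).
Proof. by rewrite /ip mulr_sumr scalarf_sum. Qed.

Definition nrm2 a : R := Re (ip a a).

Lemma tau_ipE a : ip a a = (nrm2 a)%:C.
Proof. by apply: real_complex_eq; have /complex_ge0[] := state_pos tau_state a. Qed.

Lemma nrm2_ge0 a : 0 <= nrm2 a.
Proof. by have /complex_ge0[] := state_pos tau_state a. Qed.

Lemma nrm2_eq0 a : nrm2 a = 0 -> a = 0.
Proof.
move=> h; case: tau_tracial => _ _ f; apply: f.
by have := tau_ipE a; rewrite h /ip => ->.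
Qed.

Lemma tau_bessel x a : nrm2 x = 1 -> normc (ip x a) ^+ 2 <= nrm2 a.
Proof.
move=> x1.
have := nrm2_ge0 (a - ip x a *: x); rewrite /nrm2 tau_ipBr tau_ipZr.
rewrite -[ip (a - _) a]tau_ip_conj -[ip (a - _) x]tau_ip_conj.
rewrite !tau_ipBr !tau_ipZr (tau_ipE x) x1 mulr1 subrr conjc0 mulr0 subr0.
rewrite rmorphB rmorphM /= !tau_ip_conj tau_ipE -[ip a x]tau_ip_conj.
case: (ip x a) => u v /=.
move=> h; rewrite sqr_sqrtr; last by rewrite addr_ge0 ?sqr_ge0.
lra.
Qed.

Definition tau_proj (t : seq A) a : A := \sum_(x <- t) ip x a *: x.

Lemma tau_projD t a b : tau_proj t (a + b) = tau_proj t a + tau_proj t b.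
Proof.
by rewrite -big_split; apply: eq_bigr => x _; rewrite tau_ipDr scalerDl.
Qed.

Lemma tau_projZ t c a : tau_proj t (c *: a) = c *: tau_proj t a.
Proof.
by rewrite scaler_sumr; apply: eq_bigr => x _; rewrite tau_ipZr scalerA.
Qed.

Lemma tau_proj_sum t (I : Type) (r : seq I) (F : I -> A) :
  tau_proj t (\sum_(i <- r) F i) = \sum_(i <- r) tau_proj t (F i).
Proof.
elim: r => [|i r IH]; last by rewrite !big_cons tau_projD IH.
by rewrite !big_nil -{1}(scale0r (0 : A)) tau_projZ scale0r.
Qed.

(** Orthonormality of [t] is carried as unit vectors fixed by [tau_proj t]: pairing the fixed-point
    equation of [x] with [x] gives coefficients whose squared moduli sum to 1, and that of [x] is
    already 1. *)
Lemma gram_schmidt (s : seq A) : exists t : seq A,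
  [/\ forall x, x \in t -> nrm2 x = 1, forall x, x \in t -> tau_proj t x = x
    & forall x, x \in s -> tau_proj t x = x].
Proof.
elim: s => [|a s [t [t1 tt ts]]]; first by exists [::]; split.
pose r := a - tau_proj t a.
have [r0|r0] := eqVneq r 0.
  exists t; split => // x; rewrite inE => /orP[/eqP->|/ts//].
  by apply/esym/eqP; rewrite -subr_eq0; apply/eqP.
(* [tau_proj t] is symmetric for the trace form, so the residual [r] is orthogonal to whatever it
   fixes. *)
have orth x : tau_proj t x = x -> ip x r = 0.
  move=> Px; rewrite /r tau_ipBr {1}/tau_proj tau_ip_sumr.
  rewrite -[in X in X - _]Px -[ip (tau_proj _ _) a]tau_ip_conj tau_ip_sumr.
  rewrite rmorph_sum -sumrB /= big1_seq// => y _.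
  by rewrite !tau_ipZr rmorphM /= !tau_ip_conj mulrC subrr.
have Pr : tau_proj t r = 0.
  by rewrite /tau_proj big1_seq// => x /andP[_ /tt/orth ->]; rewrite scale0r.
have n0 : 0 < nrm2 r.
  by rewrite lt_neqAle nrm2_ge0 andbT eq_sym; apply: contra r0 => /eqP/nrm2_eq0 ->.
pose nu := Num.sqrt (nrm2 r).
have nu0 : 0 < nu by rewrite sqrtr_gt0.
pose q := nu^-1%:C *: r.
have rE : r = nu%:C *: q by rewrite scalerA -rmorphM mulfV ?scale1r// gt_eqF.
have q1 : ip q q = 1.
  rewrite /q tau_ipZr -tau_ip_conj tau_ipZr rmorphM /= tau_ip_conj tau_ipE.
  apply/eqP; rewrite eq_complex /= !(mul0r, mulr0, subr0, addr0, oppr0) eqxx andbT.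
  have <- : nu ^+ 2 = nrm2 r by rewrite sqr_sqrtr// nrm2_ge0.
  by apply/eqP; field; rewrite gt_eqF.
have qorth x : tau_proj t x = x -> ip q x = 0.
  by move=> /orth h; rewrite -tau_ip_conj /q tau_ipZr h mulr0 conjc0.
have PcE x : tau_proj (q :: t) x = ip q x *: q + tau_proj t x.
  by rewrite /tau_proj big_cons.
have Pfix x : tau_proj t x = x -> tau_proj (q :: t) x = x.
  by move=> h; rewrite PcE qorth// scale0r add0r.
have Pq : tau_proj (q :: t) q = q.
  by rewrite PcE q1 scale1r {2}/q tau_projZ Pr scaler0 addr0.
have PP : tau_proj t (tau_proj t a) = tau_proj t a.
  rewrite {2}/tau_proj tau_proj_sum; apply: eq_big_seq => x xt.
  by rewrite tau_projZ tt.
exists (q :: t); split.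
- by move=> x; rewrite inE => /orP[/eqP->|/t1//]; rewrite /nrm2 q1.
- by move=> x; rewrite inE => /orP[/eqP->//|/tt]; exact: Pfix.
- move=> x; rewrite inE => /orP[/eqP->|/ts]; last exact: Pfix.
  have -> : a = nu%:C *: q + tau_proj t a by rewrite -rE subrK.
  by rewrite tau_projD tau_projZ Pq Pfix.
Qed.

Lemma finite_dim_coordinates (B : set A) : finite_dim B -> exists t : seq A,
  (forall x, x \in t -> nrm2 x = 1) /\ forall b, B b -> b = tau_proj t b.
Proof.
move=> [s hs]; have [t [t1 _ ts]] := gram_schmidt s.
exists t; split => // b /hs[c ->]; rewrite tau_proj_sum.
by apply: eq_bigr => i _; rewrite tau_projZ ts ?mem_nth.
Qed.

(** Each trace coordinate is at most the trace norm, by Bessel. This comparison is what turns a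
    trace-norm contraction into a norm contraction in [cexp_pos_sub]. *)
Lemma finite_dim_nrm2 (B : set A) : finite_dim B ->
  exists2 K : R, 0 <= K & forall b, B b -> nrm b ^+ 2 <= K * nrm2 b.
Proof.
move=> /finite_dim_coordinates[t [t1 tB]].
pose N := \sum_(x <- t) nrm x.
have N0 : 0 <= N by apply: sumr_ge0 => j _; exact: nrm_ge0.
exists (N ^+ 2); first exact: sqr_ge0.
move=> b /tB bE.
have le : nrm b <= N * Num.sqrt (nrm2 b).
  rewrite {1}bE (le_trans (nrm_sum _ _ _))// mulr_suml.
  rewrite big_seq [X in _ <= X]big_seq; apply: ler_sum => x xt.
  rewrite nrmZ mulrC ler_wpM2l ?nrm_ge0//.
  rewrite -[normc _]ger0_norm ?normc_ge0// -sqrtr_sqr ler_wsqrtr//.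
  exact/tau_bessel/t1.
rewrite -[X in _ * X]sqr_sqrtr ?nrm2_ge0// -exprMn.
by rewrite ler_sqr ?nnegrE ?nrm_ge0// mulr_ge0// sqrtr_ge0.
Qed.

End TraceCoordinates.

(** * Conditional expectations and ideals of AF-algebras *)

Section Subalgebra.
Context {R : realType} {A : cstarAlgType R} (B : cstarSubalg A).
Implicit Types (a b h : A).
Local Notation BS := (subalg_set B).

Lemma subalg0 : BS 0.
Proof. by have := subalgZD (-1) (subalg1 B) (subalg1 B); rewrite scaleN1r addNr. Qed.

Lemma subalgZ c a : BS a -> BS (c *: a).
Proof. by move=> Ba; rewrite -[_ *: _]addr0; apply: subalgZD => //; exact: subalg0. Qed.

Lemma subalgD a b : BS a -> BS b -> BS (a + b).
Proof. by move=> Ba Bb; rewrite -[a]scale1r; exact: subalgZD. Qed.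

Lemma subalgN a : BS a -> BS (- a).
Proof. by move=> Ba; rewrite -scaleN1r; exact: subalgZ. Qed.

Lemma subalgB a b : BS a -> BS b -> BS (a - b).
Proof. by move=> Ba Bb; apply: subalgD => //; exact: subalgN. Qed.

Lemma subalgX a n : BS a -> BS (a ^+ n).
Proof.
by move=> Ba; elim: n => [|n IH]; [exact: subalg1|rewrite exprS; exact: subalgM].
Qed.

Definition to_subalg a (Ba : BS a) : subalg_type B := exist _ a (mem_set Ba).

Lemma subalg_valP (x : subalg_type B) : BS (val x).
Proof. exact: set_mem (valP x). Qed.

Lemma subalg_sqrt h : BS h -> star h = h -> nrm h < 1 ->
  exists s, [/\ BS s, star s = s & s * s = 1 - h].
Proof.
move=> Bh hs h1.
have [||s ss sE] := @sqrt_one_sub R (subalg_type B) (to_subalg Bh).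
- exact: val_inj.
- exact: h1.
- exists (val s); split; first exact: subalg_valP.
    exact: (congr1 (fun z : subalg_type B => val z) ss).
  exact: (congr1 (fun z : subalg_type B => val z) sE).
Qed.

End Subalgebra.

Section ConditionalExpectations.
Context {R : realType} {A : cstarAlgType R} (An : nat -> cstarSubalg A)
  (An_incr : forall n, An n `<=` An n.+1)
  (An_fin : forall n, finite_dim (An n))
  (A0_scalars : An 0%N = range (fun c : R[i] => c%:A) :> set A)
  (An_dense : closure (\bigcup_n (An n : set A) : set (mtop A)) = setT)
  (tau : A -> R[i]) (tau_tracial : faithful_tracial tau)
  (E : nat -> A -> A) (E_cexp : forall n, cond_expectation tau (An n) (E n)).
Implicit Types (a b c x y : A) (m n : nat).

Let tau_state : states tau. Proof. by case: tau_tracial. Qed.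
Let tau_lin : scalar tau := state_scalar tau_state.

Lemma subalg_le m n : (m <= n)%N -> An m `<=` An n.
Proof.
elim: n => [|n IH]; first by rewrite leqn0 => /eqP->.
by rewrite leq_eqVlt => /orP[/eqP->//|/IH h x /h]; exact: An_incr.
Qed.

Lemma cexp_mem n a : subalg_set (An n) (E n a).
Proof. exact: cexp_in (E_cexp n) a. Qed.

Lemma cexpD n a b : E n (a + b) = E n a + E n b.
Proof. by have := cexp_linear (E_cexp n) 1 a b; rewrite !scale1r. Qed.

Lemma cexp0 n : E n 0 = 0.
Proof. by apply: (cexp_id (E_cexp n)); exact: subalg0. Qed.

Lemma cexpZ n (z : R[i]) a : E n (z *: a) = z *: E n a.
Proof. by have := cexp_linear (E_cexp n) z a 0; rewrite cexp0 !addr0. Qed.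

Lemma cexpB n a b : E n (a - b) = E n a - E n b.
Proof. by rewrite cexpD -scaleN1r cexpZ scaleN1r. Qed.

Lemma cexp_fix n m a : (m <= n)%N -> subalg_set (An m) a -> E n a = a.
Proof. by move=> mn am; apply: (cexp_id (E_cexp n)); exact: subalg_le mn _ am. Qed.

Lemma cexpMl n b a : subalg_set (An n) b -> E n (b * a) = b * E n a.
Proof.
move=> Bb; have := cexp_bimod (E_cexp n) a Bb (subalg1 (An n)).
by rewrite !mulr1.
Qed.

Lemma cexpMr n b a : subalg_set (An n) b -> E n (a * b) = E n a * b.
Proof.
move=> Bb; have := cexp_bimod (E_cexp n) a (subalg1 (An n)) Bb.
by rewrite !mul1r.
Qed.

(** [E n] is the orthogonal projection onto [An n] for the trace form. Together with [tau_separates]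
    this yields [cexp_star] and [cexp_tower]. *)
Lemma cexp_adj n b a : subalg_set (An n) b ->
  tau_ip tau b (E n a) = tau_ip tau b a.
Proof.
move=> Bb; rewrite /tau_ip -cexpMl; last exact: subalg_star.
by rewrite (cexp_trace (E_cexp n)).
Qed.

Lemma tau_separates n x y : subalg_set (An n) x -> subalg_set (An n) y ->
  (forall b, subalg_set (An n) b -> tau_ip tau b x = tau_ip tau b y) -> x = y.
Proof.
move=> Bx By h; apply/eqP; rewrite -subr_eq0; apply/eqP/(nrm2_eq0 tau_tracial).
by rewrite /nrm2 tau_ipBr// h ?subrr//; exact: subalgB.
Qed.

Lemma cexp_star n a : E n (star a) = star (E n a).
Proof.
apply: (@tau_separates n); [exact: cexp_mem|exact/subalg_star/cexp_mem|].
move=> b Bb; rewrite cexp_adj//.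
(* The trace property makes [star] antiunitary for the trace form. *)
have tauC u v : tau_ip tau u (star v) = (tau_ip tau (star u) v)^*%C.
  rewrite /tau_ip starK -starM state_star//; congr (_^*)%C.
  by case: tau_tracial => _ -> _.
by rewrite !tauC cexp_adj//; exact: subalg_star.
Qed.

Lemma cexp_tower m n a : (m <= n)%N -> E m (E n a) = E m a.
Proof.
move=> mn; apply: (@tau_separates m); try exact: cexp_mem.
by move=> b Bb; rewrite !cexp_adj//; exact: subalg_le mn _ Bb.
Qed.

Lemma cexp_tower_id m n a : (m <= n)%N -> E n (E m a) = E m a.
Proof. by move=> mn; apply: cexp_fix mn (cexp_mem _ _). Qed.

(** [E n] is a contraction that fixes [b]. The factor 2 is that of [FAF], which it enters through
    [lfam_mul]. *)
Lemma cexp_sub_le n a b : subalg_set (An n) b ->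
  nrm (a - E n a) <= 2 * nrm (a - b).
Proof.
move=> Bb; have -> : a - E n a = (a - b) - E n (a - b).
  by rewrite cexpB (cexp_fix (leqnn n) Bb) opprB addrA subrK.
rewrite (le_trans (nrmD _ _))// nrmN mulr_natl mulr2n lerD//.
exact: cexp_nrm (E_cexp n) _.
Qed.

Lemma cexp_sub_le2 n a : nrm (a - E n a) <= 2 * nrm a.
Proof. by have := cexp_sub_le a (subalg0 (An n)); rewrite subr0. Qed.

Lemma cexp_approx a (e : R) : 0 < e -> exists n, exists2 b,
  subalg_set (An n) b & nrm (a - b) < e.
Proof.
move=> e0; have : closure (\bigcup_n (An n : set A) : set (mtop A)) a.
  by rewrite An_dense.
by move=> /closure_mtopP/(_ e e0)[b [n _ Bb] ab]; exists n, b.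
Qed.

Lemma cexp0_scalar a : exists c : R[i], E 0%N a = c%:A.
Proof.
have := cexp_mem 0 a; rewrite A0_scalars => -[c _ <-]; by exists c.
Qed.

(* With [1 - y/N = s^2], positivity of [y] in [A] makes [s] a contraction for
   the trace norm, hence, [An n] being finite dimensional, for the norm. *)
Lemma cexp_pos_sub n y (eta : R) : subalg_set (An n) y -> cstar_pos y ->
  0 < eta -> exists2 d, subalg_set (An n) d & y + eta%:C%:A = star d * d.
Proof.
move=> By [d yE] eta0.
have ys : star y = y by rewrite yE starM starK.
pose N := nrm y + 1.
have N0 : 0 < N by rewrite ltr_wpDl// nrm_ge0.
pose h := N^-1%:C *: y.
have [||| s [Bs ss sE]] := @subalg_sqrt _ _ (An n) h.
- exact: subalgZ.
- by rewrite star_real_scale ys.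
- by rewrite nrmZR gtr0_norm ?invr_gt0// mulrC ltr_pdivrMr// mul1r ltrDl.
have s_contr x : nrm2 tau (s * x) <= nrm2 tau x.
  rewrite -subr_ge0.
  have -> : nrm2 tau x - nrm2 tau (s * x) = N^-1 * nrm2 tau (d * x).
    rewrite /nrm2 /tau_ip !starM ss -!mulrA (mulrA s s) sE mulrBl mul1r mulrBr.
    rewrite scalarfB// /h -scalerAl -scalerAr scalarfZ// yE -!mulrA.
    move: (tau (star x * x)) => [u v]. move: (tau _) => [u' v'] /=; ring.
  by rewrite mulr_ge0 ?nrm2_ge0// invr_ge0 ltW.
have [K K0 hK] := finite_dim_nrm2 tau_tracial (An_fin n).
have sX k : nrm2 tau (s ^+ k) <= 1.
  elim: k => [|k IH]; last by rewrite exprS (le_trans (s_contr _)).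
  by rewrite /nrm2 /tau_ip expr0 star1 mulr1 state1.
have s1 : nrm s ^+ 2 <= 1.
  (* All powers of [s] have trace norm at most 1, hence squared norm at most [K]; taking $2^j$-th
     roots removes [K]. *)
  apply: (@expr2n_bounded _ _ K) => // j.
  rewrite expr1n mulr1 exprAC -nrm_selfadj_pow//.
  rewrite (le_trans (hK _ (subalgX _ Bs)))//.
  by rewrite -[X in _ <= X]mulr1 ler_wpM2l.
have h1 : nrm (1 - h) <= 1 by rewrite -sE -{1}ss cstar_identity.
have Ne0 : 0 < N + eta by rewrite addr_gt0.
(* [nrm (1 - h)] may equal 1, whereas [subalg_sqrt] wants a norm below 1: this is why [eta] is
   added. As $N h = y$, one has $(N + \eta)(1 - g) = y + \eta$. *)
pose g := (N / (N + eta))%:C *: (1 - h).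
have [||| t [Bt ts tE]] := @subalg_sqrt _ _ (An n) g.
- by apply/subalgZ/subalgB; [exact: subalg1|exact: subalgZ].
- by rewrite star_real_scale starB star1 star_real_scale ys.
- rewrite nrmZR gtr0_norm ?divr_gt0//.
  rewrite (le_lt_trans (y := N / (N + eta)))//.
    by rewrite ler_piMr// ltW// divr_gt0.
  by rewrite ltr_pdivrMr// mul1r ltrDl.
exists ((Num.sqrt (N + eta))%:C *: t); first exact: subalgZ.
rewrite star_real_scale ts -scalerAl -scalerAr scalerA -rmorphM -expr2 sqr_sqrtr ?(ltW Ne0)//.
rewrite tE /g scalerBr scalerA -rmorphM mulrC divfK ?gt_eqF//.
rewrite scalerBr opprB addrA addrAC -scalerBl -rmorphB.
by rewrite addrAC subrr add0r /h scalerA -rmorphM mulfV ?gt_eqF// scale1r addrC.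
Qed.

End ConditionalExpectations.

Section IdealUnits.
Context {R : realType} {A : cstarAlgType R} (An : nat -> cstarSubalg A)
  (An_incr : forall n, An n `<=` An n.+1)
  (An_fin : forall n, finite_dim (An n))
  (tau : A -> R[i]) (tau_tracial : faithful_tracial tau)
  (I : closedIdeal A) (e : nat -> A)
  (e_unit : forall n, is_unit_of ((I : set A) `&` An n) (e n)).
Implicit Types (a b c x y : A) (m n : nat).

Lemma unit_mem n : subalg_set (An n) (e n).
Proof. by have [[]] := e_unit n. Qed.

Lemma unit_ideal n : ideal_set I (e n).
Proof. by have [[]] := e_unit n. Qed.

Lemma unit_mulr n a : ideal_set I a -> subalg_set (An n) a -> a * e n = a.
Proof. by move=> Ia Ba; have [_ /(_ a (conj Ia Ba))[]] := e_unit n. Qed.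

Lemma unit_mull n a : ideal_set I a -> subalg_set (An n) a -> e n * a = a.
Proof. by move=> Ia Ba; have [_ /(_ a (conj Ia Ba))[]] := e_unit n. Qed.

Lemma unit_idem n : e n * e n = e n.
Proof. exact: unit_mulr (unit_ideal n) (unit_mem n). Qed.

(** Both [a * e n] and [e n * a] lie in $I_n$, so both equal [e n * a * e n]. *)
Lemma unit_central n a : subalg_set (An n) a -> a * e n = e n * a.
Proof.
move=> Ba.
rewrite -(@unit_mull n (a * e n)).
- rewrite mulrA unit_mulr//; first by apply: Defs.idealMr; exact: unit_ideal.
  exact: subalgM (unit_mem n) Ba.
- by apply: Defs.idealMl; exact: unit_ideal.
- exact: subalgM Ba (unit_mem n).
Qed.

(** [closedIdeal] does not postulate stability under [star], so uniqueness of the unit cannot be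
    invoked. Instead [z = e n - star (e n) * e n] satisfies [star z * z = 0], because [e n] commutes
    with its adjoint. *)
Lemma unit_star n : star (e n) = e n.
Proof.
have Bs : subalg_set (An n) (star (e n)) by apply: subalg_star; exact: unit_mem.
have comm := unit_central Bs.
suff -> : e n = star (e n) * e n by rewrite starM starK.
apply/eqP; rewrite -subr_eq0; apply/eqP/nrm_eq0/eqP.
rewrite -sqrf_eq0 -cstar_identity; apply/eqP.
have ss : star (e n) * star (e n) = star (e n) by rewrite -starM unit_idem.
rewrite starB starM starK.
have -> : (star (e n) - star (e n) * e n) * (e n - star (e n) * e n) = 0.
  rewrite mulrBl !mulrBr -!mulrA unit_idem (mulrA (star (e n)) (star _)) ss.
  rewrite subrr sub0r.
  by rewrite (mulrA (e n)) -comm -mulrA unit_idem (mulrA _ (star _)) ss subrr oppr0.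
exact: nrm0.
Qed.

Lemma nrm_projection_le1 x : star x = x -> x * x = x -> nrm x <= 1.
Proof.
move=> xs xx; have := cstar_identity x; rewrite xs xx => h.
have := nrm_ge0 x; move: (nrm x) h => t h t0; rewrite leNgt.
apply/negP => t1; have t_gt0 : 0 < t by exact: lt_trans ltr01 t1.
by move: h; apply/eqP; rewrite lt_eqF// expr2 ltr_pMl.
Qed.

Lemma unit_le1 n : nrm (e n) <= 1.
Proof. exact: nrm_projection_le1 (unit_star n) (unit_idem n). Qed.

Lemma unitC_idem n : (1 - e n) * (1 - e n) = 1 - e n.
Proof. by rewrite mulrBr mulr1 mulrBl mul1r unit_idem subrr subr0. Qed.

Lemma unitC_star n : star (1 - e n) = 1 - e n.
Proof. by rewrite starB star1 unit_star. Qed.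

Lemma unitC_le1 n : nrm (1 - e n) <= 1.
Proof. exact: nrm_projection_le1 (unitC_star n) (unitC_idem n). Qed.

Lemma unit_mul_le m n : (m <= n)%N -> e m * e n = e m.
Proof.
by move=> mn; apply: unit_mulr (unit_ideal m) (subalg_le An_incr mn (unit_mem m)).
Qed.

Lemma unit_mul_le' m n : (m <= n)%N -> e n * e m = e m.
Proof.
by move=> mn; apply: unit_mull (unit_ideal m) (subalg_le An_incr mn (unit_mem m)).
Qed.

(* Otherwise the powers [h^(2^j)] of a norm-one positive [h] in [A_n (1 - e_n)]
   would accumulate at a norm-one element of [I]. *)
Lemma dist_ideal n a b : ideal_set I a -> subalg_set (An n) b ->
  nrm (b * (1 - e n)) <= nrm (b - a).
Proof.
move=> Ia Bb; rewrite leNgt; apply/negP => lt.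
set x := b * (1 - e n) in lt; set N := nrm x in lt.
have Bp : subalg_set (An n) (1 - e n) by apply: subalgB; [exact: subalg1|exact: unit_mem].
have Bx : subalg_set (An n) x by exact: subalgM.
have N0 : 0 < N by rewrite (le_lt_trans (nrm_ge0 (b - a))).
have pe : (1 - e n) * e n = 0 by rewrite mulrBl mul1r unit_idem subrr.
pose h := (N ^- 2)%:C *: (star x * x).
have Bh : subalg_set (An n) h by apply/subalgZ/subalgM => //; exact: subalg_star.
have hs : star h = h by rewrite /h star_real_scale starM starK.
have N20 : 0 < N ^- 2 by rewrite invr_gt0 exprn_gt0.
have h1 : nrm h = 1.
  by rewrite /h nrmZR cstar_identity gtr0_norm// mulVf// gt_eqF// exprn_gt0.
have he : h * e n = 0.
  by rewrite /h -scalerAl /x -!mulrA pe !mulr0 scaler0.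
pose dl := nrm (b - a) / N.
have dl0 : 0 <= dl by rewrite divr_ge0 ?nrm_ge0// ltW.
have dl1 : dl < 1 by rewrite ltr_pdivrMr// mul1r.
pose a1 := (N ^- 2)%:C *: (star x * (a * (1 - e n))).
have Ia1 : ideal_set I a1.
  by rewrite /a1 -mulr_algl; apply/Defs.idealMl/Defs.idealMl; exact: Defs.idealMr.
have ha1 : nrm (h - a1) <= dl.
  rewrite /h /a1 -scalerBr -mulrBr -mulrBl nrmZR gtr0_norm//.
  rewrite ler_pdivrMl ?exprn_gt0// /dl.
  have -> : N ^+ 2 * (nrm (b - a) / N) = N * nrm (b - a).
    by field; rewrite gt_eqF.
  rewrite (le_trans (nrmM _ _))// nrm_star ler_wpM2l ?(ltW N0)//.
  by rewrite (le_trans (nrmM _ _))// ler_piMr ?nrm_ge0 ?unitC_le1.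
(* Submultiplicativity of the quotient norm: [(h - a1) * (h ^+ k.+1 - c)] differs from [h ^+ k.+2]
   by an element of [I]. So the distance from the powers of [h] to [I] decays geometrically, while
   the norms of the $h^{2^j}$ remain 1. *)
have pow k : exists2 c, ideal_set I c & nrm (h ^+ k.+1 - c) <= dl ^+ k.+1.
  elim: k => [|k [c Ic hc]]; first by exists a1.
  exists (h * c + a1 * h ^+ k.+1 - a1 * c).
    rewrite -[- (a1 * c)]mulrN; apply: Defs.idealD; last exact: Defs.idealMr.
    by apply: Defs.idealD; [exact: Defs.idealMl|exact: Defs.idealMr].
  have -> : h ^+ k.+2 - (h * c + a1 * h ^+ k.+1 - a1 * c) =
      (h - a1) * (h ^+ k.+1 - c).
    rewrite mulrBl !mulrBr -exprS !opprD !opprK !addrA //.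
  by rewrite [dl ^+ _]exprS (le_trans (nrmM _ _))// ler_pM ?nrm_ge0.
have [t [t1 tB]] := finite_dim_coordinates tau_tracial (An_fin n).
pose S : set A := [set y | subalg_set (An n) y /\ nrm y = 1].
have nrm_dist (u v : A) : `|nrm u - nrm v| <= nrm (u - v).
  rewrite ler_norml; apply/andP; split.
    by rewrite lerBrDr addrC lerBlDr nrmB -{1}(subrK u v) addrC nrmD.
  by rewrite lerBlDr -{1}(subrK v u) nrmD.
have cS : compact (S : set (mtop A)).
  apply: (@approx_fin_compact _ _ A id) => //.
  - exact: cstar_complete.
  - move=> d d0; exists 'I_(size t), (tnth (in_tuple t)), (\sum_(x <- t) nrm x).
    move=> _ [y [By y1] <-]; exists (fun j => tau_ip tau (tnth (in_tuple t) j) y).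
      move=> j; have tau_state : states tau by case: tau_tracial.
      rewrite (le_trans (state_le_nrm tau_state _))// (le_trans (nrmM _ _))//.
      rewrite y1 mulr1 nrm_star (big_tnth _ _ t) (bigD1 j)//= lerDl.
      by apply: sumr_ge0 => i _; exact: nrm_ge0.
    rewrite {1}(tB _ By) /tau_proj (big_tnth _ _ t) subrr nrm0.
    exact: ltW.
  - apply: closed_mtopP => y hy; split.
      apply: (@closed_mtop_in _ _ (subalg_set (An n)) y (@Defs.subalg_closed _ _ (An n))) => d /hy[z [Bz _] zy].
      by exists z.
    apply/eqP; rewrite -subr_eq0 -normr_le0; apply/ler_addgt0Pr => d /hy[z [_ z1] yz].
    by rewrite add0r -z1 (le_trans (nrm_dist y z))// ltW.
pose Y j : mtop A := h ^+ (2 ^ j).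
have YS : (Y @ \oo) S.
  exists 0%N => // j _ /=; split; first exact: subalgX.
  by rewrite nrm_selfadj_pow// h1 expr1n.
have [z [[Bz z1] clz]] := cS _ _ YS.
have near_z (d : R) : 0 < d -> forall M, exists2 j, (M <= j)%N & nrm (z - h ^+ (2 ^ j)) < d.
  move=> d0 M.
  have [|u [[j Mj <-]]] := clz [set Y j | j in [set j | (M <= j)%N]] _ _ (nbhsx_ballx z d d0).
    by exists M => // j /= Mj; exists j.
  by rewrite mtop_ballE; exists j.
have Iz : ideal_set I z.
  apply: (@closed_mtop_in _ _ (ideal_set I) z (@Defs.ideal_closed _ _ I)) => d d0.
  have d2 : 0 < d / 2 by rewrite divr_gt0.
  have [M hM] := @expr_lt_eps _ dl (d / 2) (introT andP (conj dl0 dl1)) d2.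
  have [j Mj zj] := near_z _ d2 M.
  have [c Ic] := pow (2 ^ j).-1; rewrite prednK ?expn_gt0// => hc.
  exists c => //; rewrite (le_lt_trans (nrm_triangle (h ^+ (2 ^ j)) _ _))//.
  rewrite (splitr d) ltrD// (le_lt_trans hc)// (le_lt_trans _ hM)//.
  apply: ler_wiXn2l => //; first exact: ltW.
  by rewrite (leq_trans Mj)// ltnW// ltn_expl.
(* The contradiction: [h * e n = 0] passes to the accumulation point [z], yet [e n] is a unit for
   [z], which lies in both [I] and [An n]. *)
have : z * e n = 0.
  apply: nrm_eq0; apply/eqP; rewrite eq_le nrm_ge0 andbT.
  apply/ler_addgt0Pr => d d0; rewrite add0r.
  have [j _ zj] := near_z _ d0 0%N.
  have -> : z * e n = (z - h ^+ (2 ^ j)) * e n.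
    rewrite mulrBl; have -> : h ^+ (2 ^ j) * e n = 0; last by rewrite subr0.
    by rewrite -(prednK (expn_gt0 2 j)) exprSr -mulrA he mulr0.
  by rewrite (le_trans (nrmM _ _))// (le_trans _ (ltW zj))// ler_piMr ?nrm_ge0 ?unit_le1.
rewrite unit_mulr// => z0; move: z1; rewrite z0 nrm0 => /eqP.
by rewrite eq_sym oner_eq0.
Qed.

(** Quantitative form of the density of $\bigcup_n I_n$ in $I$: an approximant from $A_n$ is moved
    into $I_n$ at the cost of a factor 2. *)
Lemma ideal_approx n a b : ideal_set I a -> subalg_set (An n) b ->
  nrm (a - b * e n) <= 2 * nrm (a - b).
Proof.
move=> Ia Bb; have -> : a - b * e n = (a - b) + b * (1 - e n).
  by rewrite mulrBr mulr1 addrA subrK.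
rewrite (le_trans (nrmD _ _))// mulr_natl mulr2n lerD//.
by rewrite (le_trans (dist_ideal Ia Bb))// nrmB.
Qed.

End IdealUnits.

(** * Quantum metrics from families of seminorms *)

Section SupFamily.
Context {R : realType} {X T : Type} (l : T -> X -> R).
Local Open Scope ereal_scope.

Definition sup_of (a : X) : \bar R := ereal_sup [set (l t a)%:E | t in [set: T]].

Lemma sup_of_leP a (y : \bar R) : sup_of a <= y <-> forall t, (l t a)%:E <= y.
Proof.
split=> [h t|h]; last by apply: ge_ereal_sup => _ [t _ <-].
by apply: le_trans h; apply: ereal_sup_ubound; exists t.
Qed.

Lemma sup_of_ub a t : (l t a)%:E <= sup_of a.
Proof. by have /sup_of_leP := lexx (sup_of a); apply. Qed.

Hypothesis l_ge0 : forall t a, (0 <= l t a)%R.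

Lemma sup_of_ge0 (t : T) a : 0 <= sup_of a.
Proof. by rewrite (le_trans _ (sup_of_ub a t))// lee_fin. Qed.

Lemma sup_of_fin (t : T) a : sup_of a < +oo ->
  exists r : R, [/\ (0 <= r)%R, sup_of a = r%:E & forall t, (l t a <= r)%R].
Proof.
have := sup_of_ge0 t a; have := @sup_of_ub a.
case: (sup_of a) => [r|//|//] h; rewrite lee_fin => r0 _.
by exists r; split => // t'; rewrite -lee_fin.
Qed.

Lemma sup_of_scale (t : T) (k : R) a b : (0 <= k)%R ->
    (forall t, l t b = k * l t a)%R -> sup_of a < +oo ->
  sup_of b = k%:E * sup_of a.
Proof.
move=> k0 h /(sup_of_fin t)[r [r0 aE lr]]; rewrite aE -EFinM.
apply/eqP; rewrite eq_le; apply/andP; split.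
  by apply/sup_of_leP => t'; rewrite lee_fin h ler_wpM2l.
have [->|kn0] := eqVneq k 0%R; first by rewrite mul0r sup_of_ge0.
have kp : (0 < k)%R by rewrite lt_neqAle eq_sym kn0.
rewrite EFinM -lee_pdivlMl// -aE; apply/sup_of_leP => t'.
by rewrite lee_pdivlMl// -EFinM -h sup_of_ub.
Qed.

End SupFamily.

Section SeminormFamily.
Context {R : realType} {B : cstarAlgType R} {T : Type}.

(** Each member is continuous, with its own constant; only the supremum may be infinite. The
    seminorms of all three bundles have this shape, so that the axioms are checked once. Continuity
    makes the unit balls closed, by [fam_closed_le]. *)
Record seminorm_family (l : T -> B -> R) : Prop := {
  fam_add : forall t a b, l t (a + b) <= l t a + l t b;
  fam_scale : forall t (c : R[i]) a, l t (c *: a) = normc c * l t a;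
  fam_bound : forall t, exists C : R, forall a, l t a <= C * nrm a
}.

Context (l : T -> B -> R) (l_fam : seminorm_family l).

Lemma fam0 t : l t 0 = 0.
Proof. by rewrite -(scale0r (0 : B)) fam_scale// normc0 mul0r. Qed.

Lemma famN t a : l t (- a) = l t a.
Proof. by rewrite -scaleN1r fam_scale// normcN normc1 mul1r. Qed.

Lemma famB t a b : l t (a - b) <= l t a + l t b.
Proof. by rewrite -(famN t b) fam_add. Qed.

Lemma fam_ge0 t a : 0 <= l t a.
Proof.
rewrite -(@pmulrn_lge0 _ _ 2)// mulr2n -{2}famN.
by rewrite -(fam0 t) -(subrr a) fam_add.
Qed.

Lemma fam_closed_le t a (r : R) :
  (forall e : R, 0 < e -> exists2 b, l t b <= r & nrm (a - b) < e) -> l t a <= r.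
Proof.
move=> h; have [C hC] := fam_bound l_fam t.
pose K := `|C| + 1; have K0 : 0 < K by rewrite ltr_wpDl.
apply/ler_addgt0Pr => e e0.
have [|b br ab] := h (e / K); first by rewrite divr_gt0.
have -> : a = b + (a - b) by rewrite addrC subrK.
rewrite (le_trans (fam_add l_fam _ _ _))// lerD// (le_trans (hC _))//.
rewrite (le_trans (y := K * nrm (a - b)))//.
  by rewrite ler_wpM2r ?nrm_ge0// (le_trans (ler_norm _))// lerDl.
by rewrite mulrC -ler_pdivlMr// ltW.
Qed.

End SeminormFamily.

Section Qcms.
Context {R : realType} {B : cstarAlgType R} {T : Type} (t0 : T)
  (l : T -> B -> R) (l_fam : seminorm_family l)
  (l_star : forall t a, l t (star a) = l t a)
  (l_mul : forall t a b, l t (a * b) <= 2 * (nrm a * l t b + l t a * nrm b))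
  (l_one : forall t, l t 1 = 0)
  (l_ker : forall a, (forall t, l t a = 0) -> exists c : R[i], a = c%:A)
  (l_dense : forall (a : B) (e : R), 0 < e ->
     exists2 b, nrm (a - b) < e & exists r : R, forall t, l t b <= r)
  (l_approx : forall e : R, 0 < e -> exists (J : finType) (x : J -> B) (M : R),
     forall a, (forall t, l t a <= 1) -> exists c0 : R[i],
       exists2 c : J -> R[i], forall j, normc (c j) <= M
         & nrm (a - c0%:A - \sum_j c j *: x j) <= e).

Implicit Types (a b : B).

Definition lip_of : B -> \bar R := sa_restrict (sup_of l).

Let l_ge0 := fam_ge0 l_fam.

Lemma lip_of_selfadj a : star a = a -> lip_of a = sup_of l a.
Proof. by rewrite /lip_of /sa_restrict => ->; rewrite eqxx. Qed.

Lemma lip_of_leP a (r : R) : (lip_of a <= r%:E)%E <->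
  star a = a /\ forall t, l t a <= r.
Proof.
rewrite /lip_of /sa_restrict; case: eqP => [sa|nsa]; last by split=> // -[].
split=> [/sup_of_leP h|[_ h]]; first by split=> // t; rewrite -lee_fin.
by apply/sup_of_leP => t; rewrite lee_fin.
Qed.

Lemma lip_of_fin a : (lip_of a < +oo)%E -> exists r : R,
  [/\ star a = a, 0 <= r, lip_of a = r%:E & forall t, l t a <= r].
Proof.
rewrite /lip_of /sa_restrict; case: eqP => [sa|//] /(sup_of_fin l_ge0 t0)[r [r0 aE h]].
by exists r.
Qed.

Lemma lip_of_ge0 a : (0 <= lip_of a)%E.
Proof.
by rewrite /lip_of /sa_restrict; case: eqP => // _; exact: sup_of_ge0.
Qed.

Lemma lip_of_leibniz a b (r s : R) :
    star a = a -> star b = b -> (forall t, l t a <= r) -> (forall t, l t b <= s) ->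
  (maxe (lip_of (jordan a b)) (lip_of (lie a b)) <= (FAF (nrm a) (nrm b) r s)%:E)%E.
Proof.
move=> sa sb ar bs; rewrite ge_max /FAF.
have mulle t : l t (a * b) <= 2 * (nrm a * s + nrm b * r).
  rewrite (le_trans (l_mul _ _ _))// ler_wpM2l// lerD//.
    by rewrite ler_wpM2l ?nrm_ge0.
  by rewrite mulrC ler_wpM2l ?nrm_ge0.
have mulle' t : l t (b * a) <= 2 * (nrm a * s + nrm b * r).
  rewrite (le_trans (l_mul _ _ _))// ler_wpM2l// addrC lerD//.
    by rewrite mulrC ler_wpM2l ?nrm_ge0.
  by rewrite ler_wpM2l ?nrm_ge0.
apply/andP; split; apply/lip_of_leP; split.
- exact: star_jordan.
- move=> t; rewrite /jordan fam_scale// normc_half ler_pdivrMl//.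
  rewrite (le_trans (fam_add l_fam _ _ _))//.
  by have := mulle t; have := mulle' t; lra.
- exact: star_lie.
- move=> t; rewrite /lie fam_scale// normc_half_i ler_pdivrMl//.
  rewrite (le_trans (famB l_fam _ _ _))//.
  by have := mulle t; have := mulle' t; lra.
Qed.

Lemma fam_scalar t (c : R[i]) : l t c%:A = 0.
Proof. by rewrite fam_scale// l_one mulr0. Qed.

Lemma lip_of_dense_sa (a : B) (e : R) : star a = a -> 0 < e ->
  exists2 b, nrm (a - b) < e & exists r : R,
    [/\ 0 <= r, star b = b & forall t, l t b <= r].
Proof.
move=> sa e0; have [b ab [r br]] := l_dense a e0.
have r0 : 0 <= r by rewrite (le_trans (l_ge0 t0 b)).
exists (re_part b).
  have -> : a - re_part b = re_part (a - b).
    by rewrite re_partB (re_part_id sa).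
  exact: le_lt_trans (nrm_re _) ab.
exists r; split=> //; first exact: selfadj_re.
move=> t; rewrite /re_part fam_scale// normc_half ler_pdivrMl//.
rewrite (le_trans (fam_add l_fam _ _ _))// l_star.
by have := br t; lra.
Qed.

(** Scalars cancel in a difference of states, so total boundedness of the Lipschitz ball modulo
    scalars ([l_approx]) reduces [mk] to finitely many evaluations. This is one half of Rieffel's
    criterion for the weak star topology; [mk_controls] is the other. *)
Lemma state_diff_le (e : R) : 0 < e -> exists (J : finType) (x : J -> B) (M : R),
  0 <= M /\ forall phi psi a, states phi -> states psi -> (forall t, l t a <= 1) ->
    normc (phi a - psi a) <= 2 * e + M * \sum_j normc (phi (x j) - psi (x j)).
Proof.
move=> e0; have [J [x [M h]]] := l_approx e0.
exists J, x, `|M|; split=> // phi psi a sphi spsi /h[c0 [c cM hc]].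
have lphi := state_scalar sphi; have lpsi := state_scalar spsi.
set z := a - c0%:A - _ in hc.
have aE : a = z + c0%:A + \sum_j c j *: x j by rewrite /z addrAC subrK subrK.
clearbody z; have expand (f : B -> R[i]) : states f ->
    f a = f z + c0 + \sum_j c j * f (x j).
  move=> sf; have lf := state_scalar sf.
  rewrite aE (scalarfD lf (z + _)) (scalarfD lf z) (scalarfZ lf c0) (state1 sf) mulr1.
  rewrite (scalarf_sum lf); congr (_ + _).
  by apply: eq_bigr => j _; rewrite (scalarfZ lf (c j)).
have -> : phi a - psi a = phi z - psi z + \sum_j c j * (phi (x j) - psi (x j)).
  rewrite (expand _ sphi) (expand _ spsi) opprD addrACA [in X in X + _]opprD.
  rewrite [X in X + _ = _]addrACA subrr addr0.
  by rewrite -sumrB; congr (_ + _); apply: eq_bigr => j _; rewrite mulrBr.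
rewrite (le_trans (le_normcD _ _))// lerD//.
  rewrite (le_trans (le_normcD _ _))// normcN mulr_natl mulr2n lerD//.
    exact: le_trans (state_le_nrm sphi _) hc.
  exact: le_trans (state_le_nrm spsi _) hc.
have normc_sum (F : J -> R[i]) : normc (\sum_j F j) <= \sum_j normc (F j).
  elim/big_rec2: _ => [|j y1 y2 _ IH]; first by rewrite normc0.
  by rewrite (le_trans (le_normcD _ _))// lerD.
rewrite (le_trans (normc_sum _))// mulr_sumr ler_sum// => j _.
rewrite normcM ler_wpM2r ?normc_ge0// (le_trans (cM j))//; exact: ler_norm.
Qed.

Lemma lip_ball_of a : lip_ball lip_of a <-> star a = a /\ forall t, l t a <= 1.
Proof.
by split=> [[sa /lip_of_leP[]]|[sa h]]; [split|split=> //; apply/lip_of_leP].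
Qed.

Lemma mk_leP phi psi (y : \bar R) : (mk lip_of phi psi <= y)%E <->
  forall a, star a = a -> (forall t, l t a <= 1) ->
    ((normc (phi a - psi a))%:E <= y)%E.
Proof.
split=> [h a sa la|h]; last first.
  by apply: ge_ereal_sup => _ [a /lip_ball_of[sa la] <-]; exact: h.
apply: le_trans h; apply: ereal_sup_ubound; exists a => //.
exact/lip_ball_of.
Qed.

Lemma mk_ge0 phi psi : (0 <= mk lip_of phi psi)%E.
Proof.
have /mk_leP/(_ 0) := lexx (mk lip_of phi psi).
move=> /(_ (star0 (A := B))) h; apply: le_trans (h _); last by move=> t; rewrite fam0.
by rewrite lee_fin normc_ge0.
Qed.

Lemma mk_lip_bound phi psi (b : B) (r d : R) : states phi -> states psi ->
    star b = b -> 0 <= r -> (forall t, l t b <= r) ->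
    (mk lip_of phi psi <= d%:E)%E ->
  normc (phi b - psi b) <= (r + 1) * d.
Proof.
move=> sphi spsi sb r0 br /mk_leP h.
have r1 : 0 < r + 1 by rewrite ltr_wpDl.
have := h ((r + 1)^-1%:C *: b); rewrite star_real_scale sb => /(_ erefl).
rewrite (scalarfZ (state_scalar sphi)) (scalarfZ (state_scalar spsi)).
rewrite -mulrBr normcM normc_real gtr0_norm ?invr_gt0// lee_fin => h'.
rewrite -ler_pdivrMl//; apply: h' => t.
rewrite fam_scale// normc_real gtr0_norm ?invr_gt0// ler_pdivrMl// mulr1.
by rewrite (le_trans (br t))// lerDl.
Qed.

(** Density of the domain: on Lipschitz elements [mk_lip_bound] applies, and a norm-small remainder
    is harmless for any state. Self-adjoint elements come first, since [mk] only tests those. *)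
Lemma mk_controls phi (a : B) (eta : R) : states phi -> 0 < eta ->
  exists2 d : R, 0 < d & forall psi, states psi ->
    (mk lip_of phi psi < d%:E)%E -> normc (phi a - psi a) < eta.
Proof.
move=> sphi eta0.
have sa_case (h : B) (e : R) : star h = h -> 0 < e -> exists2 d : R, 0 < d &
    forall psi, states psi -> (mk lip_of phi psi < d%:E)%E ->
      normc (phi h - psi h) < e.
  move=> sh e0; have e3 : 0 < e / 3 by rewrite divr_gt0.
  have [b hb [r [r0 sb br]]] := lip_of_dense_sa sh e3.
  have r1 : 0 < r + 1 by rewrite ltr_wpDl.
  exists (e / 3 / (r + 1)); first by rewrite divr_gt0.
  move=> psi spsi /ltW/(mk_lip_bound sphi spsi sb r0 br).
  have -> : (r + 1) * (e / 3 / (r + 1)) = e / 3 by field; rewrite gt_eqF.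
  have -> : phi h - psi h = phi (h - b) - psi (h - b) + (phi b - psi b).
    rewrite (scalarfB (state_scalar sphi)) (scalarfB (state_scalar spsi)).
    by ring.
  move=> h1; rewrite (le_lt_trans (le_normcD _ _))//.
  rewrite (le_lt_trans (lerD (le_normcD _ _) h1))// normcN.
  have h2 := state_le_nrm sphi (h - b); have h3 := state_le_nrm spsi (h - b).
  lra.
have eta2 : 0 < eta / 2 by rewrite divr_gt0.
have [d1 d10 h1] := sa_case _ _ (selfadj_re a) eta2.
have [d2 d20 h2] := sa_case _ _ (selfadj_im a) eta2.
exists (Num.min d1 d2); first by rewrite lt_min d10.
move=> psi spsi hmk.
have m1 : (mk lip_of phi psi < d1%:E)%E.
  by apply: lt_le_trans hmk _; rewrite lee_fin ge_min lexx.
have m2 : (mk lip_of phi psi < d2%:E)%E.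
  by apply: lt_le_trans hmk _; rewrite lee_fin ge_min lexx orbT.
have -> : phi a - psi a = (phi (re_part a) - psi (re_part a)) +
    'i%C * (phi (im_part a) - psi (im_part a)).
  have lphi := state_scalar sphi; have lpsi := state_scalar spsi.
  move: (re_part a) (im_part a) (re_imE a) => u v ->.
  rewrite (scalarfD lphi u) (scalarfD lpsi u) (scalarfZ lphi) (scalarfZ lpsi).
  by rewrite mulrBr opprD addrACA.
rewrite (le_lt_trans (le_normcD _ _))// normcM.
have -> : normc ('i%C : R[i]) = 1 by rewrite /normc /= expr0n /= add0r expr1n sqrtr1.
by rewrite mul1r (splitr eta) ltrD// ?h1 ?h2.
Qed.

(** The balls of [(R[i])^o] have radii in [R[i]]; a positive element of [R[i]] is real, so real
    radii suffice. *)
Lemma eventually_normc (F : set_system (B -> R[i])) (a : B) (z : R[i]) :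
    Filter F ->
    ((fun g : B -> (R[i])^o => g a) @ F --> (z : (R[i])^o)) <->
    forall e : R, 0 < e -> F [set g | normc (z - g a) < e].
Proof.
move=> FF; split=> [h e e0|h].
  have eC : 0 < e%:C by rewrite ltcR.
  apply: (@filterS _ F FF _ _ _ (h _ (nbhsx_ballx (z : (R[i])^o) _ eC))) => g.
  by rewrite /= /ball /= normr_normc ltcR.
apply/cvg_ballP => e e0.
have eE : e = (Re e)%:C by apply: real_complex_eq; move: e0; rewrite ltcE => /andP[/eqP].
have e1 : 0 < Re e by move: e0; rewrite {1}eE ltcR.
apply: filterS (h _ e1) => g /=.
by rewrite /ball /= eE normr_normc ltcR.
Qed.

Lemma mk_nbhs phi (U : set (B -> R[i])) : states phi ->
  within states (nbhs (phi : {ptws B -> (R[i])^o})) U <->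
  exists2 e : R, 0 < e &
    forall psi, states psi -> (mk lip_of phi psi < e%:E)%E -> U psi.
Proof.
move=> sphi; split=> [hU|[e e0 hU]].
  (* The filter generated by the [mk]-balls of states around [phi]. It converges pointwise to [phi],
     hence contains every weak star neighbourhood. *)
  pose G : set_system (B -> R[i]) := [set V | exists2 e : R, 0 < e &
    forall psi, states psi -> (mk lip_of phi psi < e%:E)%E -> V psi].
  have GF : Filter G.
    split.
    - by exists 1.
    - move=> P Q [e1 e10 h1] [e2 e20 h2]; exists (Num.min e1 e2).
        by rewrite lt_min e10.
      move=> psi spsi h; split; [apply: h1|apply: h2] => //;
        by apply: lt_le_trans h _; rewrite lee_fin ge_min lexx ?orbT.
    - by move=> P Q PQ [e e0 h]; exists e => // psi spsi /(h _ spsi)/PQ.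
  have Gphi : {ptws, (G : set_system (mtop B -> (R[i])^o)) --> (phi : mtop B -> (R[i])^o)}.
    apply/pointwise_cvgP => a; apply: (proj2 (@eventually_normc G a (phi a) GF)) => e e0.
    exact: mk_controls.
  have [e e0 h] := Gphi _ hU; exists e => // psi spsi hpsi.
  exact: h.
have e4 : 0 < e / 4 by rewrite divr_gt0.
have [J [x [M [M0 h]]]] := state_diff_le e4.
(* Then [M * #|J|%:R * d <= e / 4], and the total is at most [3 / 4 * e]; a strict inequality is
   needed. *)
pose d := e / 4 / (M * #|J|%:R + 1).
have d0 : 0 < d by rewrite divr_gt0// ltr_wpDl// mulr_ge0.
pose N : set_system (B -> R[i]) := nbhs (phi : {ptws mtop B -> (R[i])^o}).
have NF : Filter N := nbhs_filter (phi : {ptws mtop B -> (R[i])^o}).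
have phicvg : {ptws, (N : set_system (mtop B -> (R[i])^o)) -->
    (phi : mtop B -> (R[i])^o)} by [].
have near_x : N [set psi | forall j, normc (phi (x j) - psi (x j)) < d].
  apply: (@filter_forall _ J (fun j psi => normc (phi (x j) - psi (x j)) < d) N NF) => j.
  have /pointwise_cvgP/(_ (x j)) hj := phicvg.
  exact: (proj1 (@eventually_normc N (x j) (phi (x j)) NF) hj).
change (N (fun psi => states psi -> U psi)).
apply: (@filterS _ N NF _ _ _ near_x) => psi hpsi spsi; apply: hU => //.
apply: (@le_lt_trans _ _ (2 * (e / 4) + M * (#|J|%:R * d))%:E).
  apply/mk_leP => a sa la; rewrite lee_fin (le_trans (h _ _ _ sphi spsi la))//.
  rewrite lerD// ler_wpM2l//.
  rewrite (le_trans (ler_sum _ (fun j _ => ltW (hpsi j))))//.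
  by rewrite sumr_const mulr_natl.
rewrite lte_fin.
have K0 : 0 < M * #|J|%:R + 1 by rewrite ltr_wpDl// mulr_ge0.
have : M * (#|J|%:R * d) <= e / 4.
  rewrite mulrA /d mulrCA ler_piMr ?(ltW e4)//.
  by rewrite ler_pdivrMr// mul1r lerDl.
lra.
Qed.

Lemma mk_metrizes : metrizes_weak_star (mk lip_of).
Proof.
split.
- move=> phi psi sphi spsi.
  have [J [x [M [M0 h]]]] := state_diff_le (ltr01 : 0 < (1 : R)).
  rewrite ge0_fin_numE ?mk_ge0//.
  apply: (@le_lt_trans _ _ (2 * 1 + M * \sum_j normc (phi (x j) - psi (x j)))%:E).
    by apply/mk_leP => a sa la; rewrite lee_fin; exact: h.
  by rewrite ltry.
- move=> phi psi sphi spsi; split=> [h0|<-]; last first.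
    apply/eqP; rewrite eq_le mk_ge0 andbT; apply/mk_leP => a sa la.
    by rewrite subrr normc0.
  apply/funext => a; apply/eqP; rewrite -subr_eq0; apply/eqP/eq0_normc/eqP.
  rewrite eq_le normc_ge0 andbT; apply/ler_addgt0Pr => e e0; rewrite add0r.
  have [d d0 hd] := mk_controls a sphi e0.
  by apply/ltW/hd => //; rewrite h0 lte_fin.
- move=> phi psi _ _.
  have sym f g : (mk lip_of f g <= mk lip_of g f)%E.
    apply/mk_leP => a sa la; have /mk_leP/(_ a sa la) := lexx (mk lip_of g f).
    by rewrite -[normc (f a - _)]normcN opprB.
  by apply/eqP; rewrite eq_le !sym.
- move=> phi psi chi _ _ _; apply/mk_leP => a sa la.
  have /mk_leP/(_ a sa la) h1 := lexx (mk lip_of phi psi).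
  have /mk_leP/(_ a sa la) h2 := lexx (mk lip_of psi chi).
  apply: le_trans (leeD h1 h2); rewrite -EFinD lee_fin.
  by rewrite (le_trans _ (le_normcD _ _))// addrA subrK.
- by move=> phi U; exact: mk_nbhs.
Qed.

Theorem lip_of_qcms : leibniz_qcms (@FAF R) lip_of.
Proof.
split.
- by move=> a /lip_of_fin[r []].
- exact: lip_of_ge0.
- move=> t a afin; have [r [sa r0 aE la]] := lip_of_fin afin.
  rewrite (lip_of_selfadj sa) lip_of_selfadj; last by rewrite star_real_scale sa.
  apply: (sup_of_scale l_ge0 t0) => //.
    by move=> t'; rewrite fam_scale// normc_real.
  by rewrite -lip_of_selfadj.
- move=> a b.
  have [afin|] := boolP (lip_of a < +oo)%E; last first.
    by rewrite -leNgt leye_eq => /eqP->; rewrite addye ?leey// gt_eqF// (lt_le_trans _ (lip_of_ge0 b)).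
  have [bfin|] := boolP (lip_of b < +oo)%E; last first.
    by rewrite -leNgt leye_eq => /eqP->; rewrite addey ?leey// gt_eqF// (lt_le_trans _ (lip_of_ge0 a)).
  have [r [sa r0 -> la]] := lip_of_fin afin; have [s [sb s0 -> lb]] := lip_of_fin bfin.
  rewrite -EFinD; apply/lip_of_leP; split; first by rewrite starD sa sb.
  by move=> t; rewrite (le_trans (fam_add l_fam _ _ _))// lerD.
- move=> a b /lip_of_fin[r [sa r0 _ la]] /lip_of_fin[s [sb s0 _ lb]].
  have := lip_of_leibniz sa sb la lb; rewrite ge_max => /andP[h _].
  exact: le_lt_trans h (ltry _).
- move=> a b /lip_of_fin[r [sa r0 _ la]] /lip_of_fin[s [sb s0 _ lb]].
  have := lip_of_leibniz sa sb la lb; rewrite ge_max => /andP[_ h].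
  exact: le_lt_trans h (ltry _).
- move=> a sa; apply/closure_mtopP => e e0.
  have [b ab [r [r0 sb lb]]] := lip_of_dense_sa sa e0; exists b => //=.
  have /lip_of_leP h : star b = b /\ forall t, l t b <= r by [].
  exact: le_lt_trans h (ltry _).
- move=> a; split=> [h|[t ->]].
    have /lip_of_leP[sa la] : (lip_of a <= 0%:E)%E by rewrite h.
    have [|c aE] := @l_ker a.
      by move=> t; apply/eqP; rewrite eq_le la l_ge0.
    exists (Re c); rewrite {1}aE; congr (_ *: _); apply: real_complex_eq.
    move: sa; rewrite aE starZ star1 => /eqP.
    rewrite -subr_eq0 -scalerBl => /eqP/(congr1 nrm).
    rewrite nrm_scalar nrm0 => /eq0_normc/eqP; rewrite subr_eq0.
    case: c {aE} => u v; rewrite eq_complex /= => /andP[_ /eqP hv]; lra.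
  apply/eqP; rewrite eq_le lip_of_ge0 andbT; apply/lip_of_leP; split.
    by rewrite star_real_scale star1.
  by move=> t'; rewrite fam_scalar.
- exact: mk_metrizes.
- apply: closed_mtopP => a ha; apply/lip_ball_of; split.
    apply/eqP; rewrite -subr_eq0; apply/eqP/nrm_eq0/eqP.
    rewrite eq_le nrm_ge0 andbT; apply/ler_addgt0Pr => e e0; rewrite add0r.
    have e2 : 0 < e / 2 by rewrite divr_gt0.
    have [b /lip_ball_of[sb _] ab] := ha _ e2.
    have -> : star a - a = star (a - b) - (a - b).
      by rewrite starB sb opprB addrA subrK.
    by rewrite (le_trans (nrmD _ _))// nrmN nrm_star (splitr e) lerD// ltW.
  move=> t; apply: (fam_closed_le l_fam) => e e0.
  by have [b /lip_ball_of[_ lb] ab] := ha _ e0; exists b.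
- move=> a b /lip_of_fin[r [sa r0 -> la]] /lip_of_fin[s [sb s0 -> lb]] /=.
  exact: lip_of_leibniz.
Qed.

End Qcms.

(** * Vector bundles from families of seminorms *)

Section SeminormBundle.
Context {R : realType} {B : cstarAlgType R} {T S : Type} (t0 : T) (s0 : S)
  (l : T -> B -> R) (l_fam : seminorm_family l)
  (l_qcms : leibniz_qcms (@FAF R) (lip_of l))
  (l_star : forall t a, l t (star a) = l t a)
  (J : closedIdeal B) (D : ideal_mod J -> \bar R)
  (d : S -> B -> R) (d_fam : seminorm_family d)
  (DE : forall w, D w = sup_of d (val w : B))
  (d_nrm : forall a, d s0 a = nrm a)
  (d_mul : forall a w (y z : R), (forall t, l t a <= y) -> (forall s, d s w <= z) ->
     forall s, d s (a * w) <= 2 * (nrm a * z + y * z))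
  (d_inner : forall v w (y z : R), ideal_set J v -> ideal_set J w ->
     (forall s, d s v <= y) -> (forall s, d s w <= z) ->
     forall t, l t (v * star w) <= 4 * (y * z))
  (d_dense : forall (a : B) (e : R), ideal_set J a -> 0 < e ->
     exists b, [/\ ideal_set J b, nrm (a - b) < e
       & exists r : R, forall s, d s b <= r])
  (d_approx : approx_fin [set a : B | ideal_set J a /\ forall s, d s a <= 1]).

Let d_ge0 := fam_ge0 d_fam.

Lemma ideal_valP (w : ideal_mod J) : ideal_set J (val w).
Proof. exact: set_mem (valP w). Qed.

Lemma dnorm_leP (w : ideal_mod J) (r : R) :
  (D w <= r%:E)%E <-> forall s, d s (val w : B) <= r.
Proof.
by rewrite DE; split=> [/sup_of_leP h s|h]; [rewrite -lee_fin|apply/sup_of_leP => s; rewrite lee_fin].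
Qed.

Lemma dnorm_fin (w : ideal_mod J) : (D w < +oo)%E -> exists r : R,
  [/\ 0 <= r, D w = r%:E & forall s, d s (val w : B) <= r].
Proof. by rewrite DE => /(sup_of_fin d_ge0 s0). Qed.

Theorem seminorm_bundle :
  metrized_bundle (@FAF R) (@GAF R) (@HAF R) (@Bundle R B (lip_of l) (ideal_mod J) D).
Proof.
split => /=.
- exact: l_qcms.
- by move=> w; rewrite DE; exact: sup_of_ge0.
- apply/eqP; rewrite eq_le; apply/andP; split.
    by apply/dnorm_leP => s; rewrite (fam0 d_fam).
  by rewrite DE; exact: sup_of_ge0.
- move=> w h; have /dnorm_leP/(_ s0) : (D w <= 0%:E)%E by rewrite h.
  rewrite d_nrm => h0; apply: val_inj; apply: nrm_eq0.
  by apply/eqP; rewrite eq_le h0 nrm_ge0.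
- move=> c w; rewrite !DE => fin.
  apply: (sup_of_scale d_ge0 s0) => //; first exact: normc_ge0.
  move=> s; rewrite -(fam_scale d_fam); congr (d s _).
  exact: mulr_algl.
- move=> v w; rewrite !DE; apply/sup_of_leP => s.
  apply: le_trans (leeD (sup_of_ub _ _ s) (sup_of_ub _ _ s)).
  by rewrite -EFinD lee_fin; exact: (fam_add d_fam).
- apply/seteqP; split=> // w _; apply/closure_mtopP => e e0.
  have [b [Jb wb [r br]]] := d_dense (ideal_valP w) e0.
  exists (exist _ b (mem_set Jb)) => //=.
  by apply: (@le_lt_trans _ _ r%:E); [apply/dnorm_leP|exact: ltry].
- move=> w; have -> : nrm w = d s0 (val w : B) by rewrite d_nrm.
  by rewrite DE; exact: sup_of_ub.
- apply: (@approx_fin_compact _ _ B (fun w : ideal_mod J => val w : B)) => //.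
  + exact: hilbert_complete.
  + move=> e /d_approx[K [x [M h]]]; exists K, x, M => a [w /dnorm_leP hw <-].
    by apply: h; split=> //; exact: ideal_valP.
  + apply: closed_mtopP => w hw; apply/dnorm_leP => s.
    apply: (fam_closed_le d_fam) => e e0.
    by have [v /dnorm_leP hv wv] := hw _ e0; exists (val v).
- move=> a w sa /(lip_of_fin t0 l_fam)[r [_ r0 -> la]] /dnorm_fin[z [z0 -> dw]] /=.
  by apply/dnorm_leP => s; exact: d_mul.
- move=> v w /dnorm_fin[y [y0 -> dv]] /dnorm_fin[z [z0 -> dw]] /=.
  have le t : l t (inner v w) <= 4 * (y * z).
    exact: d_inner (ideal_valP v) (ideal_valP w) dv dw t.
  have HE : HAF y z = 4 * (y * z) by rewrite /HAF /FAF; ring.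
  rewrite HE ge_max; apply/andP; split; apply/lip_of_leP; split.
  + exact: selfadj_re.
  + move=> t; rewrite /re_part (fam_scale l_fam) normc_half ler_pdivrMl//.
    rewrite (le_trans (fam_add l_fam _ _ _))// l_star.
    by have := le t; lra.
  + exact: selfadj_im.
  + move=> t; rewrite /im_part (fam_scale l_fam) normc_half_i ler_pdivrMl//.
    rewrite (le_trans (famB l_fam _ _ _))// l_star.
    by have := le t; lra.
Qed.

End SeminormBundle.

(** * Direct sums of C*-algebras and of ideals *)

Section ProductAlgebra.
Context {R : realType} (A1 A2 : cstarAlgType R).
Local Notation P := (A1 * A2)%type.
Implicit Types (a b : P).

Definition prod_nrm a : R := Num.max (nrm a.1) (nrm a.2).

Let prod_nrm0 : prod_nrm 0 = 0.
Proof. by rewrite /prod_nrm /= !nrm0 maxxx. Qed.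

Let prod_nrm_eq0 a : prod_nrm a = 0 -> a = 0.
Proof.
case: a => x y h; have : prod_nrm (x, y) <= 0 by rewrite h.
rewrite /prod_nrm ge_max /= => /andP[x0 y0].
by congr pair; apply: nrm_eq0; apply/eqP; rewrite eq_le nrm_ge0 andbT.
Qed.

Let prod_nrmN a : prod_nrm (- a) = prod_nrm a.
Proof. by rewrite /prod_nrm /= !nrmN. Qed.

Let prod_nrmD a b : prod_nrm (a + b) <= prod_nrm a + prod_nrm b.
Proof.
rewrite /prod_nrm /= ge_max; apply/andP; split.
  by rewrite (le_trans (nrmD _ _))// lerD// le_max lexx.
by rewrite (le_trans (nrmD _ _))// lerD// le_max lexx orbT.
Qed.

HB.instance Definition _ :=
  hasNorm.Build R P prod_nrm0 prod_nrm_eq0 prod_nrmN prod_nrmD.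

Lemma nrm_pairE a : nrm a = Num.max (nrm a.1) (nrm a.2).
Proof. by []. Qed.

Definition prod_star a : P := (star a.1, star a.2).

Let prod_nrmZ (c : R[i]) a : nrm (c *: a) = normc c * nrm a.
Proof. by rewrite !nrm_pairE /= !nrmZ maxr_pMr// normc_ge0. Qed.

Let prod_nrmM a b : nrm (a * b) <= nrm a * nrm b.
Proof.
rewrite !nrm_pairE /= ge_max; apply/andP; split.
  by rewrite (le_trans (nrmM _ _))// ler_pM ?nrm_ge0// le_max lexx.
by rewrite (le_trans (nrmM _ _))// ler_pM ?nrm_ge0// le_max lexx orbT.
Qed.

Let prod_starK : involutive prod_star.
Proof. by case=> x y; rewrite /prod_star /= !starK. Qed.

Let prod_starD : {morph prod_star : a b / a + b}.
Proof. by move=> a b; rewrite /prod_star /= !starD. Qed.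

Let prod_starZ (c : R[i]) a : prod_star (c *: a) = c^*%C *: prod_star a.
Proof. by rewrite /prod_star /= !starZ. Qed.

Let prod_starM a b : prod_star (a * b) = prod_star b * prod_star a.
Proof. by rewrite /prod_star /= !starM. Qed.

Let prod_cstar a : nrm (prod_star a * a) = nrm a ^+ 2.
Proof.
rewrite !nrm_pairE /= !cstar_identity; have := nrm_ge0 a.1; have := nrm_ge0 a.2.
move: (nrm a.1) (nrm a.2) => x y y0 x0.
case: (lerP x y) => [xy|/ltW xy]; [rewrite max_r//|rewrite max_l//];
  by rewrite ler_sqr ?nnegrE.
Qed.

Let prod_complete (F : set_system (mtop P)) : ProperFilter F ->
  cauchy F -> exists a : mtop P, F --> a.
Proof.
move=> FF /cauchy_ballP Fc.
have fst_le (a b : P) : nrm (a.1 - b.1) <= nrm (a - b).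
  by rewrite [leRHS]nrm_pairE le_max lexx.
have snd_le (a b : P) : nrm (a.2 - b.2) <= nrm (a - b).
  by rewrite [leRHS]nrm_pairE le_max lexx orbT.
have cauchy_proj (V : cstarAlgType R) (f : P -> V) :
    (forall a b, nrm (f a - f b) <= nrm (a - b)) ->
    exists v : V, forall e : R, 0 < e -> F [set a | nrm (v - f a) < e].
  move=> f_le.
  have [|v Fv] := @cstar_complete R V (f @ F) (fmap_proper_filter f FF).
    apply/cauchy_ballP => e e0; rewrite near_map2.
    apply: filterS (Fc e e0) => -[a b] /=.
    by rewrite !mtop_ballE /=; exact: le_lt_trans.
  exists v => e e0; have := Fv _ (nbhsx_ballx (v : mtop V) e e0).
  by rewrite mtop_ballE.
have [v1 h1] := cauchy_proj A1 fst fst_le.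
have [v2 h2] := cauchy_proj A2 snd snd_le.
exists ((v1, v2) : P) => U /nbhs_ballP[e /= e0 eU].
apply: filterS2 (h1 e e0) (h2 e e0) => a a1 a2; apply: eU.
by rewrite mtop_ballE /= nrm_pairE gt_max a1.
Qed.

HB.instance Definition _ := isCStarAlgebra.Build R P
  prod_nrmZ prod_nrmM prod_starK prod_starD prod_starZ prod_starM prod_cstar
  prod_complete.

Lemma nrm_fst a : nrm a.1 <= nrm a.
Proof. by rewrite nrm_pairE le_max lexx. Qed.

Lemma nrm_snd a : nrm a.2 <= nrm a.
Proof. by rewrite nrm_pairE le_max lexx orbT. Qed.

Variables (I1 : closedIdeal A1) (I2 : closedIdeal A2).

Let prod_ideal_closed :
  closed ([set a : P | ideal_set I1 a.1 /\ ideal_set I2 a.2] : set (mtop P)).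
Proof.
apply: closed_mtopP => a ha; split.
  apply: (@closed_mtop_in _ _ (ideal_set I1) _ (@Defs.ideal_closed _ _ I1)) => e /ha[b [b1 _] ab].
  by exists b.1 => //; exact: le_lt_trans (nrm_fst (a - b)) ab.
apply: (@closed_mtop_in _ _ (ideal_set I2) _ (@Defs.ideal_closed _ _ I2)) => e /ha[b [_ b2] ab].
by exists b.2 => //; exact: le_lt_trans (nrm_snd (a - b)) ab.
Qed.

Let prod_ideal0 : [set a : P | ideal_set I1 a.1 /\ ideal_set I2 a.2] 0.
Proof. by split; exact: Defs.ideal0. Qed.

Let prod_idealD a b : [set a : P | ideal_set I1 a.1 /\ ideal_set I2 a.2] a ->
  [set a : P | ideal_set I1 a.1 /\ ideal_set I2 a.2] b ->
  [set a : P | ideal_set I1 a.1 /\ ideal_set I2 a.2] (a + b).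
Proof. by move=> [a1 a2] [b1 b2]; split; exact: Defs.idealD. Qed.

Let prod_idealMl a b : [set a : P | ideal_set I1 a.1 /\ ideal_set I2 a.2] b ->
  [set a : P | ideal_set I1 a.1 /\ ideal_set I2 a.2] (a * b).
Proof. by move=> [b1 b2]; split; exact: Defs.idealMl. Qed.

Let prod_idealMr a b : [set a : P | ideal_set I1 a.1 /\ ideal_set I2 a.2] a ->
  [set a : P | ideal_set I1 a.1 /\ ideal_set I2 a.2] (a * b).
Proof. by move=> [a1 a2]; split; exact: Defs.idealMr. Qed.

Definition prod_ideal : closedIdeal P :=
  ClosedIdeal prod_ideal0 prod_idealD prod_idealMl prod_idealMr prod_ideal_closed.

End ProductAlgebra.

(** * The bundles of an ideal *)

Section AFFamilies.
Context {R : realType} {A : cstarAlgType R} (An : nat -> cstarSubalg A)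
  (An_incr : forall n, An n `<=` An n.+1)
  (An_fin : forall n, finite_dim (An n))
  (A0_scalars : An 0%N = range (fun c : R[i] => c%:A) :> set A)
  (An_dense : closure (\bigcup_n (An n : set A) : set (mtop A)) = setT)
  (tau : A -> R[i]) (tau_tracial : faithful_tracial tau)
  (E : nat -> A -> A) (E_cexp : forall n, cond_expectation tau (An n) (E n))
  (beta : nat -> R) (beta_gt0 : forall n, 0 < beta n)
  (beta_cvg0 : beta @ \oo --> (0 : R))
  (I : closedIdeal A) (e : nat -> A)
  (e_unit : forall n, is_unit_of ((I : set A) `&` An n) (e n)).
Implicit Types (a b v w : A) (m n : nat).

Let tau_state : states tau. Proof. by case: tau_tracial. Qed.

Definition lfam n a : R := nrm (a - E n a) / beta n.

(** One index type for the three entries of the maximum, so that [D_I] is a single supremum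
    ([DidealE]). *)
Definition dfam (s : option (nat + nat)) a : R :=
  match s with
  | None => nrm a
  | Some (inl n) => lfam n a
  | Some (inr n) => nrm (a - a * e n) / beta n
  end.

Lemma lfam_leP n a (r : R) : (lfam n a <= r) = (nrm (a - E n a) <= r * beta n).
Proof. by rewrite /lfam ler_pdivrMr. Qed.

Lemma seminorm_lfam : seminorm_family lfam.
Proof.
split.
- move=> n a b; rewrite /lfam -mulrDl ler_pM2r ?invr_gt0//.
  by rewrite (cexpD E_cexp) opprD addrACA nrmD.
- by move=> n c a; rewrite /lfam (cexpZ E_cexp) -scalerBr nrmZ mulrA.
- move=> n; exists (2 / beta n) => a; rewrite /lfam mulrAC ler_pM2r ?invr_gt0//.
  exact: (cexp_sub_le2 An_incr E_cexp).
Qed.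

Lemma seminorm_dfam : seminorm_family dfam.
Proof.
split.
- case=> [[n|n]|] a b /=; first exact: (fam_add seminorm_lfam).
    rewrite -mulrDl ler_pM2r ?invr_gt0//.
    by rewrite mulrDl opprD addrACA nrmD.
  exact: nrmD.
- case=> [[n|n]|] c a /=; first exact: (fam_scale seminorm_lfam).
    by rewrite -scalerAl -scalerBr nrmZ mulrA.
  exact: nrmZ.
- case=> [[n|n]|] /=; first exact: (fam_bound seminorm_lfam).
    exists ((beta n)^-1) => a; rewrite mulrC ler_pM2l ?invr_gt0//.
    rewrite -{1}(mulr1 a) -mulrBr (le_trans (nrmM _ _))// ler_piMr ?nrm_ge0//.
    exact: (unitC_le1 e_unit).
  by exists 1 => a; rewrite mul1r.
Qed.

Lemma lfam_star n a : lfam n (star a) = lfam n a.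
Proof. by rewrite /lfam (cexp_star tau_tracial E_cexp) -starB nrm_star. Qed.

Lemma lfam_mul n a b : lfam n (a * b) <= 2 * (nrm a * lfam n b + lfam n a * nrm b).
Proof.
rewrite lfam_leP.
have -> : 2 * (nrm a * lfam n b + lfam n a * nrm b) * beta n =
    2 * (nrm a * nrm (b - E n b) + nrm (a - E n a) * nrm b).
  by rewrite /lfam; field; rewrite gt_eqF.
rewrite (le_trans (cexp_sub_le An_incr E_cexp _ (subalgM (cexp_mem E_cexp n a) (cexp_mem E_cexp n b))))//.
rewrite ler_wpM2l//.
have -> : a * b - E n a * E n b = (a - E n a) * b + E n a * (b - E n b).
  by rewrite mulrBl mulrBr addrA subrK.
rewrite (le_trans (nrmD _ _))// addrC lerD// (le_trans (nrmM _ _))//.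
by rewrite ler_wpM2r ?nrm_ge0//; exact: cexp_nrm (E_cexp n) a.
Qed.

Lemma lfam_eq0 n m a : (n <= m)%N -> subalg_set (An n) a -> lfam m a = 0.
Proof.
by move=> nm Ba; rewrite /lfam (cexp_fix An_incr E_cexp nm Ba) subrr nrm0 mul0r.
Qed.

Lemma lfam_one n : lfam n 1 = 0.
Proof. exact: lfam_eq0 (leqnn n) (subalg1 _). Qed.

Lemma lfam_ker a : (forall n, lfam n a = 0) -> exists c : R[i], a = c%:A.
Proof.
move=> /(_ 0%N)/eqP; rewrite /lfam mulf_eq0 invr_eq0 (gt_eqF (beta_gt0 0%N)) orbF.
move=> /eqP/nrm_eq0/eqP; rewrite subr_eq0 => /eqP ->.
exact: (cexp0_scalar A0_scalars E_cexp).
Qed.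

Lemma lfam_bounded n a : subalg_set (An n) a -> exists r : R, forall m, lfam m a <= r.
Proof.
move=> Ba; exists (\sum_(i < n) lfam i a) => m.
have [nm|mn] := leqP n m.
  rewrite (lfam_eq0 nm Ba); apply: sumr_ge0 => i _.
  exact: (fam_ge0 seminorm_lfam).
rewrite (bigD1 (Ordinal mn))//= lerDl; apply: sumr_ge0 => i _.
exact: (fam_ge0 seminorm_lfam).
Qed.

Lemma dfam_bounded n a : ideal_set I a -> subalg_set (An n) a ->
  exists r : R, forall s, dfam s a <= r.
Proof.
move=> Ia Ba; have [r hr] := lfam_bounded Ba.
have r0 : 0 <= r by rewrite (le_trans _ (hr 0%N))// (fam_ge0 seminorm_lfam).
have d0 s : 0 <= dfam s a by exact: (fam_ge0 seminorm_dfam).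
pose q := \sum_(i < n) dfam (Some (inr (i : nat))) a.
have q0 : 0 <= q by apply: sumr_ge0 => i _; exact: d0.
exists (nrm a + r + q); case=> [[m|m]|].
- rewrite (le_trans (hr m))//; have := nrm_ge0 a; lra.
- have [nm|mn] := leqP n m.
    rewrite /dfam (unit_mulr e_unit Ia (subalg_le An_incr nm Ba)) subrr nrm0 mul0r.
    by rewrite !addr_ge0// nrm_ge0.
  have : dfam (Some (inr m)) a <= q.
    by rewrite /q (bigD1 (Ordinal mn))//= lerDl; apply: sumr_ge0 => i _; exact: (d0 (Some (inr _))).
  move=> /le_trans; apply; have := nrm_ge0 a; lra.
- by rewrite /=; lra.
Qed.

Lemma lfam_le1 n a : (forall m, lfam m a <= 1) -> nrm (a - E n a) <= beta n.
Proof. by move=> /(_ n); rewrite lfam_leP mul1r. Qed.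

Lemma beta_small (d : R) : 0 < d -> exists n, beta n <= d.
Proof.
move=> d0; have /cvgrPdist_lt/(_ d d0)[N _ /(_ N (leqnn N))] := beta_cvg0.
by rewrite /= sub0r normrN gtr0_norm// => h; exists N; exact: ltW.
Qed.

Lemma subalg_coordinates n : exists (J : finType) (x : J -> A) (M : R),
  [/\ forall j, subalg_set (An n) (x j), 0 <= M
    & forall a, subalg_set (An n) a -> exists2 c : J -> R[i],
        forall j, normc (c j) <= M * nrm a & a = \sum_j c j *: x j].
Proof.
have [t [t1 tB]] := finite_dim_coordinates tau_tracial (An_fin n).
have M0 : 0 <= \sum_(x <- t) nrm x by apply: sumr_ge0 => x _; exact: nrm_ge0.
(* [finite_dim] provides a spanning family in [A], possibly outside [An n]. Applying [E n] brings it
   inside and leaves the expansions of elements of [An n] valid. *)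
exists 'I_(size t), (fun j => E n (tnth (in_tuple t) j)), (\sum_(x <- t) nrm x).
split=> //; first by move=> j; exact: (cexp_mem E_cexp).
move=> a Ba; exists (fun j => tau_ip tau (tnth (in_tuple t) j) a).
  move=> j; rewrite (le_trans (state_le_nrm tau_state _))// (le_trans (nrmM _ _))//.
  rewrite nrm_star ler_wpM2r ?nrm_ge0// (big_tnth _ _ t) (bigD1 j)//= lerDl.
  by apply: sumr_ge0 => i _; exact: nrm_ge0.
rewrite -{1}(cexp_fix An_incr E_cexp (leqnn n) Ba) {1}(tB _ Ba) /tau_proj.
rewrite (big_tnth _ _ t).
elim/big_rec2: _ => [|j y1 y2 _ <-]; first exact: (cexp0 E_cexp).
by rewrite (cexpD E_cexp) (cexpZ E_cexp).
Qed.

(** The Lipschitz ball is bounded modulo scalars: $E_n a - E_0 a = E_n(a - E_0 a)$ has norm at most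
    [beta 0], which bounds its coordinates. *)
Lemma lfam_coordinates n : exists (J : finType) (x : J -> A) (M : R),
  (forall j, subalg_set (An n) (x j)) /\
  forall a, (forall m, lfam m a <= 1) -> exists c0 : R[i], E 0%N a = c0%:A /\
    exists2 c : J -> R[i], forall j, normc (c j) <= M
      & E n a = c0%:A + \sum_j c j *: x j.
Proof.
have [J [x [M [xB M0 h]]]] := subalg_coordinates n.
exists J, x, (M * beta 0%N); split=> // a la.
have [c0 c0E] := cexp0_scalar A0_scalars E_cexp a; exists c0; split=> //.
have dE : E n a - c0%:A = E n (a - E 0%N a).
  by rewrite (cexpB E_cexp) (cexp_tower_id An_incr E_cexp _ (leq0n n)) c0E.
have [|c hc cE] := h (E n a - c0%:A).
  by rewrite dE; exact: (cexp_mem E_cexp).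
exists c; last by rewrite -cE addrC subrK.
move=> j; rewrite (le_trans (hc j))// ler_wpM2l// dE.
by rewrite (le_trans (cexp_nrm (E_cexp n) _))// lfam_le1.
Qed.

Lemma dfam_mul a w (y z : R) : (forall n, lfam n a <= y) ->
  (forall s, dfam s w <= z) -> forall s, dfam s (a * w) <= 2 * (nrm a * z + y * z).
Proof.
move=> la dw.
have w_z : nrm w <= z by exact: dw None.
have z0 : 0 <= z by rewrite (le_trans (nrm_ge0 w)).
have y0 : 0 <= y by rewrite (le_trans _ (la 0%N))// (fam_ge0 seminorm_lfam).
have az : 0 <= nrm a * z by rewrite mulr_ge0 ?nrm_ge0.
have yz : 0 <= y * z by rewrite mulr_ge0.
case=> [[n|n]|] /=.
- rewrite (le_trans (lfam_mul _ _ _))// ler_wpM2l// lerD//.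
    by rewrite ler_wpM2l ?nrm_ge0//; exact: dw (Some (inl n)).
  by rewrite ler_pM ?nrm_ge0//; exact: (fam_ge0 seminorm_lfam).
- have := dw (Some (inr n)) => /= hn.
  rewrite (le_trans (y := nrm a * z))//; last lra.
  rewrite -mulrA -mulrBr ler_pdivrMr// -mulrA (le_trans (nrmM _ _))//.
  by rewrite ler_wpM2l ?nrm_ge0// -ler_pdivrMr.
- rewrite (le_trans (nrmM _ _))// (le_trans (y := nrm a * z))//; last lra.
  by rewrite ler_wpM2l ?nrm_ge0.
Qed.

Lemma dfam_inner v w (y z : R) : (forall s, dfam s v <= y) ->
  (forall s, dfam s w <= z) -> forall n, lfam n (v * star w) <= 4 * (y * z).
Proof.
move=> dv dw n; rewrite (le_trans (lfam_mul _ _ _))// lfam_star nrm_star.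
have vy := dv None; have wz := dw None; have lv := dv (Some (inl n)).
have lw := dw (Some (inl n)); rewrite /= in vy wz lv lw.
have h1 : nrm v * lfam n w <= y * z.
  by rewrite ler_pM ?nrm_ge0// (fam_ge0 seminorm_lfam).
have h2 : lfam n v * nrm w <= y * z.
  by rewrite ler_pM ?nrm_ge0// (fam_ge0 seminorm_lfam).
lra.
Qed.

Lemma dfam_dense a (r : R) : ideal_set I a -> 0 < r ->
  exists b, [/\ ideal_set I b, nrm (a - b) < r & exists q : R, forall s, dfam s b <= q].
Proof.
move=> Ia r0; have r2 : 0 < r / 2 by rewrite divr_gt0.
have [n [b Bb ab]] := cexp_approx An_dense a r2.
have Ie : ideal_set I (b * e n) by apply: Defs.idealMl; exact: (unit_ideal e_unit).
exists (b * e n); split=> //.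
  rewrite (le_lt_trans (ideal_approx An_fin tau_tracial e_unit Ia Bb))//.
  by rewrite mulrC -ltr_pdivlMr.
apply: (@dfam_bounded n) => //; apply: subalgM => //; exact: (unit_mem e_unit).
Qed.

Lemma lfam_qcms : leibniz_qcms (@FAF R) (lip_of lfam).
Proof.
apply: (lip_of_qcms 0%N) => //.
- exact: seminorm_lfam.
- exact: lfam_star.
- exact: lfam_mul.
- exact: lfam_one.
- exact: lfam_ker.
- move=> a r r0; have [n [b Bb ab]] := cexp_approx An_dense a r0.
  by exists b => //; exact: lfam_bounded Bb.
- move=> r r0; have [n nr] := beta_small r0.
  have [J [x [M [_ h]]]] := lfam_coordinates n; exists J, x, M => a la.
  have [c0 [_ [c cM cE]]] := h a la; exists c0, c => //.
  by rewrite -addrA -opprD -cE (le_trans (lfam_le1 n la)).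
Qed.

Lemma DidealE a : Dideal E beta e a = sup_of dfam a.
Proof.
apply/eqP; rewrite eq_le; apply/andP; split.
  rewrite /Dideal !ge_max; apply/and3P; split.
  - by apply/(@sup_of_leP _ _ _ lfam) => n; exact: (sup_of_ub dfam a (Some (inl n))).
  - exact: (sup_of_ub dfam a None).
  - by apply: ge_ereal_sup => _ [n _ <-]; exact: (sup_of_ub dfam a (Some (inr n))).
apply/sup_of_leP; case=> [[n|n]|]; rewrite /Dideal !le_max.
- by apply/orP; left; exact: (sup_of_ub lfam a n).
- by apply/orP; right; apply/orP; right; apply: ereal_sup_ubound; exists n.
- by rewrite lexx orbT.
Qed.

Lemma ideal_bundle_metrized :
  metrized_bundle (@FAF R) (@GAF R) (@HAF R) (ideal_bundle E beta I e).
Proof.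
change (metrized_bundle (@FAF R) (@GAF R) (@HAF R)
  (@Bundle R A (lip_of lfam) (ideal_mod I) (fun w : ideal_mod I => Dideal E beta e (val w)))).
apply: (@seminorm_bundle R A nat (option (nat + nat)) 0%N None lfam seminorm_lfam
  lfam_qcms lfam_star I (fun w : ideal_mod I => Dideal E beta e (val w)) dfam) => //.
- exact: seminorm_dfam.
- by move=> w; exact: DidealE.
- exact: dfam_mul.
- by move=> v w y z _ _ dv dw; exact: dfam_inner.
- exact: dfam_dense.
- move=> r r0; have [n nr] := beta_small r0.
  have [J [x [M [_ M0 h]]]] := subalg_coordinates n; exists J, x, M => a [_ da].
  have [c hc cE] := h _ (cexp_mem E_cexp n a); exists c.
    move=> j; rewrite (le_trans (hc j))// ler_piMr//.
    by rewrite (le_trans (cexp_nrm (E_cexp n) a))//; exact: da None.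
  rewrite -cE (le_trans _ nr)// lfam_le1// => m; exact: da (Some (inl m)).
Qed.

Section FiniteStage.
Variable n : nat.
Local Notation B := (subalg_type (An n)).

Definition lfam_n m (x : B) : R := lfam m (val x).
Definition dfam_n s (x : B) : R := dfam s (val x).

Lemma seminorm_lfam_n : seminorm_family lfam_n.
Proof.
split=> [t x y|t c x|t]; [exact: (fam_add seminorm_lfam)|exact: (fam_scale seminorm_lfam)|].
by have [C hC] := fam_bound seminorm_lfam t; exists C => x; exact: hC.
Qed.

Lemma seminorm_dfam_n : seminorm_family dfam_n.
Proof.
split=> [t x y|t c x|t]; [exact: (fam_add seminorm_dfam)|exact: (fam_scale seminorm_dfam)|].
by have [C hC] := fam_bound seminorm_dfam t; exists C => x; exact: hC.
Qed.

Lemma val_subalg_sum (J : finType) (c : J -> R[i]) (x : J -> B) :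
  val (\sum_j c j *: x j) = \sum_j c j *: val (x j) :> A.
Proof. by elim/big_rec2: _ => [//|j y1 y2 _ <-]. Qed.

Lemma lfam_n_qcms : leibniz_qcms (@FAF R) (lip_of lfam_n).
Proof.
apply: (lip_of_qcms 0%N) => //.
- exact: seminorm_lfam_n.
- by move=> t x; exact: lfam_star.
- by move=> t x y; exact: lfam_mul.
- by move=> t; exact: lfam_one.
- move=> x /lfam_ker[c cE]; exists c; exact: val_inj.
- move=> x r r0; exists x; first by rewrite subrr nrm0.
  exact: lfam_bounded (subalg_valP x).
- move=> r r0; have [J [x [M [xB h]]]] := lfam_coordinates n.
  exists J, (fun j => to_subalg (xB j)), M => a la.
  have [c0 [_ [c cM cE]]] := h (val a) la; exists c0, c => //.
  have -> : a - c0%:A - \sum_j c j *: to_subalg (xB j) = 0.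
    apply: val_inj; rewrite !raddfB /= val_subalg_sum /=.
    rewrite (cexp_fix An_incr E_cexp (leqnn n) (subalg_valP a)) in cE.
    by rewrite -addrA -opprD cE subrr.
  by rewrite nrm0 ltW.
Qed.

Lemma fin_ideal_bundle_metrized :
  metrized_bundle (@FAF R) (@GAF R) (@HAF R) (fin_ideal_bundle E beta I e (An n)).
Proof.
change (metrized_bundle (@FAF R) (@GAF R) (@HAF R)
  (@Bundle R B (lip_of lfam_n) (ideal_mod (ideal_cap I (An n)))
    (fun w : ideal_mod (ideal_cap I (An n)) => Dideal E beta e (val (val w : B))))).
apply: (@seminorm_bundle R B nat (option (nat + nat)) 0%N None lfam_n seminorm_lfam_n
  lfam_n_qcms _ (ideal_cap I (An n))
  (fun w : ideal_mod (ideal_cap I (An n)) => Dideal E beta e (val (val w : B))) dfam_n) => //.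
- by move=> t x; exact: lfam_star.
- exact: seminorm_dfam_n.
- by move=> w; exact: DidealE.
- by move=> x w y z lx dw s; exact: dfam_mul.
- by move=> v w y z _ _ dv dw t; exact: dfam_inner.
- move=> x r Ix r0; exists x; split=> //; first by rewrite subrr nrm0.
  exact: dfam_bounded Ix (subalg_valP x).
- move=> r r0; have [J [x [M [xB M0 h]]]] := subalg_coordinates n.
  exists J, (fun j => to_subalg (xB j)), M => a [_ da].
  have [c hc cE] := h _ (subalg_valP a); exists c.
    by move=> j; rewrite (le_trans (hc j))// ler_piMr//; exact: da None.
  have -> : a - \sum_j c j *: to_subalg (xB j) = 0.
    by apply: val_inj; rewrite raddfB /= val_subalg_sum /= -cE subrr.
  by rewrite nrm0 ltW.
Qed.

End FiniteStage.

End AFFamilies.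

(** * The bundle over the direct sum *)

Section MiddleBundle.
Context {R : realType} {A : cstarAlgType R} (An : nat -> cstarSubalg A)
  (An_incr : forall n, An n `<=` An n.+1)
  (An_fin : forall n, finite_dim (An n))
  (A0_scalars : An 0%N = range (fun c : R[i] => c%:A) :> set A)
  (An_dense : closure (\bigcup_n (An n : set A) : set (mtop A)) = setT)
  (tau : A -> R[i]) (tau_tracial : faithful_tracial tau)
  (E : nat -> A -> A) (E_cexp : forall n, cond_expectation tau (An n) (E n))
  (beta : nat -> R) (beta_gt0 : forall n, 0 < beta n)
  (beta_cvg0 : beta @ \oo --> (0 : R))
  (I : closedIdeal A) (e : nat -> A)
  (e_unit : forall n, is_unit_of ((I : set A) `&` An n) (e n))
  (n : nat) (dl : R) (dl_gt0 : 0 < dl).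

Local Notation B := (subalg_type (An n)).
Local Notation P := (B * A)%type.
Local Notation lf := (lfam E beta).
Local Notation df := (dfam E beta e).
Local Notation lf_fam := (seminorm_lfam An_incr E_cexp beta_gt0).
Local Notation df_fam := (seminorm_dfam An_incr E_cexp beta_gt0 e_unit).
Implicit Types (x y : P) (a xi : A).

Definition ideal_ball : set A := [set xi | ideal_set I xi /\ forall s, df s xi <= 1].

Lemma ideal_ball_nrm xi : ideal_ball xi -> nrm xi <= 1.
Proof. by move=> [_ /(_ None)]. Qed.

Definition gap x : A := val x.1 - x.2.

Lemma nrm_gap x : nrm (gap x) <= 2 * nrm x.
Proof.
rewrite (le_trans (nrmD _ _))// nrmN mulr_natl mulr2n lerD//.
  exact: (nrm_fst x).
exact: (nrm_snd x).
Qed.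

Lemma gapD x y : gap (x + y) = gap x + gap y.
Proof. by rewrite /gap addrACA -opprD. Qed.

Lemma gapZ (c : R[i]) x : gap (c *: x) = c *: gap x.
Proof. by rewrite /gap scalerBr. Qed.

(** A twisted Leibniz rule, with the second coordinate acting on the left and the first on the
    right; it gives all the Leibniz inequalities for the gap. *)
Lemma gapM x y : gap (x * y) = gap x * val y.1 + x.2 * gap y.
Proof. by rewrite /gap mulrBl mulrBr addrA subrK. Qed.

Lemma gap_star x : gap (star x) = star (gap x).
Proof. by rewrite /gap starB. Qed.

(** In the Lipschitz ball the coordinates differ by at most [dl], which is what exchanging one for
    the other costs in the heights. The gap also ties the scalars of the two coordinates, so that
    the kernel is one-dimensional. *)
Definition lmid (t : option (nat + nat)) x : R :=
  match t with
  | None => nrm (gap x) / dl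
  | Some (inl m) => lf m (val x.1)
  | Some (inr m) => lf m x.2
  end.

(* With the weight [2 * dl], the summand [None] of [lmid] is at most
   [2 * (2 * dl) / dl = 4] times the product of the norms: the constant of [H]. *)
Definition dmid (s : option (option (nat + nat) + option (nat + nat) + {xi | ideal_ball xi}))
    x : R :=
  match s with
  | None => nrm x
  | Some (inl (inl s)) => df s (val x.1)
  | Some (inl (inr s)) => df s x.2
  | Some (inr xi) => nrm (gap x * star (sval xi)) / (2 * dl)
  end.

Let dl2 : 0 < 2 * dl. Proof. by rewrite mulr_gt0. Qed.

Lemma seminorm_lmid : seminorm_family lmid.
Proof.
split.
- case=> [[m|m]|] x y /=; [exact: (fam_add lf_fam)|exact: (fam_add lf_fam)|].
  by rewrite -mulrDl ler_pM2r ?invr_gt0// gapD nrmD.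
- case=> [[m|m]|] c x /=; [exact: (fam_scale lf_fam)|exact: (fam_scale lf_fam)|].
  by rewrite gapZ nrmZ mulrA.
- case=> [[m|m]|] /=.
  + have [C hC] := fam_bound lf_fam m; exists `|C| => x.
    rewrite (le_trans (hC _))// (le_trans (y := `|C| * nrm (val x.1 : A)))//.
      by rewrite ler_wpM2r ?nrm_ge0 ?ler_norm.
    by rewrite ler_wpM2l//; exact: (nrm_fst x).
  + have [C hC] := fam_bound lf_fam m; exists `|C| => x.
    rewrite (le_trans (hC _))// (le_trans (y := `|C| * nrm x.2))//.
      by rewrite ler_wpM2r ?nrm_ge0 ?ler_norm.
    by rewrite ler_wpM2l//; exact: (nrm_snd x).
  + by exists (2 / dl) => x; rewrite mulrAC ler_pM2r ?invr_gt0// nrm_gap.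
Qed.

Lemma seminorm_dmid : seminorm_family dmid.
Proof.
split.
- case=> [[[s|s]|xi]|] x y /=; [exact: (fam_add df_fam)|exact: (fam_add df_fam)| |exact: nrmD].
  by rewrite -mulrDl ler_pM2r ?invr_gt0// gapD mulrDl nrmD.
- case=> [[[s|s]|xi]|] c x /=; [exact: (fam_scale df_fam)|exact: (fam_scale df_fam)| |exact: nrmZ].
  by rewrite gapZ -scalerAl nrmZ mulrA.
- case=> [[[s|s]|xi]|] /=.
  + have [C hC] := fam_bound df_fam s; exists `|C| => x.
    rewrite (le_trans (hC _))// (le_trans (y := `|C| * nrm (val x.1 : A)))//.
      by rewrite ler_wpM2r ?nrm_ge0 ?ler_norm.
    by rewrite ler_wpM2l//; exact: (nrm_fst x).
  + have [C hC] := fam_bound df_fam s; exists `|C| => x.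
    rewrite (le_trans (hC _))// (le_trans (y := `|C| * nrm x.2))//.
      by rewrite ler_wpM2r ?nrm_ge0 ?ler_norm.
    by rewrite ler_wpM2l//; exact: (nrm_snd x).
  + exists (2 / (2 * dl)) => x; rewrite mulrAC ler_pM2r ?invr_gt0//.
    rewrite (le_trans (nrmM _ _))// nrm_star (le_trans _ (nrm_gap x))//.
    by rewrite ler_piMr ?nrm_ge0// (ideal_ball_nrm (svalP xi)).
  + by exists 1 => x; rewrite mul1r.
Qed.

Lemma lmid_gap x (r : R) : (forall t, lmid t x <= r) -> nrm (gap x) <= r * dl.
Proof. by move=> /(_ None); rewrite /= ler_pdivrMr. Qed.

Lemma lmid_star t x : lmid t (star x) = lmid t x.
Proof.
case: t => [[m|m]|] /=; [exact: (lfam_star tau_tracial E_cexp)|exact: (lfam_star tau_tracial E_cexp)|].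
by rewrite gap_star nrm_star.
Qed.

Lemma lmid_mul t x y : lmid t (x * y) <= 2 * (nrm x * lmid t y + lmid t x * nrm y).
Proof.
have lf0 m a : 0 <= lf m a by exact: (fam_ge0 lf_fam).
case: t => [[m|m]|] /=.
- rewrite (le_trans (lfam_mul An_incr E_cexp beta_gt0 _ _ _))// ler_wpM2l// lerD//.
    by rewrite ler_wpM2r//; exact: (nrm_fst x).
  by rewrite ler_wpM2l//; exact: (nrm_fst y).
- rewrite (le_trans (lfam_mul An_incr E_cexp beta_gt0 _ _ _))// ler_wpM2l// lerD//.
    by rewrite ler_wpM2r//; exact: (nrm_snd x).
  by rewrite ler_wpM2l//; exact: (nrm_snd y).
- have h : nrm (gap (x * y)) <= nrm (gap x) * nrm y + nrm x * nrm (gap y).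
    rewrite gapM (le_trans (nrmD _ _))// lerD// (le_trans (nrmM _ _))//.
      by rewrite ler_wpM2l ?nrm_ge0//; exact: (nrm_fst y).
    by rewrite ler_wpM2r ?nrm_ge0//; exact: (nrm_snd x).
  rewrite ler_pdivrMr// (le_trans h)//.
  have -> : 2 * (nrm x * (nrm (gap y) / dl) + nrm (gap x) / dl * nrm y) * dl =
      2 * (nrm (gap x) * nrm y + nrm x * nrm (gap y)) by field; rewrite gt_eqF.
  have h1 : 0 <= nrm (gap x) * nrm y by rewrite mulr_ge0 ?nrm_ge0.
  have h2 : 0 <= nrm x * nrm (gap y) by rewrite mulr_ge0 ?nrm_ge0.
  lra.
Qed.

Lemma lmid_le x (r : R) : (forall t, lmid t x <= r) <->
  [/\ forall m, lf m (val x.1) <= r, forall m, lf m x.2 <= r & nrm (gap x) <= r * dl].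
Proof.
split=> [h|[h1 h2 h3]]; last by case=> [[m|m]|] //=; rewrite ler_pdivrMr.
split; [exact: (fun m => h (Some (inl m)))|exact: (fun m => h (Some (inr m)))|].
exact: lmid_gap.
Qed.

Lemma val_pair_sum (J : finType) (c : J -> R[i]) (x : J -> P) :
  \sum_j c j *: x j = (\sum_j c j *: (x j).1, \sum_j c j *: (x j).2).
Proof.
by elim/big_rec3: _ => [//|j y1 y2 y3 _ ->].
Qed.

Lemma lmid_qcms : leibniz_qcms (@FAF R) (lip_of lmid).
Proof.
apply: (lip_of_qcms None) => //.
- exact: seminorm_lmid.
- exact: lmid_star.
- exact: lmid_mul.
- case=> [[m|m]|] /=; [exact: (lfam_one An_incr E_cexp)|exact: (lfam_one An_incr E_cexp)|].
  by rewrite /gap subrr nrm0 mul0r.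
- move=> [x1 x2] h.
  have [c cE] := lfam_ker A0_scalars E_cexp beta_gt0 (fun m => h (Some (inr m))).
  exists c; congr pair => //; apply: val_inj; rewrite /= in cE *.
  have /eqP := h None; rewrite /= mulf_eq0 invr_eq0 (gt_eqF dl_gt0) orbF.
  by move=> /eqP/nrm_eq0/eqP; rewrite subr_eq0 /= cE => /eqP.
- move=> [x1 x2] r r0; have [m [b Bb ab]] := cexp_approx An_dense x2 r0.
  exists (x1, b); first by rewrite nrm_pairE /= subrr nrm0 gt_max r0.
  have [q1 h1] := lfam_bounded An_incr E_cexp beta_gt0 (subalg_valP x1).
  have [q2 h2] := lfam_bounded An_incr E_cexp beta_gt0 Bb.
  exists (Num.max (Num.max q1 q2) (nrm (gap (x1, b)) / dl)).
  by case=> [[k|k]|] /=; rewrite !le_max ?h1 ?h2 ?lexx ?orbT.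
- move=> r r0; have [m mr] := beta_small beta_gt0 beta_cvg0 r0.
  have [J1 [y1 [M1 [y1B h1]]]] := lfam_coordinates An_incr An_fin A0_scalars tau_tracial E_cexp beta_gt0 n.
  have [J2 [y2 [M2 [_ h2]]]] := lfam_coordinates An_incr An_fin A0_scalars tau_tracial E_cexp beta_gt0 m.
  (* Each coordinate has its own scalar. [c1] is subtracted from the pair, and the vector [(0, 1)]
     carries [c2 - c1], which is bounded by [dl] because the gap is. *)
  pose X (j : (J1 + J2 + unit)%type) : P :=
    match j with
    | inl (inl j) => (to_subalg (y1B j), 0)
    | inl (inr j) => (0, y2 j)
    | inr _ => (0, 1)
    end.
  exists (J1 + J2 + unit)%type, X, (Num.max (Num.max M1 M2) dl).
  move=> [a1 a2] /lmid_le[/= l1 l2 lg].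
  have [c1 [c1E [k1 k1M k1E]]] := h1 _ l1; have [c2 [c2E [k2 k2M k2E]]] := h2 _ l2.
  exists c1, (fun j => match j with inl (inl j) => k1 j | inl (inr j) => k2 j | inr _ => c2 - c1 end).
    case=> [[j|j]|_]; rewrite !le_max ?k1M ?k2M ?orbT//.
    have -> : normc (c2 - c1) <= dl; last by rewrite orbT.
    rewrite -(nrm_scalar (A := A)) scalerBl -c1E -c2E -(cexpB E_cexp).
    by rewrite (le_trans (cexp_nrm (E_cexp _) _))// nrmB; move: lg; rewrite mul1r.
  rewrite val_pair_sum !big_sumType /= !big_const !card_unit /=.
  rewrite !scaler0 !addr0.
  have z1 (f : J2 -> R[i]) : \sum_i f i *: (0 : B) = 0 by apply: big1 => i _; rewrite scaler0.
  have z2 (f : J1 -> R[i]) : \sum_i f i *: (0 : A) = 0 by apply: big1 => i _; rewrite scaler0.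
  rewrite z1 z2 addr0 add0r.
  have -> : (a1, a2) - c1%:A - (\sum_j k1 j *: to_subalg (y1B j), \sum_i k2 i *: y2 i + (c2 - c1) *: 1) =
    (0, a2 - E m a2) :> P.
    congr pair.
      apply: val_inj; rewrite !raddfB /= val_subalg_sum /=.
      rewrite (cexp_fix An_incr E_cexp (leqnn n) (subalg_valP a1)) in k1E.
      by rewrite -addrA -opprD k1E subrr.
    rewrite /= k2E scalerBl -addrA -opprD; congr (_ - _).
    by rewrite addrC -addrA subrK addrC.
  rewrite nrm_pairE /= nrm0 ge_max (ltW r0) /= (le_trans _ mr)//.
  exact: (lfam_le1 beta_gt0).
Qed.

Definition mid_ideal : closedIdeal P := prod_ideal (ideal_cap I (An n)) I.

Definition mid_bundle : bundle R :=
  @Bundle R P (lip_of lmid) (ideal_mod mid_ideal)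
    (fun w : ideal_mod mid_ideal => sup_of dmid (val w : P)).

Lemma ideal_ball_scale a xi (y z : R) : ideal_set I xi ->
  (forall s, df s xi <= z) ->
  (forall xi, ideal_ball xi -> nrm (a * star xi) <= y) ->
  nrm (a * star xi) <= y * z.
Proof.
move=> Ixi dxi h.
have z0 : 0 <= z by rewrite (le_trans (nrm_ge0 xi))//; exact: dxi None.
have [zE|zn0] := eqVneq z 0.
  have -> : xi = 0.
    by apply: nrm_eq0; apply/eqP; rewrite eq_le nrm_ge0 andbT -zE; exact: dxi None.
  by rewrite star0 mulr0 nrm0 zE mulr0.
have zp : 0 < z by rewrite lt_neqAle eq_sym zn0.
have /h : ideal_ball (z^-1%:C *: xi).
  split; first by rewrite -mulr_algl; exact: Defs.idealMl.
  move=> s; rewrite (fam_scale df_fam) normc_real gtr0_norm ?invr_gt0//.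
  by rewrite ler_pdivrMl// mulr1.
rewrite star_real_scale -scalerAr nrmZR gtr0_norm ?invr_gt0//.
by rewrite ler_pdivrMl// mulrC.
Qed.

Lemma dmid_le x (r : R) : (forall s, dmid s x <= r) <->
  [/\ forall s, df s (val x.1) <= r, forall s, df s x.2 <= r
    & forall xi, ideal_ball xi -> nrm (gap x * star xi) <= r * (2 * dl)].
Proof.
split=> [h|[h1 h2 h3]].
  split=> [s|s|xi bxi]; [exact: (h (Some (inl (inl s))))|exact: (h (Some (inl (inr s))))|].
  by have := h (Some (inr (exist _ xi bxi))); rewrite /= ler_pdivrMr.
case=> [[[s|s]|[xi bxi]]|] //=; first by rewrite ler_pdivrMr// h3.
by rewrite nrm_pairE ge_max (h1 None) (h2 None).
Qed.

Theorem mid_bundle_metrized : metrized_bundle (@FAF R) (@GAF R) (@HAF R) mid_bundle.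
Proof.
apply: (@seminorm_bundle R P _ _ None None lmid seminorm_lmid lmid_qcms lmid_star
  mid_ideal (fun w : ideal_mod mid_ideal => sup_of dmid (val w : P)) dmid) => //.
- exact: seminorm_dmid.
- move=> a w y z la dw.
  have [l1 l2 lg] := (lmid_le _ _).1 la; have [d1 d2 dg] := (dmid_le _ _).1 dw.
  have z0 : 0 <= z by rewrite (le_trans (nrm_ge0 w))//; exact: dw None.
  have y0 : 0 <= y by rewrite -(pmulr_lge0 _ dl_gt0) (le_trans (nrm_ge0 _) lg).
  have yz : 0 <= y * z by rewrite mulr_ge0.
  have mono (t u : R) : t <= nrm a -> u <= 2 * (t * z + y * z) -> u <= 2 * (nrm a * z + y * z).
    move=> ta /le_trans; apply; rewrite ler_wpM2l// lerD2r.
    by rewrite ler_wpM2r.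
  apply/dmid_le; split.
  + move=> s; apply: (mono (nrm (val a.1 : A))); first exact: (nrm_fst a).
    by have h := dfam_mul An_incr E_cexp beta_gt0 l1 d1 s; exact: h.
  + move=> s; apply: (mono (nrm a.2)); first exact: (nrm_snd a).
    by have h := dfam_mul An_incr E_cexp beta_gt0 l2 d2 s; exact: h.
  (* [gap a] is bounded in norm, [gap w] only against [star xi]; in [gapM] the factor [a.2] stands
     to the left of [gap w] and does not separate it from [star xi]. *)
  + move=> xi bxi; rewrite gapM mulrDl (le_trans (nrmD _ _))//.
    have h1 : nrm (gap a * val w.1 * star xi) <= y * dl * z.
      rewrite (le_trans (nrmM _ _))// nrm_star -[leRHS]mulr1.
      rewrite ler_pM ?nrm_ge0 ?(ideal_ball_nrm bxi)// (le_trans (nrmM _ _))//.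
      by rewrite ler_pM ?nrm_ge0//; exact: d1 None.
    have h2 : nrm (a.2 * gap w * star xi) <= nrm a * (z * (2 * dl)).
      rewrite -mulrA (le_trans (nrmM _ _))// ler_pM ?nrm_ge0//; first exact: (nrm_snd a).
      exact: dg.
    have h3 : 0 <= nrm a * z * dl by rewrite !mulr_ge0 ?nrm_ge0// ltW.
    have h4 : 0 <= y * z * dl by rewrite !mulr_ge0// ltW.
    rewrite (le_trans (lerD h1 h2))//; nra.
- move=> v w y z [Jv1 Jv2] [Jw1 Jw2] dv dw.
  have [v1 v2 vg] := (dmid_le _ _).1 dv; have [w1 w2 wg] := (dmid_le _ _).1 dw.
  apply/lmid_le; split.
  + exact: (dfam_inner An_incr tau_tracial E_cexp beta_gt0 v1 w1).
  + exact: (dfam_inner An_incr tau_tracial E_cexp beta_gt0 v2 w2).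
  (* Each summand is a gap times the adjoint of an element of [I], the second one after taking
     adjoints. Hence testing gaps against [I] is enough, and the sum is exactly
     [4 * (y * z) * dl]. *)
  + rewrite gapM gap_star.
    have h1 : nrm (gap v * star (val w.1 : A)) <= y * (2 * dl) * z.
      by apply: ideal_ball_scale.
    have h2 : nrm (v.2 * star (gap w)) <= z * (2 * dl) * y.
      rewrite -nrm_star starM starK; exact: ideal_ball_scale.
    rewrite (le_trans (nrmD _ _))// (le_trans (lerD h1 h2))//.
    by rewrite le_eqVlt; apply/orP; left; apply/eqP; ring.
- move=> [a1 a2] r [/= Ia1 Ia2] r0.
  have [b [Ib ab [q2 h2]]] := dfam_dense An_incr An_fin An_dense tau_tracial E_cexp beta_gt0 e_unit Ia2 r0.
  have [q1 h1] := dfam_bounded An_incr E_cexp beta_gt0 e_unit Ia1 (subalg_valP a1).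
  exists (a1, b); split=> //; first by rewrite nrm_pairE /= subrr nrm0 gt_max r0.
  exists (Num.max (Num.max q1 q2) (nrm (gap (a1, b)) / (2 * dl))).
  apply/dmid_le; split=> [s|s|xi bxi] /=; rewrite ?le_max ?h1 ?h2 ?orbT//.
  rewrite (le_trans (nrmM _ _))// nrm_star (le_trans (y := nrm (gap (a1, b))))//.
    by rewrite ler_piMr ?nrm_ge0 ?(ideal_ball_nrm bxi).
  by rewrite -ler_pdivrMr// le_max lexx orbT.
- move=> r r0; have [m mr] := beta_small beta_gt0 beta_cvg0 r0.
  have [J1 [y1 [M1 [y1B M10 h1]]]] := subalg_coordinates An_incr An_fin tau_tracial E_cexp n.
  have [J2 [y2 [M2 [_ M20 h2]]]] := subalg_coordinates An_incr An_fin tau_tracial E_cexp m.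
  pose X (j : (J1 + J2)%type) : P :=
    match j with
    | inl j => (to_subalg (y1B j), 0)
    | inr j => (0, y2 j)
    end.
  exists (J1 + J2)%type, X, (Num.max M1 M2) => -[a1 a2] [_ /dmid_le[/= d1 d2 _]].
  have [k1 k1M k1E] := h1 _ (subalg_valP a1).
  have [k2 k2M k2E] := h2 _ (cexp_mem E_cexp m a2).
  exists (fun j => match j with inl j => k1 j | inr j => k2 j end).
    case=> j; rewrite le_max.
      by apply/orP; left; rewrite (le_trans (k1M j))// ler_piMr//; exact: d1 None.
    apply/orP; right; rewrite (le_trans (k2M j))// ler_piMr//.
    by rewrite (le_trans (cexp_nrm (E_cexp _) _))//; exact: d2 None.
  rewrite val_pair_sum !big_sumType /=.
  have z1 (f : J2 -> R[i]) : \sum_i f i *: (0 : B) = 0 by apply: big1 => i _; rewrite scaler0.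
  have z2 (f : J1 -> R[i]) : \sum_i f i *: (0 : A) = 0 by apply: big1 => i _; rewrite scaler0.
  rewrite z1 z2 addr0 add0r -k2E.
  have -> : (a1, a2) - (\sum_j k1 j *: to_subalg (y1B j), E m a2) = (0, a2 - E m a2) :> P.
    congr pair; apply: val_inj; rewrite raddfB /= val_subalg_sum /=.
    by rewrite -k1E subrr.
  rewrite nrm_pairE /= nrm0 ge_max (ltW r0) /= (le_trans _ mr)//.
  by apply: (lfam_le1 beta_gt0) => k; exact: d2 (Some (inl k)).
Qed.

End MiddleBundle.

(** * Approximation in the unit ball of an ideal *)

Section RealEstimates.
Context {R : realType}.
Implicit Types (b eps k t : R).

(** The alternatives are [x - 1 + k <= 3 / 2 * eps * x] for [x = 1 + eps / 2] and for [x = eps / b],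
    cleared of denominators. If the first fails, [k <= b + b ^+ 2] forces [eps] to be so close to
    [b] that [eps / b] is nearly 1. *)
Lemma shrink_alternative b eps k : 0 < b -> b <= eps -> 0 <= k ->
    k <= b + b ^+ 2 -> k ^+ 2 <= 2 * b ^+ 2 ->
  k <= eps + 3 / 4 * eps ^+ 2 \/ eps - b + k * b <= 3 / 2 * eps ^+ 2.
Proof.
move=> b0 beps k0 kb k2b.
have [|notA] := leP k (eps + 3 / 4 * eps ^+ 2); [by left|right].
pose t := eps - b; have t0 : 0 <= t by rewrite subr_ge0.
have epsE : eps = b + t by rewrite /t addrC subrK.
rewrite epsE in notA *; clearbody t.
have bt0 : 0 <= b * t by rewrite mulr_ge0// ltW.
have t20 : 0 <= t ^+ 2 by exact: sqr_ge0.
have b20 : 0 < b ^+ 2 by rewrite exprn_gt0.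
have sqE : (b + t) ^+ 2 = b ^+ 2 + 2 * (b * t) + t ^+ 2 by ring.
rewrite sqE in notA *.
have -> : b + t - b = t by ring.
(* For [b] at least 1/3 the second alternative always holds: 17/12 exceeds $\sqrt 2$ and stays below
   3/2, and [t] is absorbed by [3 * (b * t)]. For smaller [b] the failure of the first gives
   [t <= b ^+ 2 / 4]. *)
have [b3|b3] := leP (1 / 3) b.
  have k1 : k <= 17 / 12 * b.
    rewrite -ler_sqr ?nnegrE// ?mulr_ge0 ?(ltW b0)//.
    by rewrite (le_trans k2b)// exprMn; nra.
  have kb1 : k * b <= 17 / 12 * b ^+ 2.
    by rewrite expr2 mulrA ler_wpM2r// ltW.
  have bt : t <= 3 * (b * t) by nra.
  lra.
have kb1 : k * b <= b ^+ 2 + b * b ^+ 2.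
  have -> : b ^+ 2 + b * b ^+ 2 = (b + b ^+ 2) * b by ring.
  by rewrite ler_wpM2r// ltW.
have tb : t <= b ^+ 2 / 4 by lra.
have [b4|b4] := leP b (1 / 4).
  have : b * b ^+ 2 <= 1 / 4 * b ^+ 2 by rewrite ler_wpM2r// ltW.
  lra.
have h1 : b * b ^+ 2 <= 1 / 3 * b ^+ 2 by rewrite ler_wpM2r// ltW.
have h2 : t <= 4 / 3 * t * (3 * b) by nra.
have h3 : t - 3 * (b * t) <= 1 / 4 * t by nra.
lra.
Qed.

Lemma xseq_ge_beta (beta : nat -> R) n : beta n <= xseq beta n - 1.
Proof. by rewrite lerBrDl /xseq le_max lexx. Qed.

Lemma xseq_ge_ratio (beta : nat -> R) m n : (forall n, 0 < beta n) -> (m < n)%N ->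
  2 * beta n <= (xseq beta n - 1) * beta m.
Proof.
move=> beta0 mn; rewrite -ler_pdivrMr// lerBrDr.
have -> : 2 * beta n / beta m + 1 = (2 * beta n + beta m) / beta m.
  by field; rewrite gt_eqF.
rewrite /xseq le_max; apply/orP; right.
exact: (le_bigmax _ (fun i : 'I_n => (2 * beta n + beta i) / beta i) (Ordinal mn)).
Qed.

Lemma xseq_max (beta : nat -> R) n :
  Num.max (beta n) (xseq beta n - 1) = xseq beta n - 1.
Proof. by rewrite max_r// xseq_ge_beta. Qed.

(** The ratio [beta n / beta m] must be small uniformly in [m < n]. For the finitely many [m < N0],
    [beta m] is bounded below while [beta n] tends to 0; from [N0] on [beta] decreases, and the last
    step before [n] alone gains the factor [r]. *)
Lemma xseq_cvg (beta : nat -> R) : (forall n, 0 < beta n) ->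
    beta @ \oo --> (0 : R) -> (fun n => beta n.+1 / beta n) @ \oo --> (0 : R) ->
  (fun n => Num.max (beta n) (xseq beta n - 1)) @ \oo --> (0 : R).
Proof.
move=> beta0 beta_cvg ratio_cvg.
apply/cvgrPdist_lt => eta eta0.
(* The entry 1 makes [beta] decrease from [N0] on; [eta / 2] accounts for the factor in
   [2 * beta n]. *)
pose r := Num.min (eta / 2) 1.
have r0 : 0 < r by rewrite lt_min divr_gt0//=.
have [r1 r2] : r <= 1 /\ 2 * r <= eta.
  split; first by rewrite ge_min lexx orbT.
  by rewrite mulrC -ler_pdivlMr// ge_min lexx.
move/cvgrPdist_lt/(_ r r0): ratio_cvg => -[N0 _ hN0].
have dec (k : nat) : (N0 <= k)%N -> beta k.+1 < r * beta k.
  move=> /hN0 /=; rewrite sub0r normrN gtr0_norm ?divr_gt0//.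
  by rewrite ltr_pdivrMr.
have decle m j : (N0 <= m)%N -> beta (m + j)%N <= beta m.
  move=> Nm; elim: j => [|j IH]; first by rewrite addn0.
  rewrite addnS (le_trans _ IH)// (le_trans (ltW (dec _ _)))//.
    by rewrite (leq_trans Nm) ?leq_addr.
  by rewrite ler_piMl// ltW.
have [c [c0 hc]] : exists c : R, 0 < c /\ forall m, (m < N0)%N -> c <= beta m.
  elim: (N0) => [|N [c [c0 hc]]]; first by exists 1.
  exists (Num.min c (beta N)); split; first by rewrite lt_min c0 beta0.
  move=> m; rewrite ltnS leq_eqVlt => /orP[/eqP->|/hc h].
    by rewrite ge_min lexx orbT.
  by rewrite ge_min h.
pose d := Num.min (eta * c / 2) eta.
have d0 : 0 < d by rewrite lt_min eta0 andbT divr_gt0// mulr_gt0.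
move/cvgrPdist_lt/(_ d d0): beta_cvg => -[N1 _ hN1].
have small n : (N1 <= n)%N -> beta n < d.
  by move=> /hN1 /=; rewrite sub0r normrN gtr0_norm.
exists N1 => // n /= N1n.
have bn := small n N1n.
rewrite xseq_max sub0r normrN ger0_norm; last first.
  by rewrite (le_trans _ (xseq_ge_beta beta n))// ltW.
rewrite ltrBlDr /xseq gt_max; apply/andP; split.
  have : d <= eta by rewrite ge_min lexx orbT.
  by move: bn; clear; move: (beta n) (d) => x y; lra.
apply/bigmax_ltP; split; first by rewrite addr_gt0.
move=> [m mn] _ /=; rewrite ltr_pdivrMr//.
suff : 2 * beta n < eta * beta m by lra.
have [mN|Nm] := ltnP m N0.
  have : beta n < eta * c / 2 by rewrite (lt_le_trans bn)// ge_min lexx.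
  have := hc m mN; nra.
have [j nE] : exists j, n = (m + j).+1.
  by exists (n - m.+1)%N; rewrite -addSn subnKC.
have h1 := dec (m + j)%N (leq_trans Nm (leq_addr _ _)).
have h2 := decle m j Nm.
rewrite nE; have := beta0 m; nra.
Qed.

End RealEstimates.

Section Approximation.
Context {R : realType} {A : cstarAlgType R} (An : nat -> cstarSubalg A)
  (An_incr : forall n, An n `<=` An n.+1)
  (An_fin : forall n, finite_dim (An n))
  (tau : A -> R[i]) (tau_tracial : faithful_tracial tau)
  (E : nat -> A -> A) (E_cexp : forall n, cond_expectation tau (An n) (E n))
  (beta : nat -> R) (beta_gt0 : forall n, 0 < beta n)
  (I : closedIdeal A) (e : nat -> A)
  (e_unit : forall n, is_unit_of ((I : set A) `&` An n) (e n))
  (n : nat).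
Implicit Types (w v xi : A).
Local Notation df := (dfam E beta e).
Local Notation ball := (ideal_ball E beta I e).
Local Notation b := (beta n).

Definition compress w : A := E n w * e n.

Lemma compress_mem w : subalg_set (An n) (compress w).
Proof. by apply: subalgM; [exact: (cexp_mem E_cexp)|exact: (unit_mem e_unit)]. Qed.

Lemma compress_ideal w : ideal_set I (compress w).
Proof. by apply: Defs.idealMl; exact: (unit_ideal e_unit). Qed.

Lemma compressE w : compress w = E n (w * e n).
Proof. by rewrite (cexpMr E_cexp)//; exact: (unit_mem e_unit). Qed.

Lemma nrm_cexp_le m w : nrm (E m w) <= nrm w.
Proof. exact: (cexp_nrm (E_cexp m)). Qed.

Lemma nrm_mul_unit m w : nrm (w * e m) <= nrm w.
Proof. by rewrite (le_trans (nrmM _ _))// ler_piMr ?nrm_ge0 ?(unit_le1 e_unit). Qed.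

Lemma nrm_mul_unitC m w : nrm (w * (1 - e m)) <= nrm w.
Proof. by rewrite (le_trans (nrmM _ _))// ler_piMr ?nrm_ge0 ?(unitC_le1 e_unit). Qed.

Lemma ball_beta m w : ball w -> nrm (w - E m w) <= beta m.
Proof. by move=> [_ /(_ (Some (inl m)))]; rewrite /= lfam_leP// mul1r. Qed.

Lemma ball_unit m w : ball w -> nrm (w * (1 - e m)) <= beta m.
Proof.
by move=> [_ /(_ (Some (inr m)))]; rewrite /= ler_pdivrMr// mul1r mulrBr mulr1.
Qed.

Lemma compress_sub_unit m w : (m < n)%N -> ball w ->
  nrm (compress w - compress w * e m) <= beta m.
Proof.
move=> mn wb.
have -> : compress w - compress w * e m = E n (w * (1 - e m)) * e n.
  rewrite /compress -mulrA (unit_mul_le' An_incr e_unit (ltnW mn)).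
  rewrite (cexpMr E_cexp); last first.
    by apply: subalgB; [exact: subalg1|exact: (subalg_le An_incr (ltnW mn) (unit_mem e_unit m))].
  by rewrite -mulrA mulrBl mul1r (unit_mul_le An_incr e_unit (ltnW mn)) mulrBr.
by rewrite (le_trans (nrm_mul_unit _ _))// (le_trans (nrm_cexp_le _ _))// ball_unit.
Qed.

(** [u - E m u] lies in $A_n$, where [e n] is central, so the two blocks can be estimated
    separately. Moving $E_m$ past [e n] costs [b], and only in the block of [e n]. *)
Lemma compress_sub_cexp m w : (m < n)%N -> ball w ->
  nrm (compress w - E m (compress w)) <= beta m + b.
Proof.
move=> mn wb; have mn' := ltnW mn; set u := compress w.
have Bz : subalg_set (An n) (u - E m u).
  apply: subalgB; first exact: compress_mem.
  exact: (subalg_le An_incr mn' (cexp_mem E_cexp m u)).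
apply: (@nrm_block_le _ _ _ (e n)).
- exact: (unit_star e_unit).
- exact: (unit_idem e_unit).
- exact: (unit_central e_unit).
- by apply: (unit_central e_unit); exact: subalg_star.
- have -> : (u - E m u) * e n =
      E n (w - E m w) * e n + E m (w * (1 - e n)) * e n.
    rewrite (cexpB E_cexp n) (cexp_tower_id An_incr E_cexp _ mn').
    rewrite mulrBr mulr1 (cexpB E_cexp m) -mulrDl addrA subrK.
    rewrite /u {2}compressE (cexp_tower An_incr tau_tracial E_cexp _ mn').
    by rewrite mulrBl mulrBl /compress -mulrA (unit_idem e_unit).
  rewrite (le_trans (nrmD _ _))// lerD//.
    by rewrite (le_trans (nrm_mul_unit _ _))// (le_trans (nrm_cexp_le _ _))// ball_beta.
  by rewrite (le_trans (nrm_mul_unit _ _))// (le_trans (nrm_cexp_le _ _))// ball_unit.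
(* In this block [u] vanishes. As $1_m \le 1_n$, [1 - e m] may be inserted before [1 - e n], and
   then $E_m$ is applied to [u - u * e m], which is small. *)
- have u0 : u * (1 - e n) = 0.
    by rewrite /u /compress -mulrA mulrBr mulr1 (unit_idem e_unit) subrr mulr0.
  have -> : (u - E m u) * (1 - e n) = - (E m (u - u * e m) * (1 - e n)).
    rewrite mulrBl u0 sub0r; congr (- _).
    have -> : u - u * e m = u * (1 - e m) by rewrite mulrBr mulr1.
    rewrite (cexpMr E_cexp u); last first.
      by apply: subalgB; [exact: subalg1|exact: (unit_mem e_unit)].
    rewrite -mulrA; congr (_ * _).
    by rewrite mulrBl mul1r mulrBr mulr1 (unit_mul_le An_incr e_unit mn') subrr subr0.
  rewrite nrmN (le_trans (nrm_mul_unitC _ _))// (le_trans (nrm_cexp_le _ _))//.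
  by rewrite (le_trans (compress_sub_unit mn wb))// lerDl ltW.
Qed.

Lemma compress_nrm w : ball w -> nrm (compress w) <= 1.
Proof.
move=> wb; rewrite (le_trans (nrm_mul_unit _ _))// (le_trans (nrm_cexp_le _ _))//.
exact: (wb.2 None).
Qed.

(** In the minimum, 2 is the trivial bound for [nrm (u - E m u)]; it serves the divisor [eps / b],
    and [beta m + b] serves [1 + eps / 2]. *)
Lemma dfam_compress w (x : R) : ball w -> 1 <= x ->
    (forall m, (m < n)%N -> Num.min 2 (beta m + b) <= x * beta m) ->
  forall s, df s (compress w) <= x.
Proof.
move=> wb x1 hx.
have x0 : 0 <= x by rewrite (le_trans ler01).
case=> [[m|m]|] /=; last by rewrite (le_trans (compress_nrm wb)).
- have [nm|mn] := leqP n m.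
    by rewrite (lfam_eq0 An_incr E_cexp beta nm (compress_mem w)).
  rewrite lfam_leP// (le_trans _ (hx m mn))// le_min compress_sub_cexp// andbT.
  rewrite (le_trans (cexp_sub_le2 An_incr E_cexp _ _))//.
  by have := compress_nrm wb; lra.
- rewrite ler_pdivrMr//; have [nm|mn] := leqP n m.
    rewrite (unit_mulr e_unit (compress_ideal w) (subalg_le An_incr nm (compress_mem w))).
    by rewrite subrr nrm0 mulr_ge0// ltW.
  by rewrite (le_trans (compress_sub_unit mn wb))// ler_peMl// ltW.
Qed.

(** The two errors [r] and [q] have orthogonal right supports, so [r * star r] and [q * star q] add
    up: $\sqrt 2 b$ instead of $2 b$. *)
Lemma compress_dist w : ball w -> nrm (w - compress w) ^+ 2 <= 2 * b ^+ 2.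
Proof.
move=> wb; set r := (w - E n w) * e n; set q := w * (1 - e n).
have -> : w - compress w = r + q.
  by rewrite /r /q /compress mulrBl mulrBr mulr1 [RHS]addrC addrA subrK.
have rq : r * star q = 0.
  rewrite /r /q starM (unitC_star e_unit) -mulrA (mulrA (e n)).
  by rewrite mulrBr mulr1 (unit_idem e_unit) subrr mul0r mulr0.
have qr : q * star r = 0 by rewrite -[LHS]starK starM starK rq star0.
rewrite -nrmMstar starD mulrDl !mulrDr rq qr addr0 add0r.
rewrite (le_trans (nrmD _ _))// !nrmMstar mulr_natl mulr2n lerD//.
  rewrite ler_sqr ?nnegrE ?nrm_ge0 ?(ltW (beta_gt0 n))//.
  by rewrite (le_trans (nrm_mul_unit _ _))// ball_beta.
by rewrite ler_sqr ?nnegrE ?nrm_ge0 ?(ltW (beta_gt0 n))// ball_unit.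
Qed.

(** As [1 - e n] is a projection it can also be applied to [xi], and [xi * (1 - e n)] is small too.
    The part cut off by the unit therefore contributes $b^2$ instead of $b$. *)
Lemma compress_kdist w xi : ball w -> ball xi ->
  nrm ((w - compress w) * star xi) <= b + b ^+ 2.
Proof.
move=> wb xb.
have -> : (w - compress w) * star xi =
    (w - E n w) * e n * star xi + w * (1 - e n) * star (xi * (1 - e n)).
  rewrite starM (unitC_star e_unit) mulrA -(mulrA w) (unitC_idem e_unit) -mulrDl.
  congr (_ * _); by rewrite /compress mulrBl mulrBr mulr1 [RHS]addrC addrA subrK.
rewrite (le_trans (nrmD _ _))// lerD//.
  rewrite (le_trans (nrmM _ _))// nrm_star -[leRHS]mulr1 ler_pM ?nrm_ge0//.
    by rewrite (le_trans (nrm_mul_unit _ _))// ball_beta.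
  exact: (xb.2 None).
by rewrite (le_trans (nrmM _ _))// nrm_star expr2 ler_pM ?nrm_ge0// ball_unit.
Qed.

(* The multiples [compress w / x] with [x = 1 + eps / 2] and [x = eps / beta n]
   both lie in the unit ball; one of them is near enough to [w]. *)
Lemma ball_approximation (eps : R) w : b <= eps ->
    (forall m, (m < n)%N -> 2 * b <= eps * beta m) -> ball w ->
  exists v, [/\ subalg_set (An n) v, ball v
    & forall xi, ball xi -> nrm ((w - v) * star xi) <= 3 / 2 * eps].
Proof.
move=> beps heps wb.
have b0 := beta_gt0 n; have eps0 : 0 < eps by rewrite (lt_le_trans b0).
pose k := Num.min (b + b ^+ 2) (Num.sqrt 2 * b).
have b20 : 0 <= b ^+ 2 by exact: sqr_ge0.
have s2b : 0 <= Num.sqrt 2 * b by rewrite mulr_ge0 ?sqrtr_ge0// ltW.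
have k0 : 0 <= k by rewrite le_min s2b andbT addr_ge0// ltW.
have k1 : k <= b + b ^+ 2 by rewrite ge_min lexx.
have sE : (Num.sqrt 2 * b) ^+ 2 = 2 * b ^+ 2 by rewrite exprMn sqr_sqrtr.
have k2 : k ^+ 2 <= 2 * b ^+ 2.
  by rewrite -sE ler_sqr ?nnegrE// ge_min lexx orbT.
have kle xi : ball xi -> nrm ((w - compress w) * star xi) <= k.
  move=> xb; rewrite le_min compress_kdist//=.
  rewrite (le_trans (nrmM _ _))// nrm_star.
  rewrite (le_trans (y := nrm (w - compress w)))//.
    by rewrite ler_piMr ?nrm_ge0//; exact: (xb.2 None).
  by rewrite -ler_sqr ?nnegrE ?nrm_ge0// sE compress_dist.
have build (x : R) : 1 <= x ->
    (forall m, (m < n)%N -> Num.min 2 (beta m + b) <= x * beta m) ->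
    x - 1 + k <= 3 / 2 * eps * x ->
    exists v, [/\ subalg_set (An n) v, ball v
      & forall xi, ball xi -> nrm ((w - v) * star xi) <= 3 / 2 * eps].
  move=> x1 hx xk; have x0 : 0 < x by rewrite (lt_le_trans ltr01).
  have df_fam := seminorm_dfam An_incr E_cexp beta_gt0 e_unit.
  exists (x^-1%:C *: compress w); split.
  - by apply: subalgZ; exact: compress_mem.
  - split; first by rewrite -mulr_algl; apply: Defs.idealMl; exact: compress_ideal.
    move=> s; rewrite (fam_scale df_fam) normc_real gtr0_norm ?invr_gt0//.
    by rewrite ler_pdivrMl// mulr1; exact: dfam_compress.
  - move=> xi xb.
    (* Since $w - u/x = (1 - 1/x) w + (w - u)/x$, the distance is at most $(x - 1 + k)/x$. *)
    have -> : (w - x^-1%:C *: compress w) * star xi =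
        (1 - x^-1)%:C *: (w * star xi) + x^-1%:C *: ((w - compress w) * star xi).
      rewrite mulrBl -scalerAl [in RHS]mulrBl scalerBr rmorphB scalerBl.
      by rewrite rmorph1 scale1r addrA subrK.
    rewrite (le_trans (nrmD _ _))// !nrmZR.
    have y1 : x^-1 <= 1 by rewrite invf_le1.
    have y0 : 0 < x^-1 by rewrite invr_gt0.
    rewrite ger0_norm ?subr_ge0// gtr0_norm//.
    have h1 : nrm (w * star xi) <= 1.
      rewrite (le_trans (nrmM _ _))// nrm_star -[leRHS]mulr1 ler_pM ?nrm_ge0//.
        exact: (wb.2 None).
      exact: (xb.2 None).
    rewrite (le_trans (y := (1 - x^-1) * 1 + x^-1 * k))//.
      by rewrite lerD// ler_wpM2l ?subr_ge0 ?(ltW y0) ?kle.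
    rewrite -(ler_pM2r x0).
    by have -> : ((1 - x^-1) * 1 + x^-1 * k) * x = x - 1 + k by field; rewrite gt_eqF.
(* The hypothesis [2 * b <= eps * beta m] reads [beta m + b <= (1 + eps / 2) * beta m] for the first
   divisor, and [2 <= eps / b * beta m] for the second. *)
have [kA|kB] := shrink_alternative b0 beps k0 k1 k2.
  apply: (build (1 + eps / 2)).
  - by rewrite lerDl divr_ge0// ltW.
  - move=> m mn; rewrite ge_min; apply/orP; right.
    by have := heps m mn; have := beta_gt0 m; nra.
  - by nra.
apply: (build (eps / b)).
- by rewrite ler_pdivlMr// mul1r.
- move=> m mn; rewrite ge_min; apply/orP; left.
  by rewrite mulrAC ler_pdivlMr// heps.
- rewrite -(ler_pM2r b0).
  have -> : (eps / b - 1 + k) * b = eps - b + k * b by field; rewrite gt_eqF.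
  by have -> : 3 / 2 * eps * (eps / b) * b = 3 / 2 * eps ^+ 2 by field; rewrite gt_eqF.
Qed.

End Approximation.

(** * The two bridges *)

Section EmbeddingMorphisms.
Context {R : realType} {A : cstarAlgType R} (B : cstarSubalg A).

Definition subalg_graph (x : subalg_type B) : (subalg_type B * A)%type := (x, val x).
Definition subalg_pair (x : (subalg_type B * A)%type) : (A * A)%type := (val x.1, x.2).
Definition diagonal (a : A) : (A * A)%type := (a, a).

Let graphB : {morph subalg_graph : x y / x - y}. Proof. by []. Qed.
Let graphM : GRing.monoid_morphism subalg_graph. Proof. by []. Qed.
Let graphZ : scalable subalg_graph. Proof. by []. Qed.
HB.instance Definition _ := GRing.isZmodMorphism.Build _ _ subalg_graph graphB.
HB.instance Definition _ := GRing.isMonoidMorphism.Build _ _ subalg_graph graphM.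
HB.instance Definition _ := GRing.isScalable.Build _ _ _ _ subalg_graph graphZ.

Let pairB : {morph subalg_pair : x y / x - y}. Proof. by []. Qed.
Let pairM : GRing.monoid_morphism subalg_pair. Proof. by []. Qed.
Let pairZ : scalable subalg_pair. Proof. by []. Qed.
HB.instance Definition _ := GRing.isZmodMorphism.Build _ _ subalg_pair pairB.
HB.instance Definition _ := GRing.isMonoidMorphism.Build _ _ subalg_pair pairM.
HB.instance Definition _ := GRing.isScalable.Build _ _ _ _ subalg_pair pairZ.

Let diagB : {morph diagonal : x y / x - y}. Proof. by []. Qed.
Let diagM : GRing.monoid_morphism diagonal. Proof. by []. Qed.
Let diagZ : scalable diagonal. Proof. by []. Qed.
HB.instance Definition _ := GRing.isZmodMorphism.Build _ _ diagonal diagB.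
HB.instance Definition _ := GRing.isMonoidMorphism.Build _ _ diagonal diagM.
HB.instance Definition _ := GRing.isScalable.Build _ _ _ _ diagonal diagZ.

End EmbeddingMorphisms.

Definition to_ideal_mod (R : realType) (B : cstarAlgType R) (J : closedIdeal B) (b : B)
    (Jb : ideal_set J b) : ideal_mod J :=
  exist (fun a : B^o => a \in (J : set B)) b (mem_set Jb).

Section HausdorffBounds.
Context {R : realType}.

Lemma hausdorff_le (T : Type) (rho : T -> T -> \bar R) (X Y : set T) (r : \bar R) :
    (forall x, X x -> exists2 y, Y y & (rho x y <= r)%E) ->
    (forall y, Y y -> exists2 x, X x & (rho x y <= r)%E) ->
  (hausdorff rho X Y <= r)%E.
Proof.
move=> h1 h2; rewrite /hausdorff ge_max; apply/andP; split.
  apply: ge_ereal_sup => _ [x /h1[y Yy xy] <-].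
  by apply: le_trans xy; apply: ereal_inf_lbound; exists y.
apply: ge_ereal_sup => _ [y /h2[x Xx xy] <-].
by apply: le_trans xy; apply: ereal_inf_lbound; exists x.
Qed.

Lemma hausdorff_ge0 (T : Type) (rho : T -> T -> \bar R) (X Y : set T) :
  X !=set0 -> (forall x y, 0 <= rho x y)%E -> (0 <= hausdorff rho X Y)%E.
Proof.
move=> [x Xx] h; rewrite /hausdorff le_max; apply/orP; left.
apply: (@le_trans _ _ (ereal_inf [set rho x y | y in Y])).
  by apply: le_ereal_inf_tmp => _ [y _ <-].
by apply: ereal_sup_ubound; exists x.
Qed.

Lemma state_comp (A1 A2 : cstarAlgType R) (f : {lrmorphism A1 -> A2}) (phi : A2 -> R[i]) :
  (forall a, f (star a) = star (f a)) -> states phi -> states (phi \o f).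
Proof.
move=> fs [lin pos one]; split => /=.
- by move=> c u v /=; rewrite linearP lin.
- by move=> a; rewrite rmorphM /= fs.
- by rewrite rmorph1.
Qed.

Lemma states1E (A : cstarAlgType R) (x : A) (phi : A -> R[i]) :
  star (1 - x) = 1 - x -> (1 - x) * (1 - x) = 1 - x ->
  states1 x phi <-> states phi /\ phi (1 - x) = 0.
Proof.
move=> xs xx; rewrite /states1 /= xs xx; split=> [[]//|[sp p0]]; by split.
Qed.

Lemma half_sum_le (x y z : R) : x <= y + z -> z <= y -> y <= 1 -> 1 / 2 * x <= 1.
Proof. lra. Qed.

Lemma kmetric_self (W : bundle R) (w : modl W) : (kmetric w w <= 0)%E.
Proof. by apply: ge_ereal_sup => _ [u _ <-]; rewrite subrr nrm0. Qed.

Lemma bridge_length_le (W W' : bundle R) (g : bridge W W') (r : R) :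
    (bridge_height g <= r%:E)%E -> (basic_reach g <= r%:E)%E ->
    (modular_reach g <= 0)%E -> (imprint g <= r%:E)%E ->
  (bridge_length g <= r%:E)%E.
Proof.
move=> h1 h2 h3 h4; rewrite /bridge_length ge_max; apply/andP; split=> //.
rewrite ge_max; apply/andP; split=> //.
by rewrite -[r%:E]add0e leeD.
Qed.

(** Suprema over empty sets are $-\infty$, so a witness is needed: the Lipschitz ball contains 0,
    which makes the basic reach nonnegative. *)
Lemma bridge_length_ge0 (W W' : bundle R) (g : bridge W W') F :
  leibniz_qcms F (@lip R W) -> (0 <= bridge_length g)%E.
Proof.
move=> qW; rewrite /bridge_length le_max; apply/orP; right.
rewrite le_max; apply/orP; left; rewrite /basic_reach.
apply: hausdorff_ge0; last by move=> x y; rewrite lee_fin nrm_ge0.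
exists (br_pi g 0 * br_pivot g), 0 => //; split; first exact: star0.
have /(lip_eq0 qW 0)-> : exists t : R, 0 = t%:C%:A :> base W.
  by exists 0; rewrite scale0r.
exact: lee01.
Qed.

Lemma trek_length_ge0 F G H (W W' : bundle R) (t : trek F G H W W') :
  (0 <= trek_length t)%E.
Proof.
elim: t => [W1 W2 m1 m2 g|W1 W2 W3 m1 g t IH] /=.
  exact: bridge_length_ge0 (mb_qcms m1).
by rewrite adde_ge0// (bridge_length_ge0 g (mb_qcms m1)).
Qed.

End HausdorffBounds.

Section Bridges.
Context {R : realType} {A : cstarAlgType R} (An : nat -> cstarSubalg A)
  (An_incr : forall n, An n `<=` An n.+1)
  (An_fin : forall n, finite_dim (An n))
  (tau : A -> R[i]) (tau_tracial : faithful_tracial tau)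
  (E : nat -> A -> A) (E_cexp : forall n, cond_expectation tau (An n) (E n))
  (beta : nat -> R) (beta_gt0 : forall n, 0 < beta n)
  (I : closedIdeal A) (e : nat -> A)
  (e_unit : forall n, is_unit_of ((I : set A) `&` An n) (e n))
  (n : nat) (dl : R) (dl_gt0 : 0 < dl).

Local Notation B := (subalg_type (An n)).
Local Notation P := (B * A)%type.
Local Notation lf := (lfam E beta).
Local Notation df := (dfam E beta e).
Local Notation lf_fam := (seminorm_lfam An_incr E_cexp beta_gt0).
Local Notation df_fam := (seminorm_dfam An_incr E_cexp beta_gt0 e_unit).
Local Notation W := (ideal_bundle E beta I e).
Local Notation Wn := (fin_ideal_bundle E beta I e (An n)).
Local Notation Mid := (mid_bundle An E beta I e n dl).

Lemma unit_ball_W (w : ideal_mod I) : @unit_ball R W w <-> ideal_ball E beta I e (val w).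
Proof.
rewrite /unit_ball /= DidealE; split=> [/sup_of_leP h|[_ h]].
  by split=> [|s]; [exact: ideal_valP|rewrite -lee_fin].
by apply/sup_of_leP => s; rewrite lee_fin.
Qed.

Lemma unit_ball_Wn (w : ideal_mod (ideal_cap I (An n))) :
  @unit_ball R Wn w <-> forall s, df s (val (val w : B)) <= 1.
Proof.
rewrite /unit_ball /= DidealE; split=> [/sup_of_leP h s|h]; first by rewrite -lee_fin.
by apply/sup_of_leP => s; rewrite lee_fin.
Qed.

Lemma unit_ball_Mid (w : ideal_mod (mid_ideal An I n)) :
  @unit_ball R Mid w <->
  [/\ forall s, df s (val (val w : P).1) <= 1, forall s, df s (val w : P).2 <= 1
    & forall xi, ideal_ball E beta I e xi ->
        nrm (gap (val w : P) * star xi) <= 1 * (2 * dl)].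
Proof.
rewrite /unit_ball /=; split=> [/sup_of_leP h|h].
  by apply/(dmid_le E beta I e dl_gt0) => s; rewrite -lee_fin; exact: h.
by apply/sup_of_leP => s; rewrite lee_fin; move: s; apply/(dmid_le E beta I e dl_gt0).
Qed.

Lemma lip_ball_W (a : A) :
  lip_ball (@lip R W) a <-> star a = a /\ forall m, lf m a <= 1.
Proof. exact: (@lip_ball_of R A nat lf a). Qed.

Lemma lip_ball_Wn (x : B) :
  lip_ball (@lip R Wn) x <-> star x = x /\ forall m, lf m (val x) <= 1.
Proof. exact: (@lip_ball_of R B nat (lfam_n E beta (n := n)) x). Qed.

Lemma lip_ball_Mid (x : P) : lip_ball (@lip R Mid) x <->
  star x = x /\ [/\ forall m, lf m (val x.1) <= 1, forall m, lf m x.2 <= 1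
                  & nrm (gap x) <= 1 * dl].
Proof.
split=> [/lip_ball_of[sx /(lmid_le E beta dl_gt0)]//|[sx hx]].
by apply/lip_ball_of; split=> //; apply/(lmid_le E beta dl_gt0).
Qed.

Definition cexp_sub (a : A) : B := to_subalg (cexp_mem E_cexp n a).

Lemma cexp_sub_fix (x : B) : cexp_sub (val x) = x.
Proof.
apply: val_inj; exact: (cexp_fix An_incr E_cexp (leqnn n) (subalg_valP x)).
Qed.

(** This turns a state of $A_n \oplus A$ into one of $A \oplus A$ that only sees the second
    coordinate, as the pivot [(0, 1)] demands. *)
Lemma state_cexp_sub (phi : P -> R[i]) : states phi ->
  states (fun a : (A * A)%type => phi (cexp_sub a.2, a.2)).
Proof.
move=> sphi; have lphi := state_scalar sphi.
split.
- move=> c u v; rewrite -lphi; congr phi; congr pair.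
  by apply: val_inj => /=; rewrite (cexpD E_cexp) (cexpZ E_cexp).
- move=> [_ a] /=; set z := phi _.
  (* [cexp_pos_sub] gives positivity in $A_n$ only after adding [eta], and this in the first
     coordinate alone. The perturbation of [z] is [eta * p] with [p] at most 1, and [eta] tends to
     0. *)
  pose p := phi ((1, 0) : P).
  have p_pos : 0 <= p.
    rewrite /p; suff <- : star ((1, 0) : P) * (1, 0) = (1, 0) by exact: state_pos.
    have -> : star ((1, 0) : P) = (1, 0) by congr pair; [exact: star1|exact: star0].
    by congr pair; [exact: mulr1|exact: mulr0].
  have p1 : normc p <= 1.
    rewrite (le_trans (state_le_nrm sphi _))// nrm_pairE /= nrm0 nrm1.
    by rewrite ge_max lexx ler01.
  have key (eta : R) : 0 < eta -> 0 <= z + eta%:C * p.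
    move=> eta0.
    have [d Bd dE] := cexp_pos_sub An_fin tau_tracial (cexp_mem E_cexp n (star a * a))
      (cexp_pos (E_cexp n) (ex_intro _ a erefl)) eta0.
    have := state_pos sphi ((to_subalg Bd, a) : P).
    congr (0 <= _); rewrite /z /p -(scalarfZ lphi) -(scalarfD lphi); congr phi.
    congr pair; last by rewrite /= scaler0 addr0.
    by apply: val_inj; rewrite /= -dE.
  have [pI pR] := (complex_ge0 p).1 p_pos.
  have zre (eta : R) : 0 < eta -> Im z = 0 /\ 0 <= Re z + eta.
    move=> eta0; have /complex_ge0[hI hR] := key _ eta0.
    have pr1 : Re p <= 1 by rewrite (le_trans (ler_norm _))// (le_trans (Re_le_normc _)).
    move: hI hR; case: (z) => u v; move: pI pR pr1; case: (p) => p' q' /= -> pR pr1.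
    by rewrite !(mul0r, mulr0, subr0, addr0) => -> h; split=> //; nra.
  apply/complex_ge0; split; first by have [] := zre 1 ltr01.
  by apply/ler_addgt0Pr => eta eta0; have [_] := zre _ eta0.
- rewrite -(state1 sphi); congr phi; congr pair; apply: val_inj.
  exact: (cexp_fix An_incr E_cexp (leqnn n) (subalg1 _)).
Qed.

Definition ideal_mod_fst (w : ideal_mod (mid_ideal An I n)) :
  ideal_mod (ideal_cap I (An n)) := to_ideal_mod (proj1 (ideal_valP w)).

Definition ideal_mod_snd (w : ideal_mod (mid_ideal An I n)) : ideal_mod I :=
  to_ideal_mod (proj2 (ideal_valP w)).

Definition ideal_mod_pair (v : ideal_mod (ideal_cap I (An n))) (w : ideal_mod I) :
    ideal_mod (mid_ideal An I n) :=
  @to_ideal_mod _ _ (mid_ideal An I n) (val v, val w)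
    (conj (ideal_valP v) (ideal_valP w)).

Let tau_state : states tau. Proof. by case: tau_tracial. Qed.

Let pivot1 : P := (1, 0).
Let pivot2 : (A * A)%type := (0, 1).

Let pivot1C : 1 - pivot1 = (0, 1).
Proof. by congr pair; rewrite ?subrr ?subr0. Qed.

Let pivot2C : 1 - pivot2 = (1, 0).
Proof. by congr pair; rewrite ?subrr ?subr0. Qed.

Let states1_pivot1 phi : states1 pivot1 phi <-> states phi /\ phi ((0, 1) : P) = 0.
Proof.
by rewrite states1E pivot1C//; congr pair;
  [exact: star0|exact: star1|exact: mulr0|exact: mulr1].
Qed.

Let states1_pivot2 phi : states1 pivot2 phi <-> states phi /\ phi ((1, 0) : (A * A)%type) = 0.
Proof.
by rewrite states1E pivot2C//; congr pair;
  [exact: star1|exact: star0|exact: mulr1|exact: mulr0].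
Qed.

Lemma state_fst (A1 A2 : cstarAlgType R) (phi : A1 -> R[i]) : states phi ->
  states (fun x : (A1 * A2)%type => phi x.1).
Proof.
move=> [lin pos one]; split.
- by move=> c u v; rewrite -lin.
- by move=> x; exact: pos.
- exact: one.
Qed.

Lemma state_snd (A1 A2 : cstarAlgType R) (phi : A2 -> R[i]) : states phi ->
  states (fun x : (A1 * A2)%type => phi x.2).
Proof.
move=> [lin pos one]; split.
- by move=> c u v; rewrite -lin.
- by move=> x; exact: pos.
- exact: one.
Qed.

Let pivot1_le1 : nrm pivot1 <= 1.
Proof. by rewrite nrm_pairE /= nrm0 nrm1 ge_max lexx ler01. Qed.

Let pivot2_le1 : nrm pivot2 <= 1.
Proof. by rewrite nrm_pairE /= nrm0 nrm1 ge_max lexx ler01. Qed.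

Let state_val : states (fun x : B => tau (val x)).
Proof.
case: tau_state => lin pos one; split; [|by move=> x; exact: pos|exact: one].
by move=> c u v; rewrite -lin.
Qed.

Let states1_pivot1_inh : states1 pivot1 !=set0.
Proof.
exists (fun x => tau (val x.1)); apply/states1_pivot1; split.
  exact: (@state_fst B A _ state_val).
exact: (scalarf0 (state_scalar tau_state)).
Qed.

Let states1_pivot2_inh : states1 pivot2 !=set0.
Proof.
exists (fun x => tau x.2); apply/states1_pivot2; split; first exact: state_snd.
exact: (scalarf0 (state_scalar tau_state)).
Qed.

(** Both bridges are indexed by the whole middle unit ball, so there is no imprint on the middle
    side; on the outer sides it measures how far the two projections are from being onto. *)
Let mid_ball : Type := {p : ideal_mod (mid_ideal An I n) | @unit_ball R Mid p}.

Let mid_ball_fst (j : mid_ball) : @unit_ball R Wn (ideal_mod_fst (sval j)).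
Proof. by apply/unit_ball_Wn; have /unit_ball_Mid[h _ _] := svalP j. Qed.

Let mid_ball_snd (j : mid_ball) : @unit_ball R W (ideal_mod_snd (sval j)).
Proof.
apply/unit_ball_W; have /unit_ball_Mid[_ h _] := svalP j; split=> //.
exact: ideal_valP (ideal_mod_snd _).
Qed.

(** The diagonal lift has gap 0, so the projection onto the unit ball of $I_n$ is onto and the first
    bridge has no imprint. *)
Let ball_Wn_mid (w : ideal_mod (ideal_cap I (An n))) : @unit_ball R Wn w ->
  @unit_ball R Mid (ideal_mod_pair w (to_ideal_mod (ideal_valP w : ideal_set I (val (val w : B))))).
Proof.
move=> /unit_ball_Wn h; apply/unit_ball_Mid; split=> // xi _.
by rewrite /gap /= subrr mul0r nrm0 mul1r mulr_ge0// ltW.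
Qed.

Let mid_ball_inh : inhabited mid_ball.
Proof.
have h0 : @unit_ball R Wn 0.
  by apply/unit_ball_Wn => s; rewrite (fam0 df_fam).
exact: inhabits (exist _ _ (ball_Wn_mid h0)).
Qed.

Definition bridge_fin_mid : bridge Wn Mid :=
  @Bridge R Wn Mid P pivot1 pivot1_le1 states1_pivot1_inh
    (subalg_graph (B := An n) : {lrmorphism B -> P}) (idfun : {lrmorphism P -> P})
    (fun=> erefl) (fun=> erefl)
    (fun x y h => congr1 fst h) (fun x y h => h)
    mid_ball mid_ball_inh
    (fun j => ideal_mod_fst (sval j)) (fun j => sval j) mid_ball_fst (fun j => svalP j).

Lemma bridge_fin_mid_length : (bridge_length bridge_fin_mid <= dl%:E)%E.
Proof.
apply: bridge_length_le.
- rewrite /bridge_height ge_max; apply/andP; split; apply: hausdorff_le => phi.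
  + move=> sphi; exists phi.
      exists (fun x : P => phi x.1) => //; apply/states1_pivot1; split.
        exact: state_fst.
      exact: (scalarf0 (state_scalar sphi)).
    by apply: ge_ereal_sup => _ [a _ <-]; rewrite subrr normc0 lee_fin ltW.
  + move=> [psi /states1_pivot1[spsi _] <-]; exists (psi \o subalg_graph (B := An n)).
      exact: (@state_comp _ _ _ (subalg_graph (B := An n) : {lrmorphism B -> P})).
    by apply: ge_ereal_sup => _ [a _ <-]; rewrite subrr normc0 lee_fin ltW.
  (* The only place where the first bridge costs anything: replacing [x] by [(x.1, x.1)] moves it by
     its gap. *)
  + move=> sphi; pose psi (x : P) := phi (subalg_graph x.1).
    have spsi : states psi.
      apply: (@state_fst B A (phi \o subalg_graph (B := An n))).
      exact: (@state_comp _ _ _ (subalg_graph (B := An n) : {lrmorphism B -> P})).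
    exists psi.
      exists psi => //; apply/states1_pivot1; split=> //.
      exact: (scalarf0 (state_scalar sphi)).
    apply: ge_ereal_sup => _ [x /lip_ball_Mid[_ [_ _ hx]] <-]; rewrite lee_fin.
    rewrite /psi -(scalarfB (state_scalar sphi)) (le_trans (state_le_nrm sphi _))//.
    rewrite nrm_pairE /= subrr nrm0 ge_max (ltW dl_gt0) /= nrmB.
    by move: hx; rewrite mul1r.
  + move=> [psi /states1_pivot1[spsi _] <-]; exists psi => //.
    by apply: ge_ereal_sup => _ [a _ <-]; rewrite subrr normc0 lee_fin ltW.
- apply: hausdorff_le => _ [x hx <-].
  + move/lip_ball_Wn: hx => [sx lx].
    exists (pivot1 * subalg_graph x).
      exists (subalg_graph x) => //; apply/lip_ball_Mid; split.
        by congr pair => //; exact: (congr1 val sx).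
      by split=> //; rewrite /gap /= subrr nrm0 mul1r ltW.
    rewrite lee_fin; have -> : br_pi bridge_fin_mid x * br_pivot bridge_fin_mid - pivot1 * subalg_graph x = 0.
      by congr pair; rewrite /= ?mulr1 ?mul1r ?mulr0 ?mul0r subrr.
    by rewrite nrm0 ltW.
  + move/lip_ball_Mid: hx => [sx [l1 l2 _]].
    exists (subalg_graph x.1 * pivot1).
      exists x.1 => //; apply/lip_ball_Wn; split=> //; exact: (congr1 fst sx).
    rewrite lee_fin; have -> : subalg_graph x.1 * pivot1 - br_pivot bridge_fin_mid * br_pi' bridge_fin_mid x = 0.
      by congr pair; rewrite /= ?mulr1 ?mul1r ?mulr0 ?mul0r subrr.
    by rewrite nrm0 ltW.
- apply: ge_ereal_sup => _ [j _ <-]; apply: ge_ereal_sup => _ [k _ <-].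
  have zero (p q : P) : nrm (subalg_graph (p.1 * star q.1) * pivot1 - pivot1 * (p * star q)) = 0.
    suff -> : subalg_graph (p.1 * star q.1) * pivot1 - pivot1 * (p * star q) = 0.
      exact: nrm0.
    by congr pair; rewrite /= ?mulr1 ?mul1r ?mulr0 ?mul0r subrr.
  rewrite ge_max /bridge_norm !lee_fin; apply/andP; split; rewrite le_eqVlt; apply/orP; left; apply/eqP.
    exact: (zero (val (sval j)) (val (sval k))).
  exact: (zero (val (sval k)) (val (sval j))).
- rewrite /imprint ge_max; apply/andP; split; apply: hausdorff_le => w.
  + move=> [j _ <-]; exists (ideal_mod_fst (sval j)); first exact: mid_ball_fst.
    by rewrite (le_trans (kmetric_self _))// lee_fin ltW.
  + move=> hw; pose p : mid_ball := exist _ _ (ball_Wn_mid hw).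
    exists w; last by rewrite (le_trans (kmetric_self _))// lee_fin ltW.
    by exists p => //; apply: val_inj.
  + move=> [j _ <-]; exists (sval j); first exact: svalP.
    by rewrite (le_trans (kmetric_self _))// lee_fin ltW.
  + move=> hw; exists w; last by rewrite (le_trans (kmetric_self _))// lee_fin ltW.
    by exists (exist _ w hw).
Qed.

Lemma lfam_cexp m (a : A) : lf m (E n a) <= lf m a.
Proof.
have [nm|mn] := leqP n m.
  rewrite (lfam_eq0 An_incr E_cexp beta nm (cexp_mem E_cexp n a)).
  exact: (fam_ge0 lf_fam).
rewrite lfam_leP// divfK ?gt_eqF//.
rewrite (cexp_tower An_incr tau_tracial E_cexp _ (ltnW mn)).
have -> : E n a - E m a = E n (a - E m a).
  by rewrite (cexpB E_cexp) (cexp_tower_id An_incr E_cexp _ (ltnW mn)).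
exact: (cexp_nrm (E_cexp n)).
Qed.

Let pair_inj : injective (subalg_pair (B := An n)).
Proof. by move=> [x1 x2] [y1 y2] [/val_inj -> ->]. Qed.

Definition bridge_mid_ideal : bridge Mid W :=
  @Bridge R Mid W (A * A)%type pivot2 pivot2_le1 states1_pivot2_inh
    (subalg_pair (B := An n) : {lrmorphism P -> (A * A)%type})
    (@diagonal R A : {lrmorphism A -> (A * A)%type})
    (fun=> erefl) (fun=> erefl)
    pair_inj (fun x y h => congr1 fst h)
    mid_ball mid_ball_inh
    (fun j => sval j) (fun j => ideal_mod_snd (sval j)) (fun j => svalP j) mid_ball_snd.

Hypothesis beta_le_dl : beta n <= 2 * dl.
Hypothesis beta_ratio_dl : forall m, (m < n)%N -> 2 * beta n <= 2 * dl * beta m.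

(* [v] is within [3 dl] of [w] for [kmetric]; the pair [(v, (v + 2 w) / 3)]
   covers two thirds of this distance, and the imprint the last third. *)
Lemma mid_ball_near (w : ideal_mod I) : @unit_ball R W w ->
  exists j : mid_ball, (@kmetric R W w (ideal_mod_snd (sval j)) <= dl%:E)%E.
Proof.
move=> /unit_ball_W wb.
have [v [Bv vb hv]] := ball_approximation An_incr tau_tracial E_cexp beta_gt0 e_unit
  beta_le_dl beta_ratio_dl wb.
pose w0 : A := val w.
pose w2 : A := (1 / 3 : R)%:C *: v + (2 / 3 : R)%:C *: w0.
have Iw2 : ideal_set I w2.
  by apply: Defs.idealD; rewrite -mulr_algl; apply: Defs.idealMl; [exact: vb.1|exact: wb.1].
have Jv : ideal_set (ideal_cap I (An n)) (to_subalg Bv) by exact: vb.1.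
pose p := ideal_mod_pair (to_ideal_mod Jv) (to_ideal_mod Iw2).
have third : `|1 / 3 : R| = 1 / 3 by rewrite ger0_norm// divr_ge0.
have twothird : `|2 / 3 : R| = 2 / 3 by rewrite ger0_norm// divr_ge0.
have pb : @unit_ball R Mid p.
  apply/unit_ball_Mid; split.
  - exact: vb.2.
  - move=> s; rewrite /= (le_trans (fam_add df_fam _ _ _))//.
    rewrite !(fam_scale df_fam) !normc_real third twothird.
    by have := vb.2 s; have := wb.2 s; rewrite -/w0; lra.
  - move=> xi xb; have -> : gap (val p : P) = (- (2 / 3) : R)%:C *: (w0 - v).
      rewrite /gap /= /w2 scalerBr rmorphN /= !scaleNr opprK opprD addrA addrC.
      congr (_ + _); rewrite -{1}(scale1r v) -scalerBl; congr (_ *: _).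
      apply/eqP; rewrite eq_complex /=; apply/andP; split; apply/eqP; lra.
    rewrite -scalerAl nrmZR normrN twothird.
    by have := hv xi xb; rewrite -/w0; lra.
exists (exist _ p pb); apply: ge_ereal_sup => _ [u /unit_ball_W ub <-]; rewrite lee_fin.
have -> : inner w u - inner (ideal_mod_snd p) u =
    (1 / 3 : R)%:C *: ((w0 - v) * star (val u : A)).
  rewrite scalerAl /inner /= /ideal_inner -mulrBl /= -/w0; congr (_ * _).
  have key : w0 = (1 / 3 : R)%:C *: w0 + (2 / 3 : R)%:C *: w0.
    rewrite -scalerDl -{1}(scale1r w0); congr (_ *: _).
    by apply/eqP; rewrite eq_complex /=; apply/andP; split; apply/eqP; lra.
  by rewrite {1}key /w2 [_ *: v + _]addrC addrKA -scalerBr.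
rewrite nrmZR third; by have := hv _ ub; lra.
Qed.

Lemma bridge_mid_ideal_length : (bridge_length bridge_mid_ideal <= dl%:E)%E.
Proof.
apply: bridge_length_le.
- rewrite /bridge_height ge_max; apply/andP; split; apply: hausdorff_le => phi.
  (* The second coordinate determines the new state, with [E n x.2] in place of [x.1]; the error is
     $E_n$ of the gap, hence at most [dl]. *)
  + move=> sphi; pose psi (a : (A * A)%type) := phi (cexp_sub a.2, a.2).
    have spsi : states psi by exact: state_cexp_sub.
    exists (psi \o subalg_pair (B := An n)).
      exists psi => //; apply/states1_pivot2; split=> //.
      rewrite /psi /=; have -> : cexp_sub 0 = 0 by apply: val_inj; exact: (cexp0 E_cexp).
      exact: (scalarf0 (state_scalar sphi)).
    apply: ge_ereal_sup => _ [x /lip_ball_Mid[_ [_ _ hx]] <-]; rewrite lee_fin.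
    rewrite /psi /= -(scalarfB (state_scalar sphi)) (le_trans (state_le_nrm sphi _))//.
    rewrite nrm_pairE /= subrr nrm0 ge_max (ltW dl_gt0) andbT.
    rewrite -{1}(cexp_sub_fix x.1); move: hx; rewrite mul1r; apply: le_trans.
    have -> : nrm (cexp_sub (val x.1) - cexp_sub x.2) = nrm (E n (gap x)).
      by rewrite /gap (cexpB E_cexp).
    exact: (cexp_nrm (E_cexp n)).
  + move=> [psi /states1_pivot2[spsi _] <-]; exists (psi \o subalg_pair (B := An n)).
      exact: (@state_comp _ _ _ (subalg_pair (B := An n) : {lrmorphism P -> (A * A)%type})).
    by apply: ge_ereal_sup => _ [a _ <-]; rewrite subrr normc0 lee_fin ltW.
  + move=> sphi; exists phi.
      exists (fun x : (A * A)%type => phi x.2) => //; apply/states1_pivot2; split.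
        exact: state_snd.
      exact: (scalarf0 (state_scalar sphi)).
    by apply: ge_ereal_sup => _ [a _ <-]; rewrite subrr normc0 lee_fin ltW.
  + move=> [psi /states1_pivot2[spsi _] <-]; exists (psi \o @diagonal R A).
      exact: (@state_comp _ _ _ (@diagonal R A : {lrmorphism A -> (A * A)%type})).
    by apply: ge_ereal_sup => _ [a _ <-]; rewrite subrr normc0 lee_fin ltW.
- apply: hausdorff_le => _ [a ha <-].
  + move/lip_ball_Mid: ha => [sx [_ l2 _]].
    exists (pivot2 * diagonal a.2).
      exists a.2 => //; apply/lip_ball_W; split=> //; exact: (congr1 snd sx).
    rewrite lee_fin; have -> : br_pi bridge_mid_ideal a * br_pivot bridge_mid_ideal
        - pivot2 * diagonal a.2 = 0.
      by congr pair; rewrite /= ?mulr1 ?mul1r ?mulr0 ?mul0r subrr.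
    by rewrite nrm0 ltW.
  + move/lip_ball_W: ha => [sa la].
    (* The midpoint splits [nrm (a - E n a)], at most [2 * dl], evenly between the gap of the pair
       [(E n a, a2)] and the basic reach [nrm (a2 - a)]. *)
    pose a2 : A := (1 / 2 : R)%:C *: (a + E n a).
    have sE : star (E n a) = E n a by rewrite -(cexp_star tau_tracial E_cexp) sa.
    have half : `|1 / 2 : R| = 1 / 2 by rewrite ger0_norm// divr_ge0.
    have halfE (c : A) : c = (1 / 2 : R)%:C *: (c + c).
      rewrite -{2 3}(scale1r c) -scalerDl scalerA -{1}(scale1r c); congr (_ *: _).
      apply/eqP; rewrite eq_complex /=; apply/andP; split; apply/eqP; lra.
    have small (c : A) : nrm ((1 / 2 : R)%:C *: (a - E n a)) <= dl.
      rewrite nrmZR half; have : nrm (a - E n a) <= beta n by exact: lfam_le1.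
      by move: beta_le_dl; lra.
    exists (subalg_pair (cexp_sub a, a2) * pivot2).
      exists (cexp_sub a, a2) => //; apply/lip_ball_Mid; split.
        congr pair; first exact: val_inj.
        by rewrite /a2 star_real_scale starD sa sE.
      split=> [m|m|].
      - by rewrite (le_trans (lfam_cexp _ _)).
      - rewrite /= (fam_scale lf_fam) normc_real half.
        exact: half_sum_le (fam_add lf_fam m a (E n a)) (lfam_cexp m a) (la m).
      - rewrite mul1r /gap /= [X in X - _]halfE /a2 -scalerBr opprD addrACA subrr addr0.
        by rewrite -nrmN -scalerN opprB small.
    rewrite lee_fin; have -> : subalg_pair (cexp_sub a, a2) * pivot2
        - br_pivot bridge_mid_ideal * br_pi' bridge_mid_ideal a = (0, a2 - a).
      by congr pair; rewrite /= ?mulr1 ?mul1r ?mulr0 ?mul0r ?subrr.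
    rewrite nrm_pairE /= nrm0 ge_max (ltW dl_gt0) /= nrmB.
    rewrite [X in X - _]halfE /a2 -scalerBr opprD addrACA subrr add0r.
    exact: small.
- apply: ge_ereal_sup => _ [j _ <-]; apply: ge_ereal_sup => _ [k _ <-].
  have zero (p q : P) : nrm (subalg_pair (p * star q) * pivot2 - pivot2 * diagonal (p.2 * star q.2)) = 0.
    suff -> : subalg_pair (p * star q) * pivot2 - pivot2 * diagonal (p.2 * star q.2) = 0.
      exact: nrm0.
    by congr pair; rewrite /= ?mulr1 ?mul1r ?mulr0 ?mul0r subrr.
  rewrite ge_max /bridge_norm !lee_fin; apply/andP; split; rewrite le_eqVlt; apply/orP; left; apply/eqP.
    exact: (zero (val (sval j)) (val (sval k))).
  exact: (zero (val (sval k)) (val (sval j))).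
- rewrite /imprint ge_max; apply/andP; split; apply: hausdorff_le => w.
  + move=> [j _ <-]; exists (sval j); first exact: svalP.
    by rewrite (le_trans (kmetric_self _))// lee_fin ltW.
  + move=> hw; exists w; last by rewrite (le_trans (kmetric_self _))// lee_fin ltW.
    by exists (exist _ w hw).
  + move=> [j _ <-]; exists (ideal_mod_snd (sval j)); first exact: mid_ball_snd.
    by rewrite (le_trans (kmetric_self _))// lee_fin ltW.
  + move=> /mid_ball_near[j hj]; exists (ideal_mod_snd (sval j)); first by exists j.
    rewrite (le_trans _ hj)//; apply: ge_ereal_sup => _ [u ub <-].
    by rewrite nrmB; apply: ereal_sup_ubound; exists u.
Qed.

End Bridges.

(** * Admissibility, the propinquity bound and its limit *)

Lemma AF_admissible (R : realType) : admissible_triple (@FAF R) (@GAF R) (@HAF R).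
Proof.
split; split; rewrite /GAF /HAF /FAF.
- by move=> *; rewrite mulr_ge0// addr_ge0// mulr_ge0.
- move=> x1 x2 x3 x4 y1 y2 y3 y4 /andP[? ?] /andP[? ?] /andP[? ?] /andP[? ?].
  by rewrite ler_wpM2l// lerD// ler_pM.
- move=> x1 x2 x3 x4 h1 h2 h3 h4.
  have := mulr_ge0 h1 h4; have := mulr_ge0 h2 h3; lra.
- by move=> *; rewrite mulr_ge0// addr_ge0// mulr_ge0.
- move=> x y z x' y' z' /andP[? ?] /andP[? ?] /andP[? ?].
  by rewrite ler_wpM2l// lerD// ler_pM.
- move=> x y z h1 h2 h3; rewrite mulrDl.
  have := mulr_ge0 h1 h3; have := mulr_ge0 h2 h3; lra.
- by move=> *; rewrite mulr_ge0// addr_ge0// mulr_ge0.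
- move=> x y x' y' /andP[? ?] /andP[? ?].
  by rewrite ler_wpM2l// lerD// ler_pM.
- move=> x y h1 h2; have := mulr_ge0 h1 h2; lra.
Qed.

Theorem proposition2p1 (R : realType) (A : cstarAlgType R)
    (An : nat -> cstarSubalg A)
    (An_incr : forall n, An n `<=` An n.+1)
    (An_fin : forall n, finite_dim (An n))
    (A0_scalars : An 0%N = range (fun c : R[i] => c%:A) :> set A)
    (An_dense : closure (\bigcup_n (An n : set A) : set (mtop A)) = setT)
    (tau : A -> R[i]) (tau_tracial : faithful_tracial tau)
    (E : nat -> A -> A) (E_cexp : forall n, cond_expectation tau (An n) (E n))
    (beta : nat -> R) (beta_gt0 : forall n, 0 < beta n)
    (beta_cvg0 : beta @ \oo --> (0 : R))
    (beta_ratio : (fun n => beta n.+1 / beta n) @ \oo --> (0 : R))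
    (I : closedIdeal A) (one_ : nat -> A)
    (one_unit : forall n, is_unit_of ((I : set A) `&` An n) (one_ n)) :
  let W := ideal_bundle E beta I one_ in
  let Wn n := fin_ideal_bundle E beta I one_ (An n) in
  let Lambda := propinquity (@FAF R) (@GAF R) (@HAF R) in
  [/\ admissible_triple (@FAF R) (@GAF R) (@HAF R),
      metrized_bundle (@FAF R) (@GAF R) (@HAF R) W /\
        (forall n, metrized_bundle (@FAF R) (@GAF R) (@HAF R) (Wn n)),
      (fun n => Lambda (Wn n) W) @ \oo --> (0%E : \bar R),
      forall n, (0 < n)%N ->
        (Lambda (Wn n) W <= (Num.max (beta n) (xseq beta n - 1))%:E)%E
    & (fun n => Num.max (beta n) (xseq beta n - 1)) @ \oo --> (0 : R)].
Proof.
move=> W Wn Lambda.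
have mbW : metrized_bundle (@FAF R) (@GAF R) (@HAF R) W.
  exact: (ideal_bundle_metrized An_incr An_fin A0_scalars An_dense tau_tracial
    E_cexp beta_gt0 beta_cvg0 one_unit).
have mbWn n : metrized_bundle (@FAF R) (@GAF R) (@HAF R) (Wn n).
  exact: (fin_ideal_bundle_metrized An_incr An_fin A0_scalars tau_tracial
    E_cexp beta_gt0 one_unit).
have bound n : (0 < n)%N ->
    (Lambda (Wn n) W <= (Num.max (beta n) (xseq beta n - 1))%:E)%E.
  move=> n0; rewrite xseq_max; set eps := xseq beta n - 1.
  have beps : beta n <= eps by exact: xseq_ge_beta.
  have dl0 : 0 < eps / 2 by rewrite divr_gt0// (lt_le_trans (beta_gt0 n)).
  have epsE : 2 * (eps / 2) = eps by field.
  have mbMid := mid_bundle_metrized An_incr An_fin A0_scalars An_dense tau_tracial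
    E_cexp beta_gt0 beta_cvg0 one_unit n dl0.
  have [g1 g1_le] : exists g : bridge (Wn n) (mid_bundle An E beta I one_ n (eps / 2)),
      (bridge_length g <= (eps / 2)%:E)%E.
    by eexists; exact: (bridge_fin_mid_length An_incr tau_tracial E_cexp beta_gt0 one_unit n dl0).
  have [g2 g2_le] : exists g : bridge (mid_bundle An E beta I one_ n (eps / 2)) W,
      (bridge_length g <= (eps / 2)%:E)%E.
    eexists; apply: (bridge_mid_ideal_length An_incr An_fin tau_tracial E_cexp beta_gt0 one_unit dl0).
      by rewrite epsE.
    by move=> m mn; rewrite epsE; exact: xseq_ge_ratio.
  have -> : eps%:E = ((eps / 2)%:E + (eps / 2)%:E)%E by rewrite -EFinD -splitr.
  apply: (@le_trans _ _ (bridge_length g1 + bridge_length g2)%E); last exact: leeD.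
  apply: ereal_inf_lbound.
  by exists (trek_cons (mbWn n) g1 (trek_one mbMid mbW g2)).
have xs_cvg := xseq_cvg beta_gt0 beta_cvg0 beta_ratio.
split=> //; first exact: AF_admissible.
apply: (@squeeze_cvge _ _ _ _ (fun=> 0%E) _
  (fun n => (Num.max (beta n) (xseq beta n - 1))%:E)).
- exists 1%N => // n /= n0; rewrite bound// andbT.
  by apply: le_ereal_inf_tmp => _ [t ->]; exact: trek_length_ge0.
- exact: cvg_cst.
- by apply: cvg_EFin => //; apply: nearW.
Qed.
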